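(* Let $\varphi$ and $\psi$ be linear fractional self-maps of the unit disk $D$, at least one of which is not an automorphism of $D$. Then the commutator $[C_\psi^{\ast}, C_\varphi]$ is non-trivially compact on the Dirichlet space $\mathcal{D}(D)$ if and only if one of the following holds: (i) $\varphi$ and $\psi$ are both parabolic with the same boundary fixed point; (ii) $\varphi$ and $\psi$ are both hyperbolic, with the fixed points of $\varphi$ being $\zeta$ and $a$ and the fixed points of $\psi$ being $\zeta$ and $1/\overline{a}$, for some $\zeta\in\partial D$.
   Context: A linear fractional self-map of $D$ is $\varphi(z)=\frac{az+b}{cz+d}$ with $ad-bc\neq0$ mapping $D$ into $D$. The Dirichlet space $\mathcal{D}(D)$ consists of holomorphic $f=\sum_{n\ge0}c_nz^n$ on $D$ with $\|f\|^2=|c_0|^2+\sum_{n\ge1}n|c_n|^2<\infty$. $C_\varphi f=f\circ\varphi$, $C_\psi^\ast$ is the adjoint in $\mathcal{D}(D)$, $[C_\psi^\ast,C_\varphi]=C_\psi^\ast C_\varphi-C_\varphi C_\psi^\ast$; it is non-trivially compact if it is compact and nonzero and neither $C_\psi^\ast C_\varphi$ nor $C_\varphi C_\psi^\ast$ is compact. A linear fractional self-map of $D$ with a fixed point on $\partial D$ is called parabolic if that boundary point is its only fixed point (in the extended complex plane), and hyperbolic if it has an additional fixed point. *)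

(* Defs.v *)
From Stdlib Require Import Reals.
Open Scope R_scope.

Definition Cx := (R * R)%type.
Definition Cre (z : Cx) : R := fst z.
Definition Cim (z : Cx) : R := snd z.
Definition C0 : Cx := (0, 0).
Definition C1 : Cx := (1, 0).
Definition Cadd (z w : Cx) : Cx := (fst z + fst w, snd z + snd w).
Definition Copp (z : Cx) : Cx := (- fst z, - snd z).
Definition Csub (z w : Cx) : Cx := Cadd z (Copp w).
Definition Cmul (z w : Cx) : Cx :=
  (fst z * fst w - snd z * snd w, fst z * snd w + snd z * fst w).
Definition Cconj (z : Cx) : Cx := (fst z, - snd z).
Definition Cnorm2 (z : Cx) : R := fst z * fst z + snd z * snd z.
Definition Cinv (z : Cx) : Cx := (fst z / Cnorm2 z, - snd z / Cnorm2 z).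
Definition Cdiv (z w : Cx) : Cx := Cmul z (Cinv w).
Fixpoint Cpow (z : Cx) (n : nat) : Cx :=
  match n with O => C1 | S m => Cmul z (Cpow z m) end.
Definition RtoC (r : R) : Cx := (r, 0).

Definition in_disk (z : Cx) : Prop := Cnorm2 z < 1.
Definition on_circle (z : Cx) : Prop := Cnorm2 z = 1.

Definition Cseries (u : nat -> Cx) (l : Cx) : Prop :=
  infinite_sum (fun n => fst (u n)) (fst l) /\
  infinite_sum (fun n => snd (u n)) (snd l).

(* A holomorphic f = sum c_n z^n on D is identified with its coefficient
   sequence c.  ||f||^2 = |c_0|^2 + sum_{n>=1} n |c_n|^2. *)
Definition coefs := nat -> Cx.
Definition dweight (n : nat) : R := match n with O => 1 | _ => INR n end.

Definition dnorm2_is (f : coefs) (l : R) : Prop :=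
  infinite_sum (fun n => dweight n * Cnorm2 (f n)) l.

Definition InD (f : coefs) : Prop := exists l, dnorm2_is f l.

Definition dinner_is (f g : coefs) (v : Cx) : Prop :=
  Cseries (fun n => Cmul (RtoC (dweight n)) (Cmul (f n) (Cconj (g n)))) v.

Definition fval_is (f : coefs) (z : Cx) (v : Cx) : Prop :=
  Cseries (fun n => Cmul (f n) (Cpow z n)) v.

Definition csub (f g : coefs) : coefs := fun n => Csub (f n) (g n).

Definition op := coefs -> coefs.

Definition is_comp_op (phi : Cx -> Cx) (T : op) : Prop :=
  forall f, InD f ->
    InD (T f) /\
    forall z, in_disk z ->
      exists v, fval_is f (phi z) v /\ fval_is (T f) z v.

Definition is_adjoint (T S : op) : Prop :=
  forall g, InD g ->
    InD (S g) /\
    forall f, InD f -> forall v, dinner_is (T f) g v -> dinner_is f (S g) v.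

Definition compose_op (S T : op) : op := fun f => S (T f).
Definition commutator (S T : op) : op :=
  fun f => csub (S (T f)) (T (S f)).

(* K is a compact operator on D: it maps D into D and every bounded
   sequence in D has a subsequence whose image is Cauchy (hence convergent,
   D being complete) in the norm of D. *)
Definition compact_on_D (K : op) : Prop :=
  (forall f, InD f -> InD (K f)) /\
  forall u : nat -> coefs,
    (forall k, InD (u k)) ->
    (exists M, forall k l, dnorm2_is (u k) l -> l <= M) ->
    exists sub : nat -> nat,
      (forall k, (sub k < sub (S k))%nat) /\
      forall eps, eps > 0 -> exists N, forall i j, (i >= N)%nat -> (j >= N)%nat ->
        forall l, dnorm2_is (csub (K (u (sub i))) (K (u (sub j)))) l -> l < eps.

Definition nonzero_on_D (K : op) : Prop :=
  exists f, InD f /\ exists n, K f n <> C0.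

Definition nontrivially_compact_comm (S T : op) : Prop :=
  compact_on_D (commutator S T) /\ nonzero_on_D (commutator S T) /\
  ~ compact_on_D (compose_op S T) /\ ~ compact_on_D (compose_op T S).

Definition lft (a b c d : Cx) (z : Cx) : Cx :=
  Cdiv (Cadd (Cmul a z) b) (Cadd (Cmul c z) d).

Definition lf_selfmap (a b c d : Cx) : Prop :=
  Csub (Cmul a d) (Cmul b c) <> C0 /\
  forall z, in_disk z -> Cadd (Cmul c z) d <> C0 /\ in_disk (lft a b c d z).

Definition is_disk_aut (phi : Cx -> Cx) : Prop :=
  (forall z w, in_disk z -> in_disk w -> phi z = phi w -> z = w) /\
  (forall w, in_disk w -> exists z, in_disk z /\ phi z = w).

(* points of the extended plane: Some z finite, None = infinity *)
Definition ext := option Cx.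

Definition lft_fixed (a b c d : Cx) (p : ext) : Prop :=
  match p with
  | Some z => Cadd (Cmul c z) d <> C0 /\ lft a b c d z = z
  | None => c = C0
  end.

Definition parabolic_at (a b c d : Cx) (zeta : Cx) : Prop :=
  on_circle zeta /\ lft_fixed a b c d (Some zeta) /\
  forall p, lft_fixed a b c d p -> p = Some zeta.

Definition is_parabolic (a b c d : Cx) : Prop :=
  exists zeta, parabolic_at a b c d zeta.

Definition is_hyperbolic (a b c d : Cx) : Prop :=
  exists zeta, on_circle zeta /\ lft_fixed a b c d (Some zeta) /\
    exists p, p <> Some zeta /\ lft_fixed a b c d p.

Definition inv_conj_is (p q : ext) : Prop :=
  match p, q with
  | Some z, Some w => z <> C0 /\ w = Cinv (Cconj z)
  | Some z, None => z = C0
  | None, Some w => w = C0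
  | None, None => False
  end.

(* Main.v *)
Require Import Defs.
From Stdlib Require Import Reals Lra Lia Classical ClassicalEpsilon FunctionalExtensionality.
From Coquelicot Require Import Coquelicot.
Open Scope R_scope.
Open Scope C_scope.

(** An element f of the Dirichlet space is handled through the pair (f(0), f').  The derivative
kernel e_s(z) = z/(1 - s z) satisfies <f, e_s> = f'(conj s), and composing it with a Moebius map M
gives again a constant plus a multiple of some e_t.  Hence, with sigma the Krein adjoint of psi,
(C_psi^* g)' = (g o sigma)' + g(0) K' and (C_psi^* g)(0) = g(0), where K is the reproducing kernel
at psi(0).  So up to finite rank the two products are C_(phi o sigma) and C_(sigma o phi).

If these two symbols agree, the commutator has finite rank.  A product whose symbol keeps the disk
away from the circle is compact.  Conversely, suppose that the symbol tau1 = phi o sigma touches the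
circle.  Evaluate a compact commutator on the normalized kernels e_(conj w), with w = w_x running
through a horocycle at the touching point.  The images have squared norm
h1^2 + h2^2 - 2 Re X, where h_i is the hyperbolic derivative of the Krein adjoint of tau_i at w,
h1 is constant along the horocycle, and |X| = h1 h2 (1 - rho^2), with rho the pseudo-hyperbolic
distance between the two Krein adjoints at w.  As w tends to the circle the norms must become small,
which forces a polynomial in x to vanish identically, that is, phi o sigma = sigma o phi.
The rest is about commuting Moebius self-maps of the disk: a self-map that is not an automorphism
touches the circle at most once, so phi and sigma share a fixed point zeta on the circle, and two
commuting non-identical maps fixing zeta have the same second fixed point. *)

(** * Complex series *)

(** The derivative kernels are rational, so composing one with a Moebius map only moves its pole;
    the reproducing kernels are logarithms and would be harder to follow. The horocycle is chosen
    because w = eta i x / (1 + i x) makes everything polynomial in the real parameter x. Numerators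
    and denominators of the image kernels become affine in x. The gap |den|^2 - |num|^2 of a
    touching map is a positive quadratic whose leading coefficient vanishes, hence a constant. The
    obstruction to equality of the two symbols is a quadratic W in x, and smallness at arbitrarily
    large integers annihilates all its coefficients. The Krein adjoint is the inverse map conjugated
    by inversion in the circle. Passing from psi to sigma therefore inverts the fixed points, which
    is the origin of the pair a, 1 / conj a in (ii). The second fixed point is taken as the second
    root of a quadratic, so it equals zeta for a parabolic map. Cases (i) and (ii) then become one
    algebraic condition: same zeta, same second root. Equal symbols still leave finite-rank terms in
    the commutator; that these do not cancel is a separate computation on the functions 1 and z. *)

Lemma infinite_sum_series (u : nat -> R) (l : R) : infinite_sum u l <-> is_series u l.
Proof. symmetry; apply is_series_Reals. Qed.

(** Total, since [Series] is; the computation rules below assume absolute convergence [Cabs]. It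
    turns the relational [Cseries] of the definitions into equations between values. *)
Definition Csum (u : nat -> C) : C := (Series (fun n => Re (u n)), Series (fun n => Im (u n))).

Definition Cabs (u : nat -> C) : Prop := ex_series (fun n => Cmod (u n)).

Lemma im_le_Cmod (z : C) : (Rabs (Im z) <= Cmod z)%R.
Proof. apply Rle_trans with (2 := Rmax_Cmod z); apply Rmax_r. Qed.

(** One parameter under an absolute and a linear bound; most later choices of a small constant are
    instances, with [K] collecting the error terms. *)
Lemma small_pos (a K b : R) : (0 < a)%R -> (0 < K)%R -> (0 < b)%R ->
  exists t, (0 < t)%R /\ (t <= a)%R /\ (t * K <= b)%R.
Proof.
  intros Ha HK Hb; exists (Rmin a (b / K)%R).
  assert (H : (0 < b / K)%R) by now apply Rdiv_lt_0_compat.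
  repeat split; [now apply Rmin_glb_lt|apply Rmin_l|].
  apply Rle_trans with (b / K * K)%R; [apply Rmult_le_compat_r; [lra|apply Rmin_r]|right; field; lra].
Qed.

Lemma Cmod_0_lt_1 : (Cmod 0 < 1)%R.
Proof. rewrite Cmod_0; lra. Qed.

Lemma ex_series_dom (a b : nat -> R) :
  (forall n, Rabs (a n) <= b n)%R -> ex_series b -> ex_series a.
Proof. intros H Hb; apply (ex_series_le (a : nat -> R_CompleteNormedModule) b); auto. Qed.

Lemma exR_scal (c : R) (a : nat -> R) : ex_series a -> ex_series (fun n => c * a n)%R.
Proof. intros H; exact (ex_series_scal c a H). Qed.

Lemma exR_plus (a b : nat -> R) : ex_series a -> ex_series b -> ex_series (fun n => a n + b n)%R.
Proof. intros Ha Hb; exact (ex_series_plus a b Ha Hb). Qed.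

Lemma exR_ext (a b : nat -> R) : (forall n, a n = b n) -> ex_series a -> ex_series b.
Proof. exact (ex_series_ext a b). Qed.

Lemma Cabs_Re (u : nat -> C) : Cabs u -> ex_series (fun n => Re (u n)).
Proof.
  intros H; apply (ex_series_le (fun n => Re (u n)) (fun n => Cmod (u n))); auto.
  intros n; apply re_le_Cmod.
Qed.

Lemma Cabs_Im (u : nat -> C) : Cabs u -> ex_series (fun n => Im (u n)).
Proof.
  intros H; apply (ex_series_le (fun n => Im (u n)) (fun n => Cmod (u n))); auto.
  intros n; apply im_le_Cmod.
Qed.

Lemma Cabs_Cseries (u : nat -> C) : Cabs u -> Cseries u (Csum u).
Proof.
  intros H; split; apply infinite_sum_series, Series_correct.
  - now apply Cabs_Re.
  - now apply Cabs_Im.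
Qed.

Lemma Cseries_unique (u : nat -> C) (l : C) : Cseries u l -> Csum u = l.
Proof.
  intros [H1 H2]; destruct l as [x y]; unfold Csum; f_equal; apply is_series_unique;
    apply infinite_sum_series; assumption.
Qed.

Lemma Csum_ext (u v : nat -> C) : (forall n, u n = v n) -> Csum u = Csum v.
Proof. intros H; unfold Csum; f_equal; apply Series_ext; intros n; now rewrite H. Qed.

Lemma Cseries_ext (u v : nat -> C) (l : C) : (forall n, u n = v n) -> Cseries u l -> Cseries v l.
Proof.
  intros H [H1 H2]; split; apply infinite_sum_series; [apply infinite_sum_series in H1|apply infinite_sum_series in H2];
  eapply is_series_ext; eauto; intros n; cbn; now rewrite H.
Qed.

Lemma Cseries_plus (u v : nat -> C) (l m : C) :
  Cseries u l -> Cseries v m -> Cseries (fun n => u n + v n) (l + m).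
Proof.
  intros [H1 H2] [H3 H4]; rewrite !infinite_sum_series in *; split; rewrite infinite_sum_series.
  - exact (is_series_plus _ _ _ _ H1 H3).
  - exact (is_series_plus _ _ _ _ H2 H4).
Qed.

Lemma Cseries_scal (c : C) (u : nat -> C) (l : C) :
  Cseries u l -> Cseries (fun n => c * u n) (c * l).
Proof.
  intros [H1 H2]; rewrite !infinite_sum_series in *; split; rewrite infinite_sum_series; cbn.
  - exact (is_series_minus _ _ _ _ (is_series_scal (fst c) _ _ H1) (is_series_scal (snd c) _ _ H2)).
  - exact (is_series_plus _ _ _ _ (is_series_scal (fst c) _ _ H2) (is_series_scal (snd c) _ _ H1)).
Qed.

Lemma Cseries_conj (u : nat -> C) (l : C) :
  Cseries u l -> Cseries (fun n => Cconj (u n)) (Cconj l).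
Proof.
  intros [H1 H2]; rewrite !infinite_sum_series in *; split; rewrite infinite_sum_series; cbn; auto.
  exact (is_series_opp _ _ H2).
Qed.

Lemma Cseries_incr (u : nat -> C) (l : C) :
  Cseries (fun n => u (S n)) l -> Cseries u (u 0%nat + l).
Proof.
  intros [H1 H2]; rewrite !infinite_sum_series in *; split; rewrite infinite_sum_series; cbn;
  apply is_series_decr_1.
  - replace (plus _ _) with (fst l); auto. change (fst l = fst (u 0%nat) + fst l + - fst (u 0%nat))%R; ring.
  - replace (plus _ _) with (snd l); auto. change (snd l = snd (u 0%nat) + snd l + - snd (u 0%nat))%R; ring.
Qed.

Lemma Cabs_shift (u : nat -> C) : Cabs (fun n => u (S n)) <-> Cabs u.
Proof. unfold Cabs; split; intros H; [apply ex_series_incr_1|apply (ex_series_incr_1 (fun n => Cmod (u n)))]; auto. Qed.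

Lemma Cabs_le (u : nat -> C) (b : nat -> R) :
  (forall n, Cmod (u n) <= b n)%R -> ex_series b -> Cabs u.
Proof.
  intros H Hb; apply (ex_series_le (fun n => Cmod (u n)) b); auto.
  intros n; change (Rabs (Cmod (u n)) <= b n)%R; rewrite Rabs_pos_eq; auto; apply Cmod_ge_0.
Qed.

Lemma Cabs_plus (u v : nat -> C) : Cabs u -> Cabs v -> Cabs (fun n => u n + v n).
Proof.
  intros Hu Hv; apply Cabs_le with (fun n => Cmod (u n) + Cmod (v n))%R.
  - intros n; apply Cmod_triangle.
  - apply (ex_series_plus (fun n => Cmod (u n)) (fun n => Cmod (v n))); auto.
Qed.

Lemma Cabs_scal (c : C) (u : nat -> C) : Cabs u -> Cabs (fun n => c * u n).
Proof.
  intros Hu; apply Cabs_le with (fun n => Cmod c * Cmod (u n))%R.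
  - intros n; rewrite Cmod_mult; lra.
  - apply (ex_series_scal (Cmod c) (fun n => Cmod (u n))); auto.
Qed.

Lemma Csum_plus (u v : nat -> C) : Cabs u -> Cabs v -> Csum (fun n => u n + v n) = Csum u + Csum v.
Proof. intros; apply Cseries_unique, Cseries_plus; now apply Cabs_Cseries. Qed.

Lemma Csum_scal (c : C) (u : nat -> C) : Cabs u -> Csum (fun n => c * u n) = c * Csum u.
Proof. intros; apply Cseries_unique, Cseries_scal; now apply Cabs_Cseries. Qed.

Lemma Csum_minus (u v : nat -> C) : Cabs u -> Cabs v -> Csum (fun n => u n - v n) = Csum u - Csum v.
Proof.
  intros; apply Cseries_unique.
  apply Cseries_ext with (fun n => u n + (-(1)) * v n); [intros; ring|].
  replace (Csum u - Csum v) with (Csum u + (-(1)) * Csum v) by ring.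
  apply Cseries_plus, Cseries_scal; now apply Cabs_Cseries.
Qed.

Lemma Csum_conj (u : nat -> C) : Cabs u -> Csum (fun n => Cconj (u n)) = Cconj (Csum u).
Proof. intros; apply Cseries_unique, Cseries_conj; now apply Cabs_Cseries. Qed.

Lemma Csum_incr (u : nat -> C) : Cabs u -> Csum u = u 0%nat + Csum (fun n => u (S n)).
Proof.
  intros; apply Cseries_unique, Cseries_incr, Cabs_Cseries, Cabs_shift; auto.
Qed.

Lemma Cmod_sqr (z : C) : (Cmod z * Cmod z = Re z * Re z + Im z * Im z)%R.
Proof. generalize (Cmod2_alt z); intros H; replace (Cmod z * Cmod z)%R with (Cmod z ^ 2)%R by ring; rewrite H; ring. Qed.

Lemma Series_mono (a b : nat -> R) :
  (forall n, a n <= b n)%R -> ex_series a -> ex_series b -> (Series a <= Series b)%R.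
Proof.
  intros H Ha Hb.
  assert (L := fun u (Hu : ex_series u) => Series_correct u Hu : is_lim_seq (sum_n u) (Series u)).
  apply (is_lim_seq_le (sum_n a) (sum_n b) (Series a) (Series b)); auto.
  intros n; apply sum_n_m_le; auto.
Qed.

Lemma sum_n_S (a : nat -> R) (n : nat) : sum_n a (S n) = (sum_n a n + a (S n))%R.
Proof. exact (sum_Sn a n). Qed.

Lemma sum_n_nonneg (a : nat -> R) (n : nat) : (forall k, 0 <= a k)%R -> (0 <= sum_n a n)%R.
Proof.
  intros H; induction n as [|n IH]; [rewrite sum_O; auto|].
  rewrite sum_n_S; generalize (H (S n)); lra.
Qed.

Lemma ex_series_bounded (a : nat -> R) (L : R) :
  (forall n, 0 <= a n)%R -> (forall m, sum_n a m <= L)%R -> ex_series a /\ (Series a <= L)%R.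
Proof.
  intros H HL.
  assert (E : ex_series a).
  { destruct (ex_finite_lim_seq_incr (sum_n a) L) as [l Hl]; auto.
    - intros n; rewrite sum_n_S; generalize (H (S n)); lra.
    - now exists l. }
  split; auto.
  apply (is_lim_seq_le (sum_n a) (fun _ => L) (Series a) L); auto.
  - exact (Series_correct a E).
  - apply is_lim_seq_const.
Qed.

Lemma sum_n_le_Series (a : nat -> R) (m : nat) :
  (forall n, 0 <= a n)%R -> ex_series a -> (sum_n a m <= Series a)%R.
Proof.
  intros H E.
  apply (is_lim_seq_le_loc (fun _ => sum_n a m) (sum_n a) (sum_n a m) (Series a)).
  - exists m; intros n Hn; induction Hn as [|n Hn IH]; [lra|].
    rewrite sum_n_S; generalize (H (S n)); lra.
  - apply is_lim_seq_const.
  - exact (Series_correct a E).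
Qed.

Lemma Series_pos (a : nat -> R) : (forall n, 0 <= a n)%R -> ex_series a -> (0 <= Series a)%R.
Proof.
  intros H E; apply Rle_trans with (sum_n a 0).
  - rewrite sum_O; auto.
  - now apply sum_n_le_Series.
Qed.

Lemma term_le_Series (a : nat -> R) (m : nat) :
  (forall n, 0 <= a n)%R -> ex_series a -> (a m <= Series a)%R.
Proof.
  intros H E; apply Rle_trans with (sum_n a m).
  - destruct m; [rewrite sum_O; lra|rewrite sum_n_S].
    generalize (sum_n_nonneg a m H); lra.
  - now apply sum_n_le_Series.
Qed.

(** With s the sum, |s|^2 is the real part of the sum of conj s u_n, hence at most |s| times the sum
    of the moduli; a positive |s| cancels. *)
Lemma Cmod_Csum (u : nat -> C) : Cabs u -> (Cmod (Csum u) <= Series (fun n => Cmod (u n)))%R.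
Proof.
  intros H; set (s := Csum u).
  destruct (Rle_lt_or_eq_dec _ _ (Cmod_ge_0 s)) as [Hp|Hz].
  2:{ rewrite <- Hz; apply Series_pos; auto; intros; apply Cmod_ge_0. }
  apply Rmult_le_reg_l with (1 := Hp).
  assert (E : (Cmod s * Cmod s)%R = Re (Csum (fun n => Cconj s * u n))).
  { rewrite Csum_scal by auto; fold s; rewrite Cmod_sqr; unfold Re, Im; cbn; ring. }
  rewrite E, <- Series_scal_l.
  apply Series_mono.
  - intros n; apply Rle_trans with (1 := Rle_abs _).
    apply Rle_trans with (1 := re_le_Cmod _).
    rewrite Cmod_mult, Cmod_conj; lra.
  - now apply Cabs_Re, Cabs_scal.
  - apply (ex_series_scal (Cmod s) (fun n => Cmod (u n))); auto.
Qed.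

(** The geometric sum 1 + t + ... + t^n has n + 1 terms, each at least t^n; multiply by 1 - t. *)
Lemma pow_bound_aux (t : R) (n : nat) : (0 <= t < 1)%R -> (INR (S n) * t ^ n * (1 - t) <= 1 - t ^ S n)%R.
Proof.
  intros Ht; induction n as [|n IH]; [cbn; lra|].
  rewrite S_INR; change (t ^ S n)%R with (t * t ^ n)%R in *; change (t ^ S (S n))%R with (t * (t * t ^ n))%R.
  assert (P : (0 <= t ^ n <= 1)%R).
  { split; [apply pow_le; lra|]. rewrite <- (pow1 n); apply pow_incr; lra. }
  set (p := (t ^ n)%R) in *; set (k := INR (S n)) in *.
  assert (I1 : (t * (k * p * (1 - t)) <= t * (1 - t * p))%R) by (apply Rmult_le_compat_l; lra).
  assert (I2 : (t * p <= 1)%R) by nra.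
  assert (I3 : (t * p * (1 - t) <= 1 * (1 - t))%R) by (apply Rmult_le_compat_r; lra).
  lra.
Qed.

(* Comparison with t^n, where r <= t^3 < 1: each factor (n+1) is absorbed by one factor t^n. *)
Lemma ex_series_geom_poly (r : R) :
  (0 <= r < 1)%R -> ex_series (fun n => INR (S n) * INR (S n) * r ^ n)%R.
Proof.
  (* The tangent line of the cube at 1 gives t^3 >= 3 t - 2, and 3 t - 2 = r for this t. *)
  intros Hr; set (t := ((2 + r) / 3)%R).
  assert (Ht : (0 < t < 1)%R) by (unfold t; lra).
  assert (Hrt : (r <= t ^ 3)%R) .
  { assert (0 <= (1 - t) * (1 - t) * (2 + t))%R by (repeat apply Rmult_le_pos; lra).
    assert (r = 3 * t - 2)%R by (unfold t; lra); nra. }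
  apply (ex_series_dom _ (fun n => / ((1 - t) * (1 - t)) * t ^ n)%R).
  2:{ apply (ex_series_scal (/ ((1 - t) * (1 - t)))%R (fun n => t ^ n)%R).
      apply ex_series_geom; rewrite Rabs_pos_eq; lra. }
  intros n.
  assert (B := pow_bound_aux t n ltac:(lra)).
  assert (P : (0 < t ^ n)%R) by (apply pow_lt; lra).
  assert (P' : (0 < t ^ S n)%R) by (apply pow_lt; lra).
  assert (I : (0 < INR (S n))%R) by (apply lt_0_INR; lia).
  assert (Pr : (0 <= r ^ n)%R) by (apply pow_le; lra).
  rewrite Rabs_pos_eq by (apply Rmult_le_pos; [nra|auto]).
  apply Rle_trans with (INR (S n) * INR (S n) * (t ^ n * t ^ n * t ^ n))%R.
  - apply Rmult_le_compat_l; [nra|].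
    replace (t ^ n * t ^ n * t ^ n)%R with ((t ^ 3) ^ n)%R by (rewrite <- !Rpow_mult_distr; f_equal; ring).
    apply pow_incr; lra.
  - assert (X : (INR (S n) * t ^ n <= / (1 - t))%R).
    { apply Rmult_le_reg_r with (1 - t)%R; [lra|]. rewrite Rinv_l by lra; lra. }
    rewrite Rinv_mult.
    replace (INR (S n) * INR (S n) * (t ^ n * t ^ n * t ^ n))%R
      with ((INR (S n) * t ^ n) * (INR (S n) * t ^ n) * t ^ n)%R by ring.
    apply Rmult_le_compat_r; [lra|].
    apply Rmult_le_compat; auto; nra.
Qed.

Lemma ex_series_geom_poly1 (r : R) :
  (0 <= r < 1)%R -> ex_series (fun n => INR (S n) * r ^ n)%R.
Proof.
  intros Hr; apply (ex_series_dom _ (fun n => INR (S n) * INR (S n) * r ^ n)%R); [|now apply ex_series_geom_poly].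
  intros n; assert (I : (1 <= INR (S n))%R) by (rewrite S_INR; generalize (pos_INR n); lra).
  assert (P : (0 <= r ^ n)%R) by (apply pow_le; lra).
  rewrite Rabs_pos_eq; [|nra].
  apply Rmult_le_compat_r; nra.
Qed.

(** Linear growth covers both a bounded coefficient sequence and the coefficients of its
    derivative. *)
Lemma Cabs_linear_growth (c : nat -> C) (B : R) (z : C) :
  (forall n, Cmod (c n) <= B * INR (S n))%R -> (Cmod z < 1)%R -> Cabs (fun n => c n * z ^ n).
Proof.
  intros H Hz; apply Cabs_le with (fun n => B * (INR (S n) * Cmod z ^ n))%R.
  - intros n; rewrite Cmod_mult, Cmod_pow, <- Rmult_assoc.
    apply Rmult_le_compat_r; auto; apply pow_le, Cmod_ge_0.
  - apply (ex_series_scal B (fun n => (INR (S n) * Cmod z ^ n)%R)), ex_series_geom_poly1.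
    split; auto; apply Cmod_ge_0.
Qed.

Lemma one_minus_neq_0 (z : C) : (Cmod z < 1)%R -> 1 - z <> 0.
Proof.
  intros H E; assert (z = 1) by (replace z with (1 - (1 - z)) by ring; rewrite E; ring).
  subst; rewrite Cmod_1 in H; lra.
Qed.

Lemma RtoC_INR_S (n : nat) : RtoC (INR (S n)) = INR n + 1.
Proof. now rewrite S_INR, RtoC_plus. Qed.

Lemma Cabs_geom (z : C) : (Cmod z < 1)%R -> Cabs (fun n => z ^ n).
Proof.
  intros H; apply Cabs_le with (fun n => 1 * (Cmod z) ^ n)%R; [intros n; rewrite Cmod_pow; lra|].
  apply (ex_series_scal 1 (fun n => (Cmod z ^ n)%R)), ex_series_geom.
  rewrite Rabs_pos_eq; auto; apply Cmod_ge_0.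
Qed.

Lemma Csum_geom (z : C) : (Cmod z < 1)%R -> Csum (fun n => z ^ n) = / (1 - z).
Proof.
  intros H; assert (N := one_minus_neq_0 z H).
  assert (E := Csum_incr _ (Cabs_geom z H)); cbn in E.
  rewrite Csum_scal in E by now apply Cabs_geom.
  set (s := Csum (fun n => z ^ n)) in *.
  assert (E' : (1 - z) * s = 1) by (transitivity (s - z * s); [ring|rewrite E at 1; ring]).
  transitivity (((1 - z) * s) / (1 - z)); [field; auto|rewrite E'; field; auto].
Qed.

Lemma Cabs_geom1 (z : C) : (Cmod z < 1)%R -> Cabs (fun n => INR (S n) * z ^ n).
Proof.
  intros H; apply Cabs_linear_growth with 1%R; auto.
  intros n; rewrite Cmod_R, Rabs_pos_eq; [lra|apply pos_INR].
Qed.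

(** Splitting (n + 2) z^(n+1) into z (n + 1) z^n and z z^n gives the linear equation s = 1 + z s + z
    / (1 - z), which is solved for s. *)
Lemma Csum_geom1 (z : C) : (Cmod z < 1)%R -> Csum (fun n => INR (S n) * z ^ n) = / ((1 - z) * (1 - z)).
Proof.
  intros H; assert (N := one_minus_neq_0 z H).
  set (s := Csum _).
  assert (E : s = 1 + (z * s + z * / (1 - z))).
  { unfold s at 1; rewrite (Csum_incr _ (Cabs_geom1 z H)).
    rewrite <- (Csum_geom z H); unfold s; rewrite <- !Csum_scal by (now apply Cabs_geom1 || now apply Cabs_geom).
    rewrite <- Csum_plus by (apply Cabs_scal; now apply Cabs_geom1 || now apply Cabs_geom).
    f_equal; [cbn; ring|].
    apply Csum_ext; intros n; rewrite (RtoC_INR_S (S n)); cbn [Cpow]; ring. }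
  assert (E' : (1 - z) * s = 1 / (1 - z)) by (transitivity (s - z * s); [ring|rewrite E at 1; field; auto]).
  transitivity (((1 - z) * s) / (1 - z)); [field; auto|rewrite E'; field; auto].
Qed.

(** * The Dirichlet space *)

#[global] Arguments Cnorm2 z%_C_scope.

Lemma Cconj_RtoC (x : R) : Cconj x = x.
Proof. unfold Cconj, RtoC; cbn; now rewrite Ropp_0. Qed.

Lemma Cnorm2_Cmod (z : C) : Cnorm2 z = (Cmod z * Cmod z)%R.
Proof. rewrite Cmod_sqr; reflexivity. Qed.

Lemma in_disk_Cmod (z : C) : in_disk z <-> (Cmod z < 1)%R.
Proof. unfold in_disk; rewrite Cnorm2_Cmod; generalize (Cmod_ge_0 z); split; nra. Qed.

Lemma on_circle_Cmod (z : C) : on_circle z <-> Cmod z = 1%R.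
Proof. unfold on_circle; rewrite Cnorm2_Cmod; generalize (Cmod_ge_0 z); split; nra. Qed.

Lemma dweight_ge_1 (n : nat) : (1 <= dweight n)%R.
Proof.
  destruct n; [apply Rle_refl|]; unfold dweight; rewrite S_INR; generalize (pos_INR n); lra.
Qed.

Definition Dnorm2 (f : coefs) : R := Series (fun n => dweight n * Cnorm2 (f n))%R.

Lemma Dterm_pos (f : coefs) (n : nat) : (0 <= dweight n * Cnorm2 (f n))%R.
Proof. rewrite Cnorm2_Cmod; apply Rmult_le_pos; [generalize (dweight_ge_1 n); lra|nra]. Qed.

Lemma InD_ex_series (f : coefs) : InD f <-> ex_series (fun n => dweight n * Cnorm2 (f n))%R.
Proof.
  split; intros [l H]; exists l; now apply infinite_sum_series.
Qed.

Lemma InD_dnorm2 (f : coefs) : InD f -> dnorm2_is f (Dnorm2 f).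
Proof. rewrite InD_ex_series; intros H; now apply infinite_sum_series, Series_correct. Qed.

Lemma dnorm2_is_unique (f : coefs) (l : R) : dnorm2_is f l -> l = Dnorm2 f.
Proof. intros H; symmetry; apply is_series_unique; now apply infinite_sum_series. Qed.

Lemma Dnorm2_pos (f : coefs) : InD f -> (0 <= Dnorm2 f)%R.
Proof. rewrite InD_ex_series; intros H; apply Series_pos; auto; intros; apply Dterm_pos. Qed.

Lemma Cmod2_le_Dnorm2 (f : coefs) (n : nat) : InD f -> (Cmod (f n) * Cmod (f n) <= Dnorm2 f)%R.
Proof.
  intros H; apply InD_ex_series in H.
  apply Rle_trans with (2 := term_le_Series _ n (Dterm_pos f) H).
  cbn beta; rewrite Cnorm2_Cmod; generalize (dweight_ge_1 n); nra.
Qed.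

(** The bound M + 1 avoids a square root: x^2 <= M forces x <= M + 1. *)
Lemma coef_le (f : coefs) (M : R) (n : nat) : InD f -> (Dnorm2 f <= M)%R -> (Cmod (f n) <= M + 1)%R.
Proof.
  intros H HM; generalize (Cmod2_le_Dnorm2 f n H) (Cmod_ge_0 (f n)); nra.
Qed.

Lemma InD_of_bound (f : coefs) (b : nat -> R) :
  (forall n, dweight n * Cnorm2 (f n) <= b n)%R -> ex_series b -> InD f.
Proof.
  intros H Hb; apply InD_ex_series, ex_series_dom with b; auto.
  intros n; rewrite Rabs_pos_eq; auto; apply Dterm_pos.
Qed.

Lemma Cnorm2_plus_le (x y : C) : (Cnorm2 (x + y) <= 2 * Cnorm2 x + 2 * Cnorm2 y)%R.
Proof.
  rewrite !Cnorm2_Cmod; generalize (Cmod_triangle x y) (Cmod_ge_0 x) (Cmod_ge_0 y) (Cmod_ge_0 (x + y)%C).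
  generalize (Cmod (x + y)) (Cmod x) (Cmod y); intros r s t; intros.
  assert (r * r <= (s + t) * (s + t))%R by (apply Rmult_le_compat; lra).
  generalize (Rle_0_sqr (s - t)); unfold Rsqr; intros.
  nra.
Qed.

Lemma InD_csub (f g : coefs) : InD f -> InD g -> InD (csub f g).
Proof.
  intros Hf Hg; rewrite InD_ex_series in Hf, Hg.
  apply InD_of_bound with (fun n => 2 * (dweight n * Cnorm2 (f n)) + 2 * (dweight n * Cnorm2 (g n)))%R.
  - intros n; unfold csub; change (Csub (f n) (g n)) with (f n - g n).
    replace (f n - g n) with (f n + (- g n)) by ring.
    generalize (Cnorm2_plus_le (f n) (- g n)) (dweight_ge_1 n); rewrite (Cnorm2_Cmod (- g n)), Cmod_opp, <- Cnorm2_Cmod.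
    intros; nra.
  - apply (exR_plus (fun n => 2 * (dweight n * Cnorm2 (f n)))%R (fun n => 2 * (dweight n * Cnorm2 (g n)))%R);
    apply (exR_scal 2%R); auto.
Qed.

Lemma Dnorm2_csub_le (f g : coefs) : InD f -> InD g ->
  (Dnorm2 (csub f g) <= 2 * Dnorm2 f + 2 * Dnorm2 g)%R.
Proof.
  intros Hf Hg; assert (Hs := InD_csub f g Hf Hg).
  rewrite InD_ex_series in Hf, Hg, Hs.
  unfold Dnorm2; rewrite <- !Series_scal_l, <- Series_plus by (apply (exR_scal 2%R); auto).
  apply Series_mono; auto.
  2:{ apply (exR_plus (fun n => 2 * (dweight n * Cnorm2 (f n)))%R (fun n => 2 * (dweight n * Cnorm2 (g n)))%R);
    apply (exR_scal 2%R); auto. }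
  intros n; unfold csub; change (Csub (f n) (g n)) with (f n - g n).
  replace (f n - g n) with (f n + (- g n)) by ring.
  generalize (Cnorm2_plus_le (f n) (- g n)) (dweight_ge_1 n); rewrite (Cnorm2_Cmod (- g n)), Cmod_opp, <- Cnorm2_Cmod.
  intros; nra.
Qed.

Definition dinner (f g : coefs) : C := Csum (fun n => dweight n * (f n * Cconj (g n))).

Lemma Cabs_dinner (f g : coefs) : InD f -> InD g -> Cabs (fun n => dweight n * (f n * Cconj (g n))).
Proof.
  rewrite !InD_ex_series; intros Hf Hg.
  apply Cabs_le with (fun n => dweight n * Cnorm2 (f n) + dweight n * Cnorm2 (g n))%R.
  - intros n; rewrite !Cmod_mult, Cmod_R, Cmod_conj, !Cnorm2_Cmod.
    generalize (dweight_ge_1 n); intros Hw; rewrite Rabs_pos_eq by lra.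
    rewrite <- Rmult_plus_distr_l; apply Rmult_le_compat_l; [lra|].
    generalize (Cmod (f n)) (Cmod (g n)); intros; nra.
  - apply (ex_series_plus (fun n => dweight n * Cnorm2 (f n))%R (fun n => dweight n * Cnorm2 (g n))%R); auto.
Qed.

Lemma dinner_is_dinner (f g : coefs) : InD f -> InD g -> dinner_is f g (dinner f g).
Proof. intros Hf Hg; exact (Cabs_Cseries _ (Cabs_dinner f g Hf Hg)). Qed.

Lemma dinner_is_unique (f g : coefs) (v : C) : dinner_is f g v -> dinner f g = v.
Proof. intros H; exact (Cseries_unique _ _ H). Qed.

Lemma dinner_conj (f g : coefs) : InD f -> InD g -> dinner g f = Cconj (dinner f g).
Proof.
  intros Hf Hg; unfold dinner; rewrite <- Csum_conj by now apply Cabs_dinner.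
  apply Csum_ext; intros n; rewrite !Cmult_conj, Cconj_conj.
  replace (Cconj (dweight n)) with (RtoC (dweight n)) by (now rewrite Cconj_RtoC).
  ring.
Qed.

Lemma adjoint_dinner (T S : op) (f g : coefs) :
  is_adjoint T S -> InD f -> InD (T f) -> InD g -> dinner (T f) g = dinner f (S g).
Proof.
  intros H Hf HTf Hg; destruct (H g Hg) as [HSg HS].
  symmetry; apply dinner_is_unique, HS; auto; now apply dinner_is_dinner.
Qed.

Definition fval (f : coefs) (z : C) : C := Csum (fun n => f n * z ^ n).
Definition dval (f : coefs) (z : C) : C := Csum (fun n => INR (S n) * f (S n) * z ^ n).

Lemma Cabs_fval (f : coefs) (z : C) (B : R) :
  (forall n, Cmod (f n) <= B)%R -> (Cmod z < 1)%R -> Cabs (fun n => f n * z ^ n).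
Proof.
  intros H Hz; apply Cabs_linear_growth with B; auto.
  intros n; apply Rle_trans with (1 := H n).
  assert (0 <= B)%R by (apply Rle_trans with (2 := H n); apply Cmod_ge_0).
  rewrite S_INR; generalize (pos_INR n); nra.
Qed.

Lemma Cabs_dval (f : coefs) (z : C) (B : R) :
  (forall n, Cmod (f n) <= B)%R -> (Cmod z < 1)%R -> Cabs (fun n => INR (S n) * f (S n) * z ^ n).
Proof.
  intros H Hz; apply Cabs_linear_growth with B; auto.
  intros n; rewrite Cmod_mult, Cmod_R, Rabs_pos_eq by apply pos_INR.
  rewrite Rmult_comm; apply Rmult_le_compat_r; auto; apply pos_INR.
Qed.

Lemma fval_is_fval (f : coefs) (z v : C) : fval_is f z v -> fval f z = v.
Proof. intros H; exact (Cseries_unique _ _ H). Qed.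

Lemma comp_op_fval (phi : C -> C) (T : op) (f : coefs) (z : C) :
  is_comp_op phi T -> InD f -> (Cmod z < 1)%R -> fval (T f) z = fval f (phi z).
Proof.
  intros H Hf Hz; destruct (H f Hf) as [_ H2].
  destruct (H2 z) as [v [V1 V2]]; [now apply in_disk_Cmod|].
  now rewrite (fval_is_fval _ _ _ V1), (fval_is_fval _ _ _ V2).
Qed.

Lemma fval_0 (f : coefs) (B : R) : (forall n, Cmod (f n) <= B)%R -> fval f 0 = f 0%nat.
Proof.
  intros H; assert (Z : (Cmod 0 < 1)%R) by (rewrite Cmod_0; lra).
  unfold fval; rewrite Csum_incr by now apply Cabs_fval with B.
  rewrite (Csum_ext _ (fun n => 0 * 0 ^ n)) by (intros; cbn [Cpow]; ring).
  rewrite Csum_scal by now apply Cabs_geom.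
  cbn [Cpow]; ring.
Qed.

Definition cst1 : coefs := fun n => match n with O => RtoC 1 | S _ => RtoC 0 end.

(* Coefficients of z / (1 - s z), the derivative kernel: <f, es s> = f'(conj s). *)
Definition es (s : C) : coefs := fun n => match n with O => RtoC 0 | S m => s ^ m end.

(* Coefficients of 1 + log (1 / (1 - conj v z)), the reproducing kernel at v. *)
Definition kern (v : C) : coefs :=
  fun n => match n with O => RtoC 1 | S m => / INR (S m) * Cconj v ^ S m end.

Lemma Cnorm2_0 : Cnorm2 (RtoC 0) = 0%R.
Proof. unfold Cnorm2; cbn; ring. Qed.

Lemma Cnorm2_1 : Cnorm2 (RtoC 1) = 1%R.
Proof. unfold Cnorm2; cbn; ring. Qed.

Lemma InD_cst1 : InD cst1.
Proof.
  apply InD_of_bound with (fun n => (1/2) ^ n)%R; [|apply ex_series_geom; rewrite Rabs_pos_eq; lra].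
  intros [|n]; unfold cst1; rewrite ?Cnorm2_0, ?Cnorm2_1; unfold dweight; [cbn; lra|].
  rewrite Rmult_0_r; apply pow_le; lra.
Qed.

Lemma InD_es (s : C) : (Cmod s < 1)%R -> InD (es s).
Proof.
  intros Hs; apply InD_ex_series.
  apply (ex_series_incr_1 (fun n => dweight n * Cnorm2 (es s n))%R).
  assert (G := Cmod_ge_0 s).
  apply ex_series_dom with (2 := ex_series_geom_poly1 (Cmod s * Cmod s)%R ltac:(nra)).
  intros n; unfold dweight, es; rewrite Cnorm2_Cmod, Cmod_pow, <- Rpow_mult_distr.
  rewrite Rabs_pos_eq; [lra|].
  apply Rmult_le_pos; [apply pos_INR|apply pow_le; nra].
Qed.

Lemma INR_S_neq_0 (n : nat) : RtoC (INR (S n)) <> 0.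
Proof. intros E; apply (not_0_INR (S n)); [lia|]; now apply RtoC_inj. Qed.

Lemma Cmod_inv_INR (n : nat) : (Cmod (/ INR (S n)) <= 1)%R.
Proof.
  rewrite Cmod_inv by apply INR_S_neq_0.
  rewrite Cmod_R, S_INR; generalize (pos_INR n); intros.
  rewrite Rabs_pos_eq by lra.
  rewrite <- Rinv_1; apply Rinv_le_contravar; lra.
Qed.

Lemma InD_kern (v : C) : (Cmod v < 1)%R -> InD (kern v).
Proof.
  intros Hs; apply InD_ex_series.
  apply (ex_series_incr_1 (fun n => dweight n * Cnorm2 (kern v n))%R).
  assert (G := Cmod_ge_0 v).
  apply ex_series_dom with (2 := ex_series_geom_poly1 (Cmod v * Cmod v)%R ltac:(nra)).
  intros n; unfold dweight, kern; rewrite Cnorm2_Cmod, Cmod_mult, Cmod_pow, Cmod_conj.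
  assert (I := Cmod_inv_INR n). assert (I0 := Cmod_ge_0 (/ INR (S n))).
  assert (P : (0 <= Cmod v ^ S n)%R) by now apply pow_le.
  assert (P' : (Cmod v ^ S n <= Cmod v ^ n)%R).
  { assert (0 <= Cmod v ^ n)%R by now apply pow_le. cbn; nra. }
  rewrite Rabs_pos_eq; [|apply Rmult_le_pos; [apply pos_INR|nra]].
  apply Rmult_le_compat_l; [apply pos_INR|].
  rewrite Rpow_mult_distr.
  apply Rmult_le_compat; nra.
Qed.

Lemma Cseries_0_incr (u : nat -> C) : u 0%nat = 0 -> Cabs u -> Csum u = Csum (fun n => u (S n)).
Proof. intros H Hu; rewrite (Csum_incr _ Hu), H; ring. Qed.

Lemma dinner_es_r (f : coefs) (z : C) : InD f -> (Cmod z < 1)%R -> dinner f (es (Cconj z)) = dval f z.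
Proof.
  intros Hf Hz; unfold dinner; rewrite Cseries_0_incr.
  - unfold dval; apply Csum_ext; intros n; unfold es, dweight.
    rewrite Cpow_conj, Cconj_conj; ring.
  - unfold es; replace (Cconj (RtoC 0)) with (RtoC 0) by (now rewrite Cconj_RtoC); ring.
  - apply Cabs_dinner; auto; apply InD_es; now rewrite Cmod_conj.
Qed.

Lemma dinner_kern_r (f : coefs) (z : C) : InD f -> (Cmod z < 1)%R -> dinner f (kern z) = fval f z.
Proof.
  intros Hf Hz; unfold dinner, fval; apply Csum_ext; intros [|n]; unfold kern, dweight.
  - replace (Cconj (RtoC 1)) with (RtoC 1) by (now rewrite Cconj_RtoC); cbn; ring.
  - rewrite Cmult_conj, Cpow_conj, Cconj_conj.
    replace (Cconj (/ INR (S n))) with (/ INR (S n)).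
    + field; apply INR_S_neq_0.
    + rewrite Cinv_conj by apply INR_S_neq_0.
      now rewrite Cconj_RtoC.
Qed.

(** The constant 1 is the reproducing kernel at the origin. *)
Lemma dinner_cst1_r (f : coefs) : InD f -> dinner f cst1 = f 0%nat.
Proof.
  intros Hf; assert (Hz : (Cmod 0 < 1)%R) by (rewrite Cmod_0; lra).
  rewrite <- (fval_0 f (Dnorm2 f + 1)) by (intros; apply coef_le; auto; lra).
  rewrite <- dinner_kern_r by auto.
  apply Csum_ext; intros [|n]; unfold cst1, kern; auto.
  replace (Cconj 0) with (RtoC 0) by (now rewrite Cconj_RtoC).
  replace (/ INR (S n) * 0 ^ S n) with (RtoC 0) by (cbn [Cpow]; ring).
  now rewrite Cconj_RtoC.
Qed.

Lemma Cmod_es_le (s : C) (n : nat) : (Cmod s < 1)%R -> (Cmod (es s n) <= 1)%R.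
Proof.
  intros H; destruct n; unfold es; [rewrite Cmod_0; lra|].
  rewrite Cmod_pow, <- (pow1 n); apply pow_incr; split; [apply Cmod_ge_0|lra].
Qed.

Lemma Cmod_mult_lt_1 (s z : C) : (Cmod s < 1)%R -> (Cmod z < 1)%R -> (Cmod (s * z) < 1)%R.
Proof. rewrite Cmod_mult; generalize (Cmod_ge_0 s) (Cmod_ge_0 z); nra. Qed.

Lemma fval_es (s z : C) : (Cmod s < 1)%R -> (Cmod z < 1)%R -> fval (es s) z = z / (1 - s * z).
Proof.
  intros Hs Hz; unfold fval; rewrite Cseries_0_incr.
  - rewrite (Csum_ext _ (fun n => z * (s * z) ^ n)) by (intros n; unfold es; rewrite Cpow_mult_l; cbn [Cpow]; ring).
    rewrite Csum_scal by (apply Cabs_geom, Cmod_mult_lt_1; auto).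
    now rewrite Csum_geom by (apply Cmod_mult_lt_1; auto).
  - unfold es; ring.
  - apply Cabs_fval with 1%R; auto; intros; now apply Cmod_es_le.
Qed.

Lemma dval_es (s z : C) : (Cmod s < 1)%R -> (Cmod z < 1)%R ->
  dval (es s) z = / ((1 - s * z) * (1 - s * z)).
Proof.
  intros Hs Hz; rewrite <- Csum_geom1 by (apply Cmod_mult_lt_1; auto).
  apply Csum_ext; intros n; unfold es; rewrite Cpow_mult_l; ring.
Qed.

(** * Parseval's inequality and the identity theorem *)

Fixpoint Csumn (F : nat -> C) (n : nat) : C :=
  match n with O => 0 | S k => Csumn F k + F k end.

Fixpoint Rsumn (F : nat -> R) (n : nat) : R :=
  match n with O => 0%R | S k => (Rsumn F k + F k)%R end.

Lemma Rsumn_sum_n (F : nat -> R) (n : nat) : Rsumn F (S n) = sum_n F n.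
Proof.
  induction n as [|n IH]; [rewrite sum_O; cbn; ring|].
  rewrite sum_n_S, <- IH; reflexivity.
Qed.

Lemma Rsumn_le (F G : nat -> R) (n : nat) : (forall k, (k < n)%nat -> (F k <= G k)%R) -> (Rsumn F n <= Rsumn G n)%R.
Proof.
  induction n as [|n IH]; intros H; cbn; [lra|].
  apply Rplus_le_compat; [apply IH; intros; apply H; lia|apply H; lia].
Qed.

Lemma Rsumn_const (x : R) (n : nat) : Rsumn (fun _ => x) n = (INR n * x)%R.
Proof. induction n as [|n IH]; cbn [Rsumn]; [cbn; ring|rewrite IH, S_INR; ring]. Qed.

Lemma Rsumn_scal (x : R) (F : nat -> R) (n : nat) : Rsumn (fun k => x * F k)%R n = (x * Rsumn F n)%R.
Proof. induction n as [|n IH]; cbn; [ring|rewrite IH; ring]. Qed.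

Lemma Rsumn_pos (F : nat -> R) (n : nat) : (forall k, 0 <= F k)%R -> (0 <= Rsumn F n)%R.
Proof. intros H; induction n as [|n IH]; cbn; [lra|generalize (H n); lra]. Qed.

Lemma Rsumn_mono_n (F : nat -> R) (m n : nat) : (forall k, 0 <= F k)%R -> (m <= n)%nat -> (Rsumn F m <= Rsumn F n)%R.
Proof. intros H Hmn; induction Hmn as [|n Hmn IH]; cbn; [lra|generalize (H n); lra]. Qed.

Lemma Csumn_scal (x : C) (F : nat -> C) (n : nat) : Csumn (fun k => x * F k) n = x * Csumn F n.
Proof. induction n as [|n IH]; cbn [Csumn]; [ring|rewrite IH; ring]. Qed.

Lemma Csumn_plus (F G : nat -> C) (n : nat) : Csumn (fun k => F k + G k) n = Csumn F n + Csumn G n.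
Proof. induction n as [|n IH]; cbn [Csumn]; [ring|rewrite IH; ring]. Qed.

Lemma Csumn_ext (F G : nat -> C) (n : nat) : (forall k, F k = G k) -> Csumn F n = Csumn G n.
Proof. intros H; induction n as [|n IH]; cbn [Csumn]; [|rewrite IH, H]; auto. Qed.

Lemma Re_Csumn (F : nat -> C) (n : nat) : Re (Csumn F n) = Rsumn (fun k => Re (F k)) n.
Proof. induction n as [|n IH]; cbn [Csumn Rsumn]; [reflexivity|rewrite <- IH; reflexivity]. Qed.

Definition cis (t : R) : C := (cos t, sin t).

Lemma cis_pow (t : R) (n : nat) : cis t ^ n = cis (INR n * t).
Proof.
  induction n as [|n IH]; cbn [Cpow].
  - unfold cis; cbn [INR]; rewrite Rmult_0_l, cos_0, sin_0; reflexivity.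
  - rewrite IH, S_INR; unfold cis, Cmult; cbn [fst snd].
    replace ((INR n + 1) * t)%R with (t + INR n * t)%R by ring.
    rewrite cos_plus, sin_plus; f_equal; ring.
Qed.

Lemma cis_conj (t : R) : cis t * Cconj (cis t) = 1.
Proof.
  unfold cis, Cconj, Cmult, RtoC; cbn [fst snd]; f_equal; [|ring].
  generalize (sin2_cos2 t); unfold Rsqr; lra.
Qed.

Lemma Cmod_cis (t : R) : Cmod (cis t) = 1%R.
Proof.
  unfold Cmod, cis; cbn [fst snd]; rewrite <- sqrt_1; f_equal.
  generalize (sin2_cos2 t); unfold Rsqr; lra.
Qed.

Lemma cis_neq_1 (t : R) : (0 < t < 2 * PI)%R -> cis t <> 1.
Proof.
  intros H E; assert (E1 : cos t = 1%R) by exact (f_equal fst E).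
  replace t with (2 * (t / 2))%R in E1 by field.
  rewrite cos_2a_sin in E1.
  assert (0 < sin (t / 2))%R by (apply sin_gt_0; lra).
  nra.
Qed.

Lemma Csumn_geom (q : C) (n : nat) : (1 - q) * Csumn (fun j => q ^ j) n = 1 - q ^ n.
Proof. induction n as [|n IH]; cbn [Csumn Cpow]; [ring|rewrite Cmult_plus_distr_l, IH; ring]. Qed.

(** Since 0 < d - i < N, the terms are a constant times the powers of an N-th root of unity q
    different from 1, and the geometric sum of q over a full period is 0. *)
Lemma roots_orth (N : nat) (r : R) (i d : nat) : (i < d)%nat -> (d < N)%nat ->
  Csumn (fun j => (r * cis (INR j * (2 * PI / INR N))) ^ i * Cconj ((r * cis (INR j * (2 * PI / INR N))) ^ d)) N = 0.
Proof.
  intros Hi Hd; set (t := (2 * PI / INR N)%R).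
  assert (Hm : exists m, d = (i + S m)%nat) by (exists (d - i - 1)%nat; lia).
  destruct Hm as [m ->].
  assert (HNp : (0 < INR N)%R) by (apply lt_0_INR; lia).
  assert (PIp := PI_RGT_0).
  set (q := Cconj (cis (INR (S m) * t))).
  rewrite (Csumn_ext _ (fun j => (RtoC r ^ i * RtoC r ^ (i + S m)) * q ^ j)).
  2:{ intros j; set (c := cis (INR j * t)).
      rewrite Cpow_conj, Cmult_conj, Cconj_RtoC, !Cpow_mult_l.
      assert (E : Cconj c ^ S m = q ^ j).
      { unfold q, c; rewrite <- !Cpow_conj, !cis_pow; do 2 f_equal; ring. }
      rewrite (Cpow_add_r (Cconj c)), E.
      transitivity (RtoC r ^ i * RtoC r ^ (i + S m) * ((c * Cconj c) ^ i) * q ^ j).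
      - rewrite Cpow_mult_l; ring.
      - unfold c; rewrite cis_conj, Cpow_1_l; ring. }
  rewrite Csumn_scal.
  assert (Ht : (0 < t)%R) by (apply Rdiv_lt_0_compat; lra).
  assert (HNt : (INR N * t = 2 * PI)%R) by (unfold t; field; lra).
  assert (Hq : 1 - q <> 0).
  { intros E; apply (cis_neq_1 (INR (S m) * t)).
    - split; [apply Rmult_lt_0_compat; auto; apply lt_0_INR; lia|].
      rewrite <- HNt; apply Rmult_lt_compat_r; auto; apply lt_INR; lia.
    - rewrite <- (Cconj_conj (cis _)); fold q.
      replace q with (1 - (1 - q)) by ring; rewrite E.
      replace (1 - 0) with (RtoC 1) by ring; apply Cconj_RtoC. }
  assert (HqN : q ^ N = 1).
  { unfold q; rewrite <- Cpow_conj, cis_pow.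
    replace (INR N * (INR (S m) * t))%R with (0 + 2 * INR (S m) * PI)%R
      by (replace (INR N * (INR (S m) * t))%R with (INR (S m) * (INR N * t))%R by ring; rewrite HNt; ring).
    unfold cis; rewrite cos_period, sin_period, cos_0, sin_0; apply (Cconj_RtoC 1). }
  assert (G := Csumn_geom q N); rewrite HqN in G.
  set (s := Csumn _ N) in *.
  replace s with (/ (1 - q) * ((1 - q) * s)) by (field; auto).
  rewrite G; field; auto.
Qed.

Definition cpoly (c : nat -> C) (d : nat) (z : C) : C := Csumn (fun i => c i * z ^ i) d.

Lemma cpoly_orth (N : nat) (r : R) (c : nat -> C) (i d : nat) : (i <= d)%nat -> (d < N)%nat ->
  Csumn (fun j => cpoly c i (r * cis (INR j * (2 * PI / INR N))) * Cconj ((r * cis (INR j * (2 * PI / INR N))) ^ d)) N = 0.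
Proof.
  intros Hi Hd; induction i as [|i IH].
  - rewrite (Csumn_ext _ (fun j => 0 * 0)) by (intros; unfold cpoly; cbn [Csumn]; ring).
    rewrite Csumn_scal; ring.
  - set (z := fun j : nat => r * cis (INR j * (2 * PI / INR N))) in *.
    rewrite (Csumn_ext _ (fun j => cpoly c i (z j) * Cconj (z j ^ d) + c i * (z j ^ i * Cconj (z j ^ d)))).
    2:{ intros j; unfold cpoly; cbn [Csumn]; fold (z j); ring. }
    rewrite Csumn_plus, Csumn_scal; unfold z; rewrite roots_orth, IH by lia; ring.
Qed.

Lemma Cnorm2_plus (x y : C) : Cnorm2 (x + y) = (Cnorm2 x + Cnorm2 y + 2 * Re (x * Cconj y))%R.
Proof. unfold Cnorm2, Re; cbn; ring. Qed.

Lemma Cnorm2_mult (x y : C) : Cnorm2 (x * y) = (Cnorm2 x * Cnorm2 y)%R.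
Proof. unfold Cnorm2; cbn; ring. Qed.

Lemma Rsumn_plus (F G : nat -> R) (n : nat) : Rsumn (fun k => F k + G k)%R n = (Rsumn F n + Rsumn G n)%R.
Proof. induction n as [|n IH]; cbn [Rsumn]; [ring|rewrite IH; ring]. Qed.

Lemma Rsumn_ext (F G : nat -> R) (n : nat) : (forall k, F k = G k) -> Rsumn F n = Rsumn G n.
Proof. intros H; induction n as [|n IH]; cbn [Rsumn]; [|rewrite IH, H]; auto. Qed.

(** Discrete Parseval identity: averaging over N equidistant nodes replaces the integral over the
    circle of radius r. In the induction the new top monomial is orthogonal to everything of lower
    degree, as long as the degree stays below N. *)
Lemma cpoly_parseval (N : nat) (r : R) (c : nat -> C) (d : nat) : (0 <= r)%R -> (d <= N)%nat ->
  Rsumn (fun j => Cnorm2 (cpoly c d (r * cis (INR j * (2 * PI / INR N))))) N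
  = (INR N * Rsumn (fun i => Cnorm2 (c i) * (r ^ i * r ^ i)) d)%R.
Proof.
  intros Hr Hd; induction d as [|d IH].
  - rewrite (Rsumn_ext _ (fun j => 0 * 0)%R) by (intros; unfold cpoly; cbn [Csumn]; rewrite Cnorm2_0; ring).
    rewrite Rsumn_scal; cbn; ring.
  - set (z := fun j : nat => r * cis (INR j * (2 * PI / INR N))) in *.
    assert (Hz : forall j, Cnorm2 (c d * z j ^ d) = (Cnorm2 (c d) * (r ^ d * r ^ d))%R).
    { intros j; rewrite Cnorm2_mult; f_equal; rewrite Cnorm2_Cmod, Cmod_pow; unfold z.
      rewrite Cmod_mult, Cmod_cis, Cmod_R, Rabs_pos_eq, Rmult_1_r; auto. }
    rewrite (Rsumn_ext _ (fun j => (Cnorm2 (cpoly c d (z j)) + Cnorm2 (c d) * (r ^ d * r ^ d))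
        + 2 * Re (Cconj (c d) * (cpoly c d (z j) * Cconj (z j ^ d))))%R).
    2:{ intros j; change (cpoly c (S d) _) with (cpoly c d (z j) + c d * z j ^ d).
        rewrite Cnorm2_plus, Hz; do 3 f_equal; rewrite Cmult_conj; ring. }
    rewrite !Rsumn_plus, Rsumn_const, (Rsumn_scal 2), <- Re_Csumn, Csumn_scal.
    unfold z; rewrite cpoly_orth, IH by lia.
    rewrite Cmult_0_r; cbn [Rsumn]; unfold Re, RtoC; cbn [fst]; ring.
Qed.

Lemma Csum_split (u : nat -> C) (n : nat) : Cabs u -> Csum u = Csumn u n + Csum (fun k => u (n + k)%nat).
Proof.
  intros Hu; induction n as [|n IH]; cbn [Csumn].
  - rewrite Cplus_0_l; reflexivity.
  - assert (Hn : Cabs (fun k => u (n + k)%nat)).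
    { apply (ex_series_incr_n (fun k => Cmod (u k)) n); exact Hu. }
    rewrite IH, (Csum_incr _ Hn), Nat.add_0_r, Cplus_assoc; f_equal.
    apply Csum_ext; intros k; f_equal; lia.
Qed.

Lemma Series_tail (a : nat -> R) (eps : R) (m : nat) : ex_series a -> (0 < eps)%R ->
  exists N, (m <= N)%nat /\ (Rabs (Series (fun k => a (N + k)%nat)) < eps)%R.
Proof.
  intros Ha He.
  assert (L : is_lim_seq (sum_n a) (Series a)) by exact (Series_correct a Ha).
  apply is_lim_seq_spec in L; destruct (L (mkposreal eps He)) as [N0 HN0]; cbn in HN0.
  exists (S (N0 + m)); split; [lia|].
  specialize (HN0 (N0 + m)%nat ltac:(lia)).
  assert (E := Series_incr_n a (S (N0 + m)) ltac:(lia) Ha); cbn [Init.Nat.pred] in E.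
  assert (E2 := sum_n_Reals a (N0 + m)).
  assert (HN1 : (Rabs (sum_n a (N0 + m) - Series a) < eps)%R) by exact HN0.
  rewrite E, E2 in HN1.
  replace (Series _) with (- (sum_f_R0 a (N0 + m) - (sum_f_R0 a (N0 + m) + Series (fun k => a (S (N0 + m) + k)%nat))))%R by ring.
  now rewrite Rabs_Ropp.
Qed.

(** On the circle of radius r a long partial sum is within e of the series, hence bounded by M + e
    at every node; the discrete identity averages this bound. *)
Lemma parseval_lt (c : nat -> C) (B M r : R) (m : nat) :
  (forall n, Cmod (c n) <= B * INR (S n))%R ->
  (forall z, (Cmod z < 1)%R -> (Cmod (Csum (fun n => c n * z ^ n)%C) <= M)%R) ->
  (0 <= r < 1)%R -> (Rsumn (fun i => Cnorm2 (c i) * (r ^ i * r ^ i)) m <= M * M)%R.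
Proof.
  intros Hc HM Hr.
  assert (M0 : (0 <= M)%R) by (apply Rle_trans with (1 := Cmod_ge_0 _) (2 := HM 0 ltac:(rewrite Cmod_0; lra))).
  set (S0 := Rsumn _ m).
  destruct (Rle_or_lt S0 (M * M)) as [|Hlt]; auto; exfalso.
  (* For 0 < e <= 1, (M + e)^2 - M^2 <= e (2 M + 1) < e (2 M + 2) <= S0 - M^2, the contradiction
     sought. *)
  destruct (small_pos 1 (2 * M + 2) (S0 - M * M)) as [e [He [He1 He2]]]; try lra.
  pose (a := fun n => (Cmod (c n) * r ^ n)%R).
  assert (Ha : ex_series a).
  { apply ex_series_dom with (fun n => B * (INR (S n) * r ^ n))%R.
    - intros n; unfold a; assert (P : (0 <= r ^ n)%R) by (apply pow_le; lra).
      rewrite Rabs_pos_eq by (apply Rmult_le_pos; auto; apply Cmod_ge_0).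
      rewrite <- Rmult_assoc; apply Rmult_le_compat_r; auto.
    - apply exR_scal, ex_series_geom_poly1; auto. }
  destruct (Series_tail a e (S m) Ha He) as [N [HmN HN]].
  assert (Hpoly : forall t, (Cnorm2 (cpoly c N (r * cis t)) <= (M + e) * (M + e))%R).
  { intros t; set (z := r * cis t).
    assert (Hz : Cmod z = r) by (unfold z; rewrite Cmod_mult, Cmod_cis, Cmod_R, Rabs_pos_eq; lra).
    assert (Hab : Cabs (fun n => c n * z ^ n)) by (apply Cabs_linear_growth with B; auto; lra).
    assert (E := Csum_split _ N Hab); fold (cpoly c N z) in E.
    assert (T : (Cmod (Csum (fun k => c (N + k)%nat * z ^ (N + k))%C) <= e)%R).
    { apply Rle_trans with (1 := Cmod_Csum _ (proj1 (ex_series_incr_n (fun k => Cmod (c k * z ^ k)) N) Hab)).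
      rewrite (Series_ext _ (fun k => a (N + k)%nat)).
      - apply Rle_trans with (1 := Rle_abs _); lra.
      - intros k; unfold a; now rewrite Cmod_mult, Cmod_pow, Hz. }
    assert (P : (Cmod (cpoly c N z) <= M + e)%R).
    { replace (cpoly c N z) with (Csum (fun n => c n * z ^ n) + - Csum (fun k => c (N + k)%nat * z ^ (N + k))) by (rewrite E; ring).
      apply Rle_trans with (1 := Cmod_triangle _ _).
      rewrite Cmod_opp; generalize (HM z ltac:(lra)); lra. }
    rewrite Cnorm2_Cmod; apply Rmult_le_compat; auto; apply Cmod_ge_0. }
  assert (NP : (0 < INR N)%R) by (apply lt_0_INR; lia).
  assert (F := cpoly_parseval N r c N ltac:(lra) (Nat.le_refl _)).
  assert (G := Rsumn_le _ (fun _ => (M + e) * (M + e))%R N (fun j _ => Hpoly (INR j * (2 * PI / INR N))%R)).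
  rewrite Rsumn_const, F in G.
  apply Rmult_le_reg_l in G; auto.
  assert (K : (S0 <= Rsumn (fun i => Cnorm2 (c i) * (r ^ i * r ^ i)) N)%R).
  { apply Rsumn_mono_n; [|lia]; intros k; rewrite Cnorm2_Cmod.
    repeat apply Rmult_le_pos; try apply Cmod_ge_0; apply pow_le; lra. }
  nra.
Qed.

Lemma Bernoulli_minus (x : R) (n : nat) : (0 <= x <= 1)%R -> (1 - INR n * (1 - x) <= x ^ n)%R.
Proof.
  intros H; induction n as [|n IH]; [cbn; lra|].
  rewrite S_INR; cbn [pow].
  assert (P : (0 <= x ^ n <= 1)%R) by (split; [apply pow_le; lra|rewrite <- (pow1 n); apply pow_incr; lra]).
  nra.
Qed.

(** The case r = 1 - dl with dl tending to 0. As m is fixed, all factors r^(2 i) are at least r^(2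
    m) >= 1 - 2 m dl by Bernoulli's inequality. *)
Lemma parseval_le (c : nat -> C) (B M : R) (m : nat) :
  (forall n, Cmod (c n) <= B * INR (S n))%R ->
  (forall z, (Cmod z < 1)%R -> (Cmod (Csum (fun n => c n * z ^ n)%C) <= M)%R) ->
  (Rsumn (fun i => Cnorm2 (c i)) m <= M * M)%R.
Proof.
  intros Hc HM; set (S0 := Rsumn _ m).
  assert (S0p : (0 <= S0)%R) by (apply Rsumn_pos; intros; rewrite Cnorm2_Cmod; generalize (Cmod_ge_0 (c k)); nra).
  destruct (Rle_or_lt S0 (M * M)) as [|Hlt]; auto; exfalso.
  pose (k := INR (m + m)); assert (Hk : (0 <= k)%R) by apply pos_INR.
  assert (Hq : (0 <= k * S0)%R) by nra.
  destruct (small_pos 1 (2 * (k * S0 + 1)) (S0 - M * M)) as [dl [Hd [Hd1 Hd2]]]; try lra.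
  assert (P := parseval_lt c B M (1 - dl) m Hc HM ltac:(lra)).
  assert (Q : ((1 - dl) ^ (m + m) * S0 <= Rsumn (fun i => Cnorm2 (c i) * ((1 - dl) ^ i * (1 - dl) ^ i)) m)%R).
  { unfold S0; rewrite <- Rsumn_scal; apply Rsumn_le; intros i Hi.
    rewrite Rmult_comm; apply Rmult_le_compat_l; [rewrite Cnorm2_Cmod; generalize (Cmod_ge_0 (c i)); nra|].
    rewrite <- pow_add. replace (m + m)%nat with ((i + i) + (m + m - (i + i)))%nat by lia.
    rewrite pow_add; rewrite <- (Rmult_1_r ((1 - dl) ^ (i + i))) at 2.
    apply Rmult_le_compat_l; [apply pow_le; lra|].
    apply Rle_trans with (1 ^ (m + m - (i + i)))%R; [apply pow_incr; lra|rewrite pow1; lra]. }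
  assert (Be := Bernoulli_minus (1 - dl) (m + m) ltac:(lra)); fold k in Be.
  nra.
Qed.

(** Parseval's inequality with M = 0, applied to the difference. *)
Lemma power_series_unique (c d : nat -> C) (B : R) :
  (forall n, Cmod (c n) <= B * INR (S n))%R -> (forall n, Cmod (d n) <= B * INR (S n))%R ->
  (forall z, (Cmod z < 1)%R -> Csum (fun n => c n * z ^ n) = Csum (fun n => d n * z ^ n)) ->
  forall n, c n = d n.
Proof.
  intros Hc Hd H n.
  assert (P := parseval_le (fun n => c n - d n) (2 * B) 0 (S n)).
  assert (Z : Cmod (c n - d n) = 0%R).
  { assert (X : (Rsumn (fun i => Cnorm2 (c i - d i)%C) (S n) <= 0 * 0)%R).
    { apply P.
      - intros k; replace (c k - d k) with (c k + - d k) by ring.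
        apply Rle_trans with (1 := Cmod_triangle _ _); rewrite Cmod_opp; generalize (Hc k) (Hd k); lra.
      - intros z Hz; rewrite (Csum_ext _ (fun n => c n * z ^ n - d n * z ^ n)) by (intros; ring).
        rewrite Csum_minus by (apply Cabs_linear_growth with B; auto).
        rewrite H by auto; replace (Csum _ - _) with (RtoC 0) by ring; rewrite Cmod_0; lra. }
    cbn [Rsumn] in X.
    assert (Y : (0 <= Rsumn (fun i => Cnorm2 (c i - d i)%C) n)%R).
    { apply Rsumn_pos; intros k; rewrite Cnorm2_Cmod; apply Rmult_le_pos; apply Cmod_ge_0. }
    rewrite (Cnorm2_Cmod (c n - d n)) in X; generalize (Cmod_ge_0 (c n - d n)); nra. }
  apply Cmod_eq_0 in Z; replace (c n) with ((c n - d n) + d n) by ring; rewrite Z; ring.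
Qed.

(** * The chain rule for power series *)

Definition mob (a b c d z : C) : C := (a * z + b) / (c * z + d).

Definition mself (a b c d : C) : Prop :=
  a * d - b * c <> 0 /\
  forall z, (Cmod z < 1)%R -> c * z + d <> 0 /\ (Cmod (mob a b c d z) < 1)%R.

Lemma lft_mob (a b c d z : C) : lft a b c d z = mob a b c d z.
Proof.
  unfold lft, mob, Defs.Cdiv, Cdiv; change Cmul with Cmult; change Cadd with Cplus.
  f_equal; unfold Defs.Cinv, Cinv, Cnorm2; cbn [fst snd pow].
  now rewrite !Rmult_1_r.
Qed.

Lemma lf_selfmap_mself (a b c d : C) : lf_selfmap a b c d <-> mself a b c d.
Proof.
  unfold lf_selfmap, mself; split; intros [H1 H2]; split; auto; intros z Hz;
    destruct (H2 z) as [H3 H4]; auto.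
  - now apply in_disk_Cmod.
  - split; auto; apply in_disk_Cmod; rewrite <- lft_mob; auto.
  - now apply in_disk_Cmod.
  - split; auto; apply in_disk_Cmod; rewrite lft_mob; auto.
Qed.

Lemma pow_diff_bound (z h : C) (r : R) (n : nat) : (Cmod z <= r)%R -> (Cmod (z + h) <= r)%R ->
  (Cmod ((z + h) ^ S n - z ^ S n) <= INR (S n) * r ^ n * Cmod h)%R.
Proof.
  intros Hz Hzh; assert (Hr : (0 <= r)%R) by (apply Rle_trans with (2 := Hz); apply Cmod_ge_0).
  induction n as [|n IH].
  - cbn [Cpow pow INR]; replace ((z + h) * 1 - z * 1) with h by ring; lra.
  - replace ((z + h) ^ S (S n) - z ^ S (S n)) with ((z + h) * ((z + h) ^ S n - z ^ S n) + h * z ^ S n) by (cbn [Cpow]; ring).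
    apply Rle_trans with (1 := Cmod_triangle _ _); rewrite !Cmod_mult, Cmod_pow.
    assert (P : (Cmod z ^ S n <= r ^ S n)%R) by (apply pow_incr; split; [apply Cmod_ge_0|auto]).
    assert (Q : (Cmod (z + h) * Cmod ((z + h) ^ S n - z ^ S n) <= r * (INR (S n) * r ^ n * Cmod h))%R)
      by (apply Rmult_le_compat; auto; apply Cmod_ge_0).
    assert (Q' : (Cmod h * Cmod z ^ S n <= Cmod h * r ^ S n)%R) by (apply Rmult_le_compat_l; auto; apply Cmod_ge_0).
    rewrite (S_INR (S n)); cbn [pow] in *; lra.
Qed.

(** With k = n + 1 the induction step produces 4 k^2 + k + 1, which is at most 4 (k + 1)^2. A bound
    quadratic in n is what [ex_series_geom_poly] sums. *)
Lemma pow_taylor_bound (z h : C) (r : R) (n : nat) : (Cmod z <= r)%R -> (Cmod (z + h) <= r)%R ->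
  (Cmod ((z + h) ^ S (S n) - z ^ S (S n) - INR (S (S n)) * z ^ S n * h)
   <= 4 * (INR (S n) * INR (S n) * r ^ n) * (Cmod h * Cmod h))%R.
Proof.
  intros Hz Hzh; assert (Hr : (0 <= r)%R) by (apply Rle_trans with (2 := Hz); apply Cmod_ge_0).
  assert (Hh := Cmod_ge_0 h).
  induction n as [|n IH].
  - replace ((z + h) ^ 2 - z ^ 2 - INR 2 * z ^ 1 * h) with (h * h).
    + rewrite Cmod_mult; cbn [INR pow]; nra.
    + rewrite (RtoC_INR_S 1), (RtoC_INR_S 0); cbn [Cpow INR]; ring.
  - replace ((z + h) ^ S (S (S n)) - z ^ S (S (S n)) - INR (S (S (S n))) * z ^ S (S n) * h)
      with (z * ((z + h) ^ S (S n) - z ^ S (S n) - INR (S (S n)) * z ^ S n * h)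
            + h * ((z + h) ^ S (S n) - z ^ S (S n)))
      by (rewrite (RtoC_INR_S (S (S n))); cbn [Cpow]; ring).
    apply Rle_trans with (1 := Cmod_triangle _ _); rewrite !(Cmod_mult z), !(Cmod_mult h).
    assert (D := pow_diff_bound z h r (S n) Hz Hzh).
    assert (Q := Rmult_le_compat _ _ _ _ (Cmod_ge_0 z) (Cmod_ge_0 _) Hz IH).
    assert (Q' := Rmult_le_compat_l _ _ _ Hh D).
    assert (P : (0 <= r ^ S n)%R) by now apply pow_le.
    rewrite (S_INR (S n)) in *; cbn [pow] in *.
    assert (I := pos_INR (S n)); set (k := INR (S n)) in *; set (p := (r ^ n)%R) in *; set (y := Cmod h) in *.
    assert (V : (0 <= r * p * (y * y))%R) by (apply Rmult_le_pos; nra).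
    apply Rle_trans with ((r * p * (y * y)) * (4 * k * k + k + 1))%R; [lra|].
    apply Rle_trans with ((r * p * (y * y)) * (4 * (k + 1) * (k + 1)))%R; [|lra].
    apply Rmult_le_compat_l; nra.
Qed.

(** The remainder is summed termwise; its constant depends on [B] and [r] only, so it serves two
    different functions at once in [dval_chain]. *)
Lemma fval_taylor (f : coefs) (B r : R) (z h : C) :
  (forall n, Cmod (f n) <= B)%R -> (r < 1)%R -> (Cmod z <= r)%R -> (Cmod (z + h) <= r)%R ->
  (Cmod (fval f (z + h) - fval f z - h * dval f z)
   <= B * (4 * Series (fun n => INR (S n) * INR (S n) * r ^ n)) * (Cmod h * Cmod h))%R.
Proof.
  intros Hf Hr Hz Hzh; assert (Hr0 : (0 <= r)%R) by (apply Rle_trans with (2 := Hz); apply Cmod_ge_0).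
  assert (A1 := Cabs_fval f (z + h) B Hf ltac:(lra)).
  assert (A2 := Cabs_fval f z B Hf ltac:(lra)).
  assert (A3 := Cabs_dval f z B Hf ltac:(lra)).
  assert (A1' := proj2 (Cabs_shift _) A1); assert (A2' := proj2 (Cabs_shift _) A2); cbn beta in *.
  pose (u := fun n => f (S n) * ((z + h) ^ S n - z ^ S n - INR (S n) * z ^ n * h)).
  assert (E : fval f (z + h) - fval f z - h * dval f z = Csum u /\ Cabs u).
  { assert (Eu : forall n, f (S n) * (z + h) ^ S n + (-(1)) * (f (S n) * z ^ S n) + (- h) * (INR (S n) * f (S n) * z ^ n) = u n)
      by (intros n; unfold u; ring).
    assert (B1 : Cabs (fun n => (-(1)) * (f (S n) * z ^ S n))) by now apply Cabs_scal.
    assert (B2 := Cabs_scal (- h) _ A3).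
    assert (B3 := Cabs_plus _ _ A1' B1).
    split.
    - unfold fval; rewrite (Csum_incr _ A1), (Csum_incr _ A2).
      rewrite <- (Csum_ext _ _ Eu), (Csum_plus _ _ B3 B2), (Csum_plus _ _ A1' B1), (Csum_scal _ _ A2'), (Csum_scal _ _ A3).
      unfold dval; cbn [Cpow]; ring.
    - assert (B4 := Cabs_plus _ _ B3 B2).
      apply Cabs_le with (2 := B4); intros n; rewrite Eu; lra. }
  destruct E as [E Au]; rewrite E.
  rewrite (Csum_incr _ Au).
  replace (u 0%nat) with (RtoC 0) by (unfold u; rewrite (RtoC_INR_S 0); cbn [Cpow INR]; ring).
  rewrite Cplus_0_l.
  assert (Au' := proj2 (Cabs_shift _) Au).
  apply Rle_trans with (1 := Cmod_Csum _ Au').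
  assert (G := ex_series_geom_poly r ltac:(lra)).
  rewrite <- Series_scal_l, <- Series_scal_l, <- Series_scal_r.
  assert (G' : ex_series (fun n => B * (4 * (INR (S n) * INR (S n) * r ^ n)) * (Cmod h * Cmod h))%R).
  { apply (exR_ext (fun n => (Cmod h * Cmod h * B * 4) * (INR (S n) * INR (S n) * r ^ n))%R); [intros n; ring|].
    now apply exR_scal. }
  apply Series_mono; auto.
  intros n; unfold u; rewrite Cmod_mult.
  rewrite Rmult_assoc; apply Rmult_le_compat; auto; try apply Cmod_ge_0.
  now apply pow_taylor_bound.
Qed.

Lemma eq_0_of_small (X : C) (K e : R) : (0 < e)%R ->
  (forall t, 0 < t < e -> Cmod X <= t * K)%R -> X = 0.
Proof.
  intros He H; apply Cmod_eq_0.
  destruct (Rle_lt_or_eq_dec _ _ (Cmod_ge_0 X)) as [P|]; auto; exfalso.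
  assert (HK : (0 < K)%R) by (generalize (H (e / 2)%R ltac:(lra)); intros; apply Rnot_le_lt; intros; nra).
  destruct (small_pos (e / 2) (2 * K) (Cmod X)) as [t [T0 [T1 T2]]]; try lra.
  generalize (H t ltac:(lra)); lra.
Qed.

Lemma mob_diff (a b c d z h : C) : c * z + d <> 0 -> c * (z + h) + d <> 0 ->
  mob a b c d (z + h) = mob a b c d z + h * (a * d - b * c) / ((c * z + d) * (c * (z + h) + d)).
Proof. intros H1 H2; unfold mob; field; auto. Qed.

(** The Taylor bounds of g at z with real increment t, and of f at w with the induced increment k,
    are subtracted and divided by t. What is left is a fixed number bounded by a multiple of t,
    hence 0. *)
Lemma dval_chain (a b c d : C) (f g : coefs) (B : R) (z : C) :
  mself a b c d -> (forall n, Cmod (f n) <= B)%R -> (forall n, Cmod (g n) <= B)%R ->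
  (forall x, (Cmod x < 1)%R -> fval g x = fval f (mob a b c d x)) -> (Cmod z < 1)%R ->
  dval g z = dval f (mob a b c d z) * ((a * d - b * c) / ((c * z + d) * (c * z + d))).
Proof.
  intros [HD HS] Hf Hg H Hz; destruct (HS z Hz) as [Hcz Hm].
  set (w := mob a b c d z) in *; set (D := a * d - b * c) in *.
  set (m := Cmod (c * z + d)).
  assert (m0 : (0 < m)%R) by now apply Cmod_gt_0.
  (* Halfway between the larger modulus and 1; [g0] is the room left for the increments. *)
  set (r := ((1 + Rmax (Cmod z) (Cmod w)) / 2)%R).
  assert (M1 := Rmax_l (Cmod z) (Cmod w)); assert (M2 := Rmax_r (Cmod z) (Cmod w)).
  assert (M3 : (Rmax (Cmod z) (Cmod w) < 1)%R) by now apply Rmax_lub_lt.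
  set (g0 := ((1 - Rmax (Cmod z) (Cmod w)) / 2)%R).
  assert (g0p : (0 < g0)%R) by (unfold g0; lra).
  assert (R1 : (Cmod z + g0 <= r)%R) by (unfold g0, r; lra).
  assert (R2 : (Cmod w + g0 <= r)%R) by (unfold g0, r; lra).
  assert (R3 : (r < 1)%R) by (unfold r; lra).
  (* Bound for |k| / t: of the two denominators in [mob_diff] one has modulus m, the other at least
     m / 2. *)
  set (L := (Cmod D * 2 / (m * m))%R).
  assert (L0 : (0 <= L)%R).
  { apply Rmult_le_pos; [generalize (Cmod_ge_0 D); lra|left; apply Rinv_0_lt_compat; nra]. }
  set (K := (B * (4 * Series (fun n => INR (S n) * INR (S n) * r ^ n)))%R).
  assert (C0 := Cmod_ge_0 c).
  (* The first choice keeps w + k in the disk of radius r, the second keeps the denominator at z + t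
     above m / 2. *)
  destruct (small_pos (Rmin 1 g0) (L + 1) g0) as [e1 [e10 [e11 e12]]]; try lra; [now apply Rmin_glb_lt; lra|].
  destruct (small_pos e1 (2 * (Cmod c + 1)) m) as [e [e0 [e2 e3]]]; try lra.
  assert (X0 : dval g z * (c * z + d) - dval f w * (D / (c * z + d)) = 0).
  { apply eq_0_of_small with (Cmod (dval g z * c) + (K + K * (L * L)) * (m + Cmod c))%R e; auto.
    intros t Ht.
    assert (t1 : (t <= 1)%R) by (generalize (Rmin_l 1 g0); lra).
    assert (t3 : (t * (L + 1) <= g0)%R) by (apply Rle_trans with (2 := e12), Rmult_le_compat_r; lra).
    assert (t4 : (t * (2 * (Cmod c + 1)) <= m)%R) by (apply Rle_trans with (2 := e3), Rmult_le_compat_r; lra).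
    assert (t2 : (t <= g0)%R) by (generalize (Rmin_r 1 g0); lra).
    assert (Ct : Cmod t = t) by (rewrite Cmod_R; apply Rabs_pos_eq; lra).
    set (q := c * (z + t) + d).
    assert (Hq1 : (Cmod q <= m + Cmod c)%R).
    { replace q with ((c * z + d) + c * t) by (unfold q; ring).
      apply Rle_trans with (1 := Cmod_triangle _ _); rewrite Cmod_mult, Ct; fold m; nra. }
    assert (Hq2 : (m <= 2 * Cmod q)%R).
    { assert (T := Cmod_triangle q (- (c * t))).
      replace (q + - (c * t)) with (c * z + d) in T by (unfold q; ring).
      rewrite Cmod_opp, Cmod_mult, Ct in T; fold m in T; nra. }
    assert (Hq0 : q <> 0) by (apply Cmod_gt_0; lra).
    assert (Zt : (Cmod (z + t) <= r)%R).
    { apply Rle_trans with (1 := Cmod_triangle _ _); rewrite Ct; lra. }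
    set (k := t * D / ((c * z + d) * q)).
    assert (Ek : mob a b c d (z + t) = w + k) by (apply mob_diff; auto).
    assert (Hk : (Cmod k <= t * L)%R).
    { unfold k; rewrite Cmod_div by now apply Cmult_neq_0.
      rewrite !Cmod_mult, Ct; fold m; unfold L.
      assert (Hmq : (0 < m * Cmod q)%R) by nra.
      apply Rmult_le_reg_r with (1 := Hmq).
      replace (t * Cmod D / (m * Cmod q) * (m * Cmod q))%R with (t * Cmod D)%R by (field; lra).
      replace (t * (Cmod D * 2 / (m * m)) * (m * Cmod q))%R with (t * Cmod D * (2 * Cmod q / m))%R by (field; lra).
      rewrite <- (Rmult_1_r (t * Cmod D)) at 1; apply Rmult_le_compat_l.
      - apply Rmult_le_pos; [lra|apply Cmod_ge_0].
      - apply Rmult_le_reg_r with m; auto; replace (2 * Cmod q / m * m)%R with (2 * Cmod q)%R by (field; lra); lra. }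
    assert (Wk : (Cmod (w + k) <= r)%R).
    { apply Rle_trans with (1 := Cmod_triangle _ _); nra. }
    assert (T1 := fval_taylor g B r z t Hg R3 ltac:(lra) Zt); fold K in T1.
    assert (T2 := fval_taylor f B r w k Hf R3 ltac:(lra) Wk); fold K in T2.
    rewrite (H (z + t)), (H z), Ek in T1 by lra; fold w in T1.
    assert (K0 : (0 <= K)%R).
    { unfold K; apply Rmult_le_pos; [apply Rle_trans with (2 := Hf 0%nat); apply Cmod_ge_0|].
      apply Rmult_le_pos; [lra|]; apply Series_pos; [|apply ex_series_geom_poly; generalize (Cmod_ge_0 z); lra].
      intros n; apply Rmult_le_pos; [apply Rmult_le_pos; apply pos_INR|apply pow_le; generalize (Cmod_ge_0 z); lra]. }
    assert (Kk : (K * (Cmod k * Cmod k) <= K * (t * L * (t * L)))%R).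
    { apply Rmult_le_compat_l; auto; apply Rmult_le_compat; auto; apply Cmod_ge_0. }
    rewrite Ct in T1.
    assert (T3 : (Cmod (k * dval f w - t * dval g z) <= t * t * (K + K * (L * L)))%R).
    { replace (k * dval f w - t * dval g z)
        with ((fval f (w + k) - fval f w - t * dval g z) + - (fval f (w + k) - fval f w - k * dval f w)) by ring.
      apply Rle_trans with (1 := Cmod_triangle _ _); rewrite Cmod_opp; lra. }
    assert (T4 : (t * Cmod (dval f w * (D / (c * z + d)) - dval g z * q) <= t * (t * (K + K * (L * L)) * (m + Cmod c)))%R).
    { replace (t * Cmod (dval f w * (D / (c * z + d)) - dval g z * q))%R with (Cmod (k * dval f w - t * dval g z) * Cmod q)%R.
      - apply Rle_trans with (t * t * (K + K * (L * L)) * (m + Cmod c))%R; [|lra].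
        apply Rmult_le_compat; auto; apply Cmod_ge_0.
      - rewrite <- Cmod_mult; rewrite <- Ct at 2; rewrite <- Cmod_mult; f_equal; unfold k; field; auto. }
    apply Rmult_le_reg_l in T4; [|lra].
    replace (dval g z * (c * z + d) - dval f w * (D / (c * z + d)))
      with (- (dval g z * c * t) + - (dval f w * (D / (c * z + d)) - dval g z * q)) by (unfold q; ring).
    apply Rle_trans with (1 := Cmod_triangle _ _); rewrite !Cmod_opp, (Cmod_mult _ t), Ct; lra. }
  transitivity ((dval g z * (c * z + d) - dval f w * (D / (c * z + d))) / (c * z + d) + dval f w * (D / ((c * z + d) * (c * z + d)))); [field; auto|].
  rewrite X0; field; auto.
Qed.

(** * Moebius maps and the adjoint of a composition operator *)

Record mat := Mat { ma : C; mb : C; mc : C; md : C }.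

Definition mden (M : mat) (z : C) : C := mc M * z + md M.
Definition mnum (M : mat) (z : C) : C := ma M * z + mb M.
Definition mapp (M : mat) (z : C) : C := mnum M z / mden M z.
Definition mdet (M : mat) : C := ma M * md M - mb M * mc M.
Definition mder (M : mat) (z : C) : C := mdet M / (mden M z * mden M z).
Definition mmul (M N : mat) : mat :=
  Mat (ma M * ma N + mb M * mc N) (ma M * mb N + mb M * md N)
      (mc M * ma N + md M * mc N) (mc M * mb N + md M * md N).

(* The Krein adjoint: w |-> 1 / conj (M^-1 (1 / conj w)). *)
Definition krein (M : mat) : mat :=
  Mat (Cconj (ma M)) (- Cconj (mc M)) (- Cconj (mb M)) (Cconj (md M)).

(** Comparing moduli of numerator and denominator states at once that there is no pole in the disk,
    and the condition still makes sense on the closed disk. *)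
Definition selfmap (M : mat) : Prop :=
  mdet M <> 0 /\ forall z, (Cmod z < 1)%R -> (Cmod (mnum M z) < Cmod (mden M z))%R.

Lemma Cmod_lt_neq_0 (x y : C) : (Cmod x < Cmod y)%R -> y <> 0.
Proof. intros H; apply Cmod_gt_0; generalize (Cmod_ge_0 x); lra. Qed.

Lemma Cmod_div_lt_1 (x y : C) : (Cmod x < Cmod y)%R -> (Cmod (x / y) < 1)%R.
Proof.
  intros H; assert (Hy := Cmod_lt_neq_0 x y H); assert (G := Cmod_ge_0 x).
  rewrite Cmod_div by auto; apply Rmult_lt_reg_r with (Cmod y); [lra|].
  unfold Rdiv; rewrite Rmult_assoc, Rinv_l by lra; lra.
Qed.

Lemma Cmod_div_lt_1_inv (x y : C) : y <> 0 -> (Cmod (x / y) < 1)%R -> (Cmod x < Cmod y)%R.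
Proof.
  intros Hy H; assert (P : (0 < Cmod y)%R) by now apply Cmod_gt_0.
  rewrite Cmod_div in H by auto; apply Rmult_lt_compat_r with (r := Cmod y) in H; auto.
  unfold Rdiv in H; rewrite Rmult_assoc, Rinv_l in H by lra; lra.
Qed.

Lemma selfmap_mself (M : mat) : selfmap M <-> mself (ma M) (mb M) (mc M) (md M).
Proof.
  unfold selfmap, mself; split; intros [H1 H2]; split; auto; intros z Hz; specialize (H2 z Hz).
  - split; [exact (Cmod_lt_neq_0 _ _ H2)|exact (Cmod_div_lt_1 _ _ H2)].
  - destruct H2; now apply Cmod_div_lt_1_inv.
Qed.

Lemma selfmap_mden (M : mat) (z : C) : selfmap M -> (Cmod z < 1)%R -> mden M z <> 0.
Proof. intros [_ H] Hz; exact (Cmod_lt_neq_0 _ _ (H z Hz)). Qed.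

Lemma selfmap_mapp (M : mat) (z : C) : selfmap M -> (Cmod z < 1)%R -> (Cmod (mapp M z) < 1)%R.
Proof. intros [_ H] Hz; exact (Cmod_div_lt_1 _ _ (H z Hz)). Qed.

(** Continuity up to the boundary: a failure at z persists at (1 - t) z, a point of the open disk,
    once t is small against the gap. *)
Lemma selfmap_closed (M : mat) (z : C) : selfmap M -> (Cmod z <= 1)%R -> (Cmod (mnum M z) <= Cmod (mden M z))%R.
Proof.
  intros [_ H] Hz; apply Rnot_lt_le; intros Hlt.
  set (K := (Cmod (ma M) + Cmod (mc M) + 1)%R).
  assert (K1 : (1 <= K)%R) by (unfold K; generalize (Cmod_ge_0 (ma M)) (Cmod_ge_0 (mc M)); lra).
  set (gap := (Cmod (mnum M z) - Cmod (mden M z))%R) in *.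
  assert (gp : (0 < gap)%R) by (unfold gap; lra).
  destruct (small_pos 1 (2 * K) gap) as [t [t0 [t1 t2]]]; try lra.
  assert (Cz := Cmod_ge_0 z).
  assert (L : (Cmod (RtoC (1 - t) * z) < 1)%R).
  { rewrite Cmod_mult, Cmod_R, Rabs_pos_eq by lra; nra. }
  specialize (H _ L).
  assert (E1 : mnum M z = mnum M (RtoC (1 - t) * z) + t * (ma M * z)) by (unfold mnum; rewrite RtoC_minus; ring).
  assert (E2 : mden M (RtoC (1 - t) * z) = mden M z + - (t * (mc M * z))) by (unfold mden; rewrite RtoC_minus; ring).
  assert (T1 := Cmod_triangle (mnum M (RtoC (1 - t) * z)) (t * (ma M * z))); rewrite <- E1 in T1.
  assert (T2 := Cmod_triangle (mden M z) (- (t * (mc M * z)))); rewrite <- E2, Cmod_opp in T2.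
  rewrite !Cmod_mult, Cmod_R, (Rabs_pos_eq t) in T1, T2 by lra.
  assert (B1 : (Cmod (ma M) * Cmod z <= Cmod (ma M))%R) by (generalize (Cmod_ge_0 (ma M)); nra).
  assert (B2 : (Cmod (mc M) * Cmod z <= Cmod (mc M))%R) by (generalize (Cmod_ge_0 (mc M)); nra).
  unfold K, gap in *; nra.
Qed.

(** Otherwise z = (d - u b) / (u a - c) lies in the closed disk and satisfies u num(z) = den(z), so
    M would send it to 1 / u, outside the closed disk. In the degenerate cases two simultaneous
    zeros contradict det <> 0. *)
Lemma selfmap_krein_lt (M : mat) (u : C) : selfmap M -> (Cmod u < 1)%R ->
  (Cmod (u * ma M - mc M) < Cmod (md M - u * mb M))%R.
Proof.
  intros HM Hu; apply Rnot_le_lt; intros Hle.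
  destruct (Ceq_dec (u * ma M - mc M) 0) as [E|E].
  - assert (E' : md M - u * mb M = 0).
    { apply Cmod_eq_0; rewrite E, Cmod_0 in Hle; generalize (Cmod_ge_0 (md M - u * mb M)); lra. }
    apply (proj1 HM); unfold mdet.
    replace (ma M * md M - mb M * mc M) with (ma M * (md M - u * mb M) + mb M * (u * ma M - mc M)) by ring.
    rewrite E, E'; ring.
  - set (z := (md M - u * mb M) / (u * ma M - mc M)).
    assert (Hz : (Cmod z <= 1)%R).
    { unfold z; rewrite Cmod_div by auto; apply Rmult_le_reg_r with (Cmod (u * ma M - mc M)); [now apply Cmod_gt_0|].
      unfold Rdiv; rewrite Rmult_assoc, Rinv_l, Rmult_1_r; [lra|]; intros X; apply E; now apply Cmod_eq_0. }
    assert (C1 := selfmap_closed M z HM Hz).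
    assert (Ez : u * mnum M z = mden M z) by (unfold mnum, mden, z; field; auto).
    rewrite <- Ez, Cmod_mult in C1.
    assert (N0 : mnum M z = 0) by (apply Cmod_eq_0; generalize (Cmod_ge_0 (mnum M z)); nra).
    assert (D0 : mden M z = 0) by (rewrite <- Ez, N0; ring).
    apply (proj1 HM).
    replace (mdet M) with (ma M * mden M z - mc M * mnum M z) by (unfold mdet, mden, mnum; ring).
    rewrite N0, D0; ring.
Qed.

Lemma selfmap_krein (M : mat) : selfmap M -> selfmap (krein M).
Proof.
  intros HM; split.
  - intros E; apply (proj1 HM); unfold mdet in *; cbn in E.
    rewrite <- (Cconj_conj (ma M * md M - mb M * mc M)), Cminus_conj, !Cmult_conj.
    replace (Cconj (ma M) * Cconj (md M) - Cconj (mb M) * Cconj (mc M))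
      with (Cconj (ma M) * Cconj (md M) - - Cconj (mc M) * - Cconj (mb M)) by ring.
    rewrite E; apply (Cconj_RtoC 0).
  - intros z Hz.
    assert (K := selfmap_krein_lt M (Cconj z) HM ltac:(now rewrite Cmod_conj)).
    rewrite <- Cmod_conj, <- (Cmod_conj (md M - _)), !Cminus_conj, !Cmult_conj, Cconj_conj in K.
    unfold mnum, mden; cbn [krein ma mb mc md].
    replace (Cconj (ma M) * z + - Cconj (mc M)) with (z * Cconj (ma M) - Cconj (mc M)) by ring.
    now replace (- Cconj (mb M) * z + Cconj (md M)) with (Cconj (md M) - z * Cconj (mb M)) by ring.
Qed.

Lemma mnum_mmul (M N : mat) (z : C) : mden N z <> 0 -> mnum (mmul M N) z = mnum M (mapp N z) * mden N z.
Proof. intros H; unfold mapp, mnum, mden in *; cbn; field; auto. Qed.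

Lemma mden_mmul (M N : mat) (z : C) : mden N z <> 0 -> mden (mmul M N) z = mden M (mapp N z) * mden N z.
Proof. intros H; unfold mapp, mnum, mden in *; cbn; field; auto. Qed.

Lemma mdet_mmul (M N : mat) : mdet (mmul M N) = mdet M * mdet N.
Proof. unfold mdet; cbn; ring. Qed.

Lemma selfmap_mmul (M N : mat) : selfmap M -> selfmap N -> selfmap (mmul M N).
Proof.
  intros HM HN; split; [rewrite mdet_mmul; apply Cmult_neq_0; [apply HM|apply HN]|].
  intros z Hz; assert (D := selfmap_mden N z HN Hz).
  rewrite mnum_mmul, mden_mmul, !Cmod_mult by auto.
  apply Rmult_lt_compat_r; [now apply Cmod_gt_0|].
  apply HM, selfmap_mapp; auto.
Qed.

Lemma mapp_mmul (M N : mat) (z : C) : mden N z <> 0 -> mden M (mapp N z) <> 0 -> mapp (mmul M N) z = mapp M (mapp N z).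
Proof.
  intros H1 H2; unfold mapp at 1; rewrite mnum_mmul, mden_mmul by auto.
  unfold mapp at 3; field; auto.
Qed.

Lemma mder_mmul (M N : mat) (z : C) : mden N z <> 0 -> mden M (mapp N z) <> 0 ->
  mder (mmul M N) z = mder M (mapp N z) * mder N z.
Proof.
  intros H1 H2; unfold mder; rewrite mden_mmul, mdet_mmul by auto; field; auto.
Qed.

(** Weaker than [InD], but enough for convergence of [fval] and [dval] in the disk and for
    uniqueness; linear combinations inherit it at once. *)
Definition coefs_bounded (f : coefs) : Prop := exists B, forall n, (Cmod (f n) <= B)%R.

Lemma InD_bounded (f : coefs) : InD f -> coefs_bounded f.
Proof. intros H; exists (Dnorm2 f + 1)%R; intros n; apply coef_le; auto; lra. Qed.

Lemma bounded_lin (A B : C) (f g : coefs) : coefs_bounded f -> coefs_bounded g ->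
  coefs_bounded (fun n => A * f n + B * g n).
Proof.
  intros [F HF] [G HG]; exists (Cmod A * F + Cmod B * G)%R; intros n.
  apply Rle_trans with (1 := Cmod_triangle _ _); rewrite !Cmod_mult.
  apply Rplus_le_compat; apply Rmult_le_compat_l; auto; apply Cmod_ge_0.
Qed.

Lemma bounded2 (f g : coefs) : coefs_bounded f -> coefs_bounded g ->
  exists B, (forall n, Cmod (f n) <= B)%R /\ (forall n, Cmod (g n) <= B)%R.
Proof.
  intros [F HF] [G HG]; exists (Rmax F G); split; intros n;
    [apply Rle_trans with (1 := HF n), Rmax_l|apply Rle_trans with (1 := HG n), Rmax_r].
Qed.

Lemma bounded_cst1 : coefs_bounded cst1.
Proof. apply InD_bounded, InD_cst1. Qed.

Lemma bounded_es (s : C) : (Cmod s < 1)%R -> coefs_bounded (es s).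
Proof. intros; now apply InD_bounded, InD_es. Qed.

Lemma fval_lin (A B : C) (f g : coefs) (z : C) : coefs_bounded f -> coefs_bounded g -> (Cmod z < 1)%R ->
  fval (fun n => A * f n + B * g n) z = A * fval f z + B * fval g z.
Proof.
  intros [F HF] [G HG] Hz; assert (H1 := Cabs_fval f z F HF Hz); assert (H2 := Cabs_fval g z G HG Hz).
  unfold fval; rewrite <- !Csum_scal, <- Csum_plus by (auto using Cabs_scal).
  apply Csum_ext; intros n; ring.
Qed.

Lemma dval_lin (A B : C) (f g : coefs) (z : C) : coefs_bounded f -> coefs_bounded g -> (Cmod z < 1)%R ->
  dval (fun n => A * f n + B * g n) z = A * dval f z + B * dval g z.
Proof.
  intros [F HF] [G HG] Hz; assert (H1 := Cabs_dval f z F HF Hz); assert (H2 := Cabs_dval g z G HG Hz).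
  unfold dval; rewrite <- !Csum_scal, <- Csum_plus by (auto using Cabs_scal).
  apply Csum_ext; intros n; ring.
Qed.

Lemma fval_unique (f g : coefs) : coefs_bounded f -> coefs_bounded g ->
  (forall z, (Cmod z < 1)%R -> fval f z = fval g z) -> forall n, f n = g n.
Proof.
  intros Hf Hg H; destruct (bounded2 f g Hf Hg) as [B [HF HG]].
  assert (B0 : (0 <= B)%R) by (apply Rle_trans with (2 := HF 0%nat); apply Cmod_ge_0).
  apply power_series_unique with B; auto; intros n;
    [apply Rle_trans with (1 := HF n)|apply Rle_trans with (1 := HG n)]; rewrite S_INR; generalize (pos_INR n); nra.
Qed.

(** The derivative does not see the coefficient of index 0, so identities obtained this way start at
    index 1. *)
Lemma dval_unique (f g : coefs) : coefs_bounded f -> coefs_bounded g ->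
  (forall z, (Cmod z < 1)%R -> dval f z = dval g z) -> forall n, f (S n) = g (S n).
Proof.
  intros Hf Hg H n; destruct (bounded2 f g Hf Hg) as [B [HF HG]].
  assert (E : INR (S n) * f (S n) = INR (S n) * g (S n)).
  { apply (power_series_unique (fun n => INR (S n) * f (S n)) (fun n => INR (S n) * g (S n)) B); auto;
    intros k; rewrite Cmod_mult, Cmod_R, Rabs_pos_eq, Rmult_comm by apply pos_INR;
    apply Rmult_le_compat_r; auto; apply pos_INR. }
  assert (N := INR_S_neq_0 n).
  assert (X : forall x y : C, INR (S n) * x = INR (S n) * y -> x = y); [intros x y E'|now apply X].
  replace x with ((INR (S n) * x) / INR (S n)) by (field; auto); rewrite E'; field; auto.
Qed.

Lemma fval_cst1 (z : C) : (Cmod z < 1)%R -> fval cst1 z = 1.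
Proof.
  intros Hz; destruct bounded_cst1 as [B HB]; unfold fval; rewrite Csum_incr by now apply Cabs_fval with B.
  rewrite (Csum_ext _ (fun n => 0 * z ^ n)) by (intros; cbn [cst1 Cpow]; ring).
  rewrite Csum_scal by now apply Cabs_geom.
  cbn [cst1 Cpow]; ring.
Qed.

Lemma dval_kern (v z : C) : (Cmod v < 1)%R -> (Cmod z < 1)%R -> dval (kern v) z = Cconj v / (1 - Cconj v * z).
Proof.
  intros Hv Hz; assert (L : (Cmod (Cconj v * z) < 1)%R) by (apply Cmod_mult_lt_1; auto; now rewrite Cmod_conj).
  unfold dval; rewrite (Csum_ext _ (fun n => Cconj v * (Cconj v * z) ^ n)).
  - rewrite Csum_scal, Csum_geom by (auto using Cabs_geom); reflexivity.
  - intros n; unfold kern; rewrite Cpow_mult_l; cbn [Cpow]; field; apply INR_S_neq_0.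
Qed.

(* The symbol data of e_u o M = const + kbeta * e_(ks). *)
Definition ks (M : mat) (u : C) : C := (u * ma M - mc M) / (md M - u * mb M).
Definition kbeta (M : mat) (u : C) : C := mdet M / ((md M - u * mb M) * (md M - u * mb M)).

Lemma Cmod_ks (M : mat) (u : C) : selfmap M -> (Cmod u < 1)%R -> (Cmod (ks M u) < 1)%R.
Proof. intros HM Hu; apply Cmod_div_lt_1, selfmap_krein_lt; auto. Qed.

Lemma krein_den_neq_0 (M : mat) (u : C) : selfmap M -> (Cmod u < 1)%R -> md M - u * mb M <> 0.
Proof. intros HM Hu; exact (Cmod_lt_neq_0 _ _ (selfmap_krein_lt M u HM Hu)). Qed.

Lemma mden_minus (M : mat) (u z : C) : selfmap M -> (Cmod u < 1)%R ->
  mden M z - u * mnum M z = (md M - u * mb M) * (1 - ks M u * z).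
Proof.
  intros HM Hu; assert (K := krein_den_neq_0 M u HM Hu); unfold mden, mnum, ks; field; auto.
Qed.

Lemma one_minus_mapp (M : mat) (u z : C) : selfmap M -> (Cmod u < 1)%R -> (Cmod z < 1)%R ->
  1 - u * mapp M z = (md M - u * mb M) * (1 - ks M u * z) / mden M z.
Proof.
  intros HM Hu Hz; rewrite <- mden_minus by auto; unfold mapp; field; now apply selfmap_mden.
Qed.

Lemma dval_es_comp (M : mat) (u z : C) : selfmap M -> (Cmod u < 1)%R -> (Cmod z < 1)%R ->
  dval (es u) (mapp M z) * mder M z = kbeta M u * dval (es (ks M u)) z.
Proof.
  intros HM Hu Hz; assert (Hs := Cmod_ks M u HM Hu).
  rewrite !dval_es by (auto using selfmap_mapp).
  rewrite one_minus_mapp by auto.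
  assert (K := krein_den_neq_0 M u HM Hu); assert (D := selfmap_mden M z HM Hz).
  assert (N := one_minus_neq_0 _ (Cmod_mult_lt_1 _ _ Hs Hz)).
  unfold mder, kbeta; field; auto.
Qed.


Lemma comp_InD (phi : C -> C) (T : op) (f : coefs) : is_comp_op phi T -> InD f -> InD (T f).
Proof. intros H Hf; apply (H f Hf). Qed.

Lemma comp_cst1 (M : mat) (T : op) : selfmap M -> is_comp_op (mapp M) T -> forall n, T cst1 n = cst1 n.
Proof.
  intros HM HT; apply fval_unique; [apply InD_bounded, (comp_InD _ _ _ HT), InD_cst1|apply bounded_cst1|].
  intros z Hz; rewrite (comp_op_fval _ _ _ _ HT InD_cst1 Hz), !fval_cst1; auto; now apply selfmap_mapp.
Qed.

(** Composition pulls the pole 1 / u back to 1 / [ks M u], and the factor [kbeta] is fixed by the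
    derivative. The constant is the value e_u(M 0). *)
Lemma comp_es (M : mat) (T : op) (u : C) : selfmap M -> is_comp_op (mapp M) T -> (Cmod u < 1)%R ->
  forall n, T (es u) n = mb M / (md M - u * mb M) * cst1 n + kbeta M u * es (ks M u) n.
Proof.
  intros HM HT Hu; assert (Hs := Cmod_ks M u HM Hu).
  apply fval_unique; [now apply InD_bounded, (comp_InD _ _ _ HT), InD_es|
    apply bounded_lin; auto using bounded_cst1, bounded_es|].
  intros z Hz; rewrite (comp_op_fval _ _ _ _ HT (InD_es u Hu) Hz), fval_lin by auto using bounded_cst1, bounded_es.
  rewrite fval_cst1, !fval_es by auto using selfmap_mapp.
  assert (K := krein_den_neq_0 M u HM Hu); assert (D := selfmap_mden M z HM Hz).
  assert (N := one_minus_neq_0 _ (Cmod_mult_lt_1 _ _ Hs Hz)).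
  rewrite one_minus_mapp by auto.
  unfold kbeta, mapp.
  transitivity (mnum M z / ((md M - u * mb M) * (1 - ks M u * z))); [field; auto|].
  unfold mdet, mnum, ks in *; field; repeat split; auto.
  intros E; apply N; transitivity ((md M - u * mb M - (u * ma M - mc M) * z) / (md M - u * mb M)); [field; auto|].
  rewrite E; field; auto.
Qed.

Lemma comp_0 (M : mat) (T : op) (f : coefs) : is_comp_op (mapp M) T -> InD f ->
  T f 0%nat = fval f (mapp M 0).
Proof.
  intros HT Hf; destruct (InD_bounded _ (comp_InD _ _ _ HT Hf)) as [B HB].
  rewrite <- (fval_0 (T f) B HB); apply comp_op_fval; auto using Cmod_0_lt_1.
Qed.

Lemma comp_dval (M : mat) (T : op) (f : coefs) (z : C) : selfmap M -> is_comp_op (mapp M) T -> InD f ->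
  (Cmod z < 1)%R -> dval (T f) z = dval f (mapp M z) * mder M z.
Proof.
  intros HM HT Hf Hz.
  destruct (bounded2 f (T f) (InD_bounded f Hf) (InD_bounded _ (comp_InD _ _ _ HT Hf))) as [B [B1 B2]].
  apply (dval_chain (ma M) (mb M) (mc M) (md M) f (T f) B z); auto.
  - now apply selfmap_mself.
  - intros x Hx; now apply comp_op_fval.
Qed.

Lemma dinner_ext_r (f g h : coefs) : (forall n, g n = h n) -> dinner f g = dinner f h.
Proof. intros H; apply Csum_ext; intros n; now rewrite H. Qed.

Lemma dinner_lin_r (A B : C) (f g h : coefs) : InD f -> InD g -> InD h ->
  dinner f (fun n => A * g n + B * h n) = Cconj A * dinner f g + Cconj B * dinner f h.
Proof.
  intros Hf Hg Hh; assert (H1 := Cabs_dinner f g Hf Hg); assert (H2 := Cabs_dinner f h Hf Hh).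
  unfold dinner; rewrite <- !Csum_scal, <- Csum_plus by auto using Cabs_scal.
  apply Csum_ext; intros n; rewrite Cplus_conj, !Cmult_conj; ring.
Qed.

Lemma adjoint_conj (M : mat) (T S : op) (f g : coefs) : is_comp_op (mapp M) T -> is_adjoint T S ->
  InD f -> InD g -> dinner (S g) f = dinner g (T f).
Proof.
  intros HT HS Hf Hg; assert (HTf := comp_InD _ _ _ HT Hf); assert (HSg := proj1 (HS g Hg)).
  rewrite (dinner_conj f (S g)), <- (adjoint_dinner T S f g), (dinner_conj g (T f)), Cconj_conj; auto.
Qed.

(** Pairing with the constant 1, which composition leaves unchanged. *)
Lemma adjoint_0 (M : mat) (T S : op) (g : coefs) : selfmap M -> is_comp_op (mapp M) T -> is_adjoint T S ->
  InD g -> S g 0%nat = g 0%nat.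
Proof.
  intros HM HT HS Hg; assert (HSg := proj1 (HS g Hg)).
  rewrite <- (dinner_cst1_r (S g)), <- (dinner_cst1_r g) by auto.
  rewrite (adjoint_conj M T S) by auto using InD_cst1.
  apply dinner_ext_r; exact (comp_cst1 M T HM HT).
Qed.

(** The derivative at w is the pairing with e_(conj w). The adjoint moves the composition onto that
    kernel, where [comp_es] is explicit: the constant yields the kernel at M 0, the new pole yields
    the Krein adjoint. *)
Lemma adjoint_dval (M : mat) (T S : op) (g : coefs) (w : C) : selfmap M -> is_comp_op (mapp M) T -> is_adjoint T S ->
  InD g -> (Cmod w < 1)%R ->
  dval (S g) w = g 0%nat * dval (kern (mapp M 0)) w + dval g (mapp (krein M) w) * mder (krein M) w.
Proof.
  intros HM HT HS Hg Hw; assert (HSg := proj1 (HS g Hg)).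
  assert (Hcw : (Cmod (Cconj w) < 1)%R) by now rewrite Cmod_conj.
  assert (Hs := Cmod_ks M _ HM Hcw).
  rewrite <- dinner_es_r, (adjoint_conj M T S) by auto using InD_es.
  rewrite (dinner_ext_r g _ _ (comp_es M T _ HM HT Hcw)), dinner_lin_r by auto using InD_cst1, InD_es.
  rewrite dinner_cst1_r by auto.
  rewrite <- (Cconj_conj (ks M (Cconj w))), dinner_es_r by (auto; now rewrite Cmod_conj).
  assert (K := krein_den_neq_0 M _ HM Hcw).
  assert (Z := Cmod_0_lt_1).
  rewrite dval_kern by auto using selfmap_mapp.
  assert (D0 : md M <> 0) by (generalize (selfmap_mden M 0 HM Z); unfold mden; now rewrite Cmult_0_r, Cplus_0_l).
  assert (D0' : Cconj (md M) <> 0) by (apply Cmod_gt_0; rewrite Cmod_conj; now apply Cmod_gt_0).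
  assert (K' : Cconj (md M) - w * Cconj (mb M) <> 0).
  { apply Cmod_gt_0; rewrite <- Cmod_conj, Cminus_conj, Cmult_conj, !Cconj_conj; now apply Cmod_gt_0. }
  f_equal.
  - rewrite Cdiv_conj, Cminus_conj, Cmult_conj, Cconj_conj by auto.
    replace (mapp M 0) with (mb M / md M) by (unfold mapp, mnum, mden; rewrite !Cmult_0_r, !Cplus_0_l; auto).
    rewrite Cdiv_conj by auto; field; repeat split; auto.
    intros E; apply K'; rewrite <- E; ring.
  - rewrite Cmult_comm; f_equal.
    + f_equal; unfold ks, mapp, mnum, mden; cbn [krein ma mb mc md].
      rewrite Cdiv_conj, !Cminus_conj, !Cmult_conj, Cconj_conj by auto; f_equal; ring.
    + unfold kbeta, mder, mden, mdet; cbn [krein ma mb mc md].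
      rewrite Cdiv_conj, Cmult_conj, !Cminus_conj, !Cmult_conj, Cconj_conj by (now apply Cmult_neq_0).
      f_equal; ring.
Qed.

(** * Compact operators on the Dirichlet space *)

Lemma Series_split (a : nat -> R) (n : nat) : ex_series a ->
  Series a = (Rsumn a n + Series (fun k => a (n + k)%nat))%R.
Proof.
  intros Ha; induction n as [|n IH]; cbn [Rsumn].
  - rewrite Rplus_0_l; reflexivity.
  - assert (Hn : ex_series (fun k => a (n + k)%nat)) by (apply (ex_series_incr_n a n); exact Ha).
    rewrite IH, (Series_incr_1 _ Hn), Nat.add_0_r, Rplus_assoc; do 2 f_equal.
    apply Series_ext; intros k; f_equal; lia.
Qed.

Lemma ex_series_abs_pair (f h : coefs) : InD f -> InD h ->
  ex_series (fun n => dweight n * (Cmod (f n) * Cmod (h n)))%R.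
Proof.
  intros Hf Hh; apply exR_ext with (2 := Cabs_dinner f h Hf Hh).
  intros n; rewrite !Cmod_mult, Cmod_conj, Cmod_R, Rabs_pos_eq; auto.
  generalize (dweight_ge_1 n); lra.
Qed.

(* The first coefficients are small; the tail is handled by AM-GM against the small tail of h. *)
Lemma pairing_small (h : coefs) (M eps : R) : InD h -> (0 <= M)%R -> (0 < eps)%R ->
  exists N dl, (0 < dl)%R /\ forall f, InD f -> (Dnorm2 f <= M)%R ->
    (forall n, (n <= N)%nat -> (Cmod (f n) <= dl)%R) ->
    (Series (fun n => dweight n * (Cmod (f n) * Cmod (h n))) <= eps)%R.
Proof.
  (* Weight of the AM-GM inequality: the part of f in the tail costs kp M / 2 <= eps / 2, leaving
     eps / 4 for the tail of h and eps / 4 for the first coefficients. *)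
  intros Hh HM He; set (kp := (eps / (M + 1))%R).
  assert (kp0 : (0 < kp)%R) by (apply Rdiv_lt_0_compat; lra).
  assert (kpM : (kp * M <= eps)%R).
  { apply Rle_trans with (kp * (M + 1))%R; [nra|]; unfold kp; right; field; lra. }
  assert (Hh' := proj1 (InD_ex_series h) Hh).
  destruct (Series_tail _ (kp * eps / 2)%R 0 Hh' ltac:(nra)) as [N [_ HN]].
  set (H := Rsumn (fun n => dweight n * Cmod (h n))%R N).
  assert (H0 : (0 <= H)%R).
  { apply Rsumn_pos; intros n; apply Rmult_le_pos; [generalize (dweight_ge_1 n); lra|apply Cmod_ge_0]. }
  exists N, (eps / (4 * (H + 1)))%R; split; [apply Rdiv_lt_0_compat; lra|].
  set (dl := (eps / (4 * (H + 1)))%R).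
  assert (dl0 : (0 < dl)%R) by (apply Rdiv_lt_0_compat; lra).
  assert (dlH : (dl * H <= eps / 4)%R).
  { apply Rle_trans with (dl * (H + 1))%R; [nra|]; unfold dl; right; field; lra. }
  intros f Hf HfM Hsmall.
  assert (Hf' := proj1 (InD_ex_series f) Hf).
  assert (Hp := ex_series_abs_pair f h Hf Hh).
  rewrite (Series_split _ N Hp).
  assert (A : (Rsumn (fun n => dweight n * (Cmod (f n) * Cmod (h n))) N <= dl * H)%R).
  { unfold H; rewrite <- Rsumn_scal; apply Rsumn_le; intros k Hk.
    assert (W := dweight_ge_1 k); assert (G := Cmod_ge_0 (h k)); assert (F := Hsmall k ltac:(lia)).
    replace (dl * (dweight k * Cmod (h k)))%R with (dweight k * (dl * Cmod (h k)))%R by ring.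
    apply Rmult_le_compat_l; [lra|]; apply Rmult_le_compat_r; auto. }
  assert (Tf : ex_series (fun k => dweight (N + k) * Cnorm2 (f (N + k)%nat))%R)
    by (apply (ex_series_incr_n (fun n => dweight n * Cnorm2 (f n))%R N); exact Hf').
  assert (Th : ex_series (fun k => dweight (N + k) * Cnorm2 (h (N + k)%nat))%R)
    by (apply (ex_series_incr_n (fun n => dweight n * Cnorm2 (h n))%R N); exact Hh').
  assert (Tp : ex_series (fun k => dweight (N + k) * (Cmod (f (N + k)%nat) * Cmod (h (N + k)%nat)))%R)
    by (apply (ex_series_incr_n (fun n => dweight n * (Cmod (f n) * Cmod (h n)))%R N); exact Hp).
  assert (Bd : (Series (fun k => dweight (N + k) * (Cmod (f (N + k)%nat) * Cmod (h (N + k)%nat)))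
    <= kp / 2 * Series (fun k => dweight (N + k) * Cnorm2 (f (N + k)%nat))
      + / (2 * kp) * Series (fun k => dweight (N + k) * Cnorm2 (h (N + k)%nat)))%R).
  { rewrite <- !Series_scal_l, <- Series_plus by now apply exR_scal.
    apply Series_mono; auto; [|apply exR_plus; now apply exR_scal].
    intros k; rewrite !Cnorm2_Cmod; assert (W := dweight_ge_1 (N + k)).
    generalize (Cmod (f (N + k)%nat)) (Cmod (h (N + k)%nat)); intros x y.
    replace (kp / 2 * (dweight (N + k) * (x * x)) + / (2 * kp) * (dweight (N + k) * (y * y)))%R
      with (dweight (N + k) * (kp / 2 * (x * x) + / (2 * kp) * (y * y)))%R by (field; lra).
    apply Rmult_le_compat_l; [lra|].
    assert (Q : (0 <= / (2 * kp) * ((kp * x - y) * (kp * x - y)))%R).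
    { apply Rmult_le_pos; [left; apply Rinv_0_lt_compat; lra|apply Rle_0_sqr]. }
    replace (/ (2 * kp) * ((kp * x - y) * (kp * x - y)))%R
      with (kp / 2 * (x * x) + / (2 * kp) * (y * y) - x * y)%R in Q by (field; lra).
    lra. }
  assert (Fl : (Series (fun k => dweight (N + k) * Cnorm2 (f (N + k)%nat)) <= M)%R).
  { apply Rle_trans with (2 := HfM); unfold Dnorm2; rewrite (Series_split _ N Hf').
    generalize (Rsumn_pos (fun n => dweight n * Cnorm2 (f n))%R N (Dterm_pos f)); lra. }
  assert (Hl : (/ (2 * kp) * Series (fun k => dweight (N + k) * Cnorm2 (h (N + k)%nat)) <= eps / 4)%R).
  { apply Rmult_le_reg_l with (2 * kp)%R; [lra|].
    rewrite <- Rmult_assoc, Rinv_r, Rmult_1_l by lra.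
    generalize (Rle_abs (Series (fun k => dweight (N + k) * Cnorm2 (h (N + k)%nat)))%R); lra. }
  assert (kp / 2 * Series (fun k => dweight (N + k) * Cnorm2 (f (N + k)%nat)) <= kp / 2 * M)%R
    by (apply Rmult_le_compat_l; lra).
  lra.
Qed.

Lemma dinner_le_pairing (f h : coefs) : InD f -> InD h ->
  (Cmod (dinner f h) <= Series (fun n => dweight n * (Cmod (f n) * Cmod (h n))))%R.
Proof.
  intros Hf Hh; apply Rle_trans with (1 := Cmod_Csum _ (Cabs_dinner f h Hf Hh)).
  right; apply Series_ext; intros n; rewrite !Cmod_mult, Cmod_conj, Cmod_R, Rabs_pos_eq; auto.
  generalize (dweight_ge_1 n); lra.
Qed.

(** Pairing absolute values against e_r bounds f' on the whole disk |z| <= r by one number, which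
    [pairing_small] can make small. *)
Lemma dval_le_pairing (f : coefs) (r : R) (z : C) : InD f -> (r < 1)%R -> (Cmod z <= r)%R ->
  (Cmod (dval f z) <= Series (fun n => dweight n * (Cmod (f n) * Cmod (es r n))))%R.
Proof.
  intros Hf Hr Hz; assert (Hr0 : (0 <= r)%R) by (generalize (Cmod_ge_0 z); lra).
  assert (Er : InD (es r)) by (apply InD_es; rewrite Cmod_R, Rabs_pos_eq; lra).
  destruct (InD_bounded f Hf) as [B HB].
  assert (P := ex_series_abs_pair f (es r) Hf Er).
  assert (A := Cabs_dval f z B HB ltac:(lra)).
  apply Rle_trans with (1 := Cmod_Csum _ A).
  rewrite (Series_incr_1 _ P).
  replace (dweight 0%nat * (Cmod (f 0%nat) * Cmod (es r 0%nat)))%R with 0%R by (cbn [es]; rewrite Cmod_0; ring).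
  rewrite Rplus_0_l.
  apply Series_mono; auto; [|apply (ex_series_incr_1 (fun n => dweight n * (Cmod (f n) * Cmod (es r n)))%R); exact P].
  intros n; unfold es, dweight; rewrite !Cmod_mult, !Cmod_pow, !Cmod_R, (Rabs_pos_eq r), Rabs_pos_eq by (auto; apply pos_INR).
  rewrite Rmult_assoc; apply Rmult_le_compat_l; [apply pos_INR|].
  apply Rmult_le_compat_l; [apply Cmod_ge_0|]; apply pow_incr; split; auto; apply Cmod_ge_0.
Qed.

(** * Extraction of subsequences and a criterion for compactness *)

Definition increasing (s : nat -> nat) : Prop := forall k, (s k < s (S k))%nat.

Lemma increasing_lt (s : nat -> nat) (i j : nat) : increasing s -> (i < j)%nat -> (s i < s j)%nat.
Proof. intros H Hij; induction Hij as [|j Hij IH]; [apply H|]; generalize (H j); lia. Qed.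

Lemma increasing_ge (s : nat -> nat) (k : nat) : increasing s -> (k <= s k)%nat.
Proof. intros H; induction k as [|k IH]; [lia|]; generalize (H k); lia. Qed.

Definition cauchy (v : nat -> R) : Prop :=
  forall e, (0 < e)%R -> exists N, forall i j, (N <= i)%nat -> (N <= j)%nat -> (Rabs (v i - v j) <= e)%R.

Lemma bounded_cauchy_subseq (v : nat -> R) (B : R) : (forall n, Rabs (v n) <= B)%R ->
  exists s, increasing s /\ cauchy (fun k => v (s k)).
Proof.
  intros HB.
  destruct (Bolzano_Weierstrass v (fun c => - B <= c <= B)%R) as [l Hl].
  { apply compact_P3. }
  { intros n; apply Rabs_le_between, HB. }
  assert (P : forall N k : nat, exists p, (N <= p)%nat /\ (Rabs (v p - l) < / (INR k + 1))%R).
  { intros N k; assert (K : (0 < / (INR k + 1))%R) by (apply Rinv_0_lt_compat; generalize (pos_INR k); lra).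
    destruct (Hl (disc l (mkposreal _ K)) N) as [p [Hp1 Hp2]].
    - exists (mkposreal _ K); intros x Hx; exact Hx.
    - exists p; split; auto. }
  pose (pick N k := proj1_sig (constructive_indefinite_description _ (P N k))).
  assert (Hpick : forall N k, (N <= pick N k)%nat /\ (Rabs (v (pick N k) - l) < / (INR k + 1))%R)
    by (intros N k; exact (proj2_sig (constructive_indefinite_description _ (P N k)))).
  pose (s := fix s k := match k with O => pick 0%nat 0%nat | S k' => pick (S (s k')) (S k') end).
  assert (Hs : forall k, (Rabs (v (s k) - l) < / (INR k + 1))%R) by (intros [|k]; apply Hpick).
  exists s; split.
  - intros k; apply (proj1 (Hpick (S (s k)) (S k))).
  - intros e He; destruct (archimed_cor1 (e / 2) ltac:(lra)) as [N [HN1 HN2]].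
    exists N; intros i j Hi Hj.
    assert (A : forall k, (N <= k)%nat -> (Rabs (v (s k) - l) < e / 2)%R).
    { intros k Hk; apply Rlt_trans with (1 := Hs k); apply Rle_lt_trans with (2 := HN1).
      apply Rinv_le_contravar; [apply lt_0_INR; lia|]; apply le_INR in Hk; lra. }
    replace (v (s i) - v (s j))%R with ((v (s i) - l) - (v (s j) - l))%R by ring.
    apply Rle_trans with (1 := Rabs_triang _ _); rewrite Rabs_Ropp.
    generalize (A i Hi) (A j Hj); lra.
Qed.

Lemma diagonal_subseq (y : nat -> nat -> R) (B : R) : (forall k n, Rabs (y k n) <= B)%R ->
  exists s, increasing s /\ forall n, cauchy (fun k => y (s k) n).
Proof.
  intros HB.
  assert (P : forall (s : nat -> nat) (n : nat), exists t, increasing t /\ cauchy (fun k => y (s (t k)) n)).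
  { intros s n; apply (bounded_cauchy_subseq (fun k => y (s k) n) B); auto. }
  pose (t s n := proj1_sig (constructive_indefinite_description _ (P s n))).
  assert (Ht : forall s n, increasing (t s n) /\ cauchy (fun k => y (s (t s n k)) n))
    by (intros s n; exact (proj2_sig (constructive_indefinite_description _ (P s n)))).
  pose (st := fix st n := match n with O => fun k => k | S n' => fun k => st n' (t (st n') n' k) end : nat -> nat).
  assert (Hst : forall n, increasing (st n)).
  { induction n as [|n IH]; intros k; cbn; [lia|].
    apply increasing_lt; auto; apply Ht. }
  exists (fun k => st k k); split.
  - intros k; cbn; apply increasing_lt; auto.
    apply Nat.lt_le_trans with (S k); [lia|]; apply increasing_ge, Ht.
  - intros n.
    (* The later extractions are subsequences of the extraction of level n + 1, and passing to it
       never lowers an index; so a tail of the diagonal inherits its Cauchy property. *)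
    assert (Q : forall k j, exists p, (j <= p)%nat /\ st (k + S n)%nat j = st (S n) p).
    { induction k as [|k IH]; intros j; [exists j; auto|].
      cbn [Nat.add]; destruct (IH (t (st (k + S n)%nat) (k + S n)%nat j)) as [p [Hp1 Hp2]].
      exists p; split; [|exact Hp2].
      apply Nat.le_trans with (2 := Hp1), increasing_ge, Ht. }
    intros e He; destruct (proj2 (Ht (st n) n) e He) as [N HN].
    exists (N + S n)%nat; intros i j Hi Hj.
    destruct (Q (i - S n)%nat i) as [p [Hp1 Hp2]]; destruct (Q (j - S n)%nat j) as [q [Hq1 Hq2]].
    replace (i - S n + S n)%nat with i in Hp2 by lia; replace (j - S n + S n)%nat with j in Hq2 by lia.
    cbn beta; rewrite Hp2, Hq2; apply HN; lia.
Qed.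

Lemma coefs_diagonal (u : nat -> coefs) (B : R) : (forall k n, Cmod (u k n) <= B)%R ->
  exists s, increasing s /\ forall n dl, (0 < dl)%R -> exists N, forall i j, (N <= i)%nat -> (N <= j)%nat ->
    (Cmod (u (s i) n - u (s j) n) <= dl)%R.
Proof.
  intros HB.
  (* Real and imaginary parts are interleaved at even and odd indices, so that one real diagonal
     extraction serves both. *)
  destruct (diagonal_subseq (fun k n => if Nat.even n then Re (u k (Nat.div2 n)) else Im (u k (Nat.div2 n))) B) as [s [Hs1 Hs2]].
  { intros k n; apply Rle_trans with (2 := HB k (Nat.div2 n)); destruct (Nat.even n); [apply re_le_Cmod|apply im_le_Cmod]. }
  exists s; split; auto; intros n dl Hdl.
  destruct (Hs2 (2 * n)%nat (dl / 2)%R ltac:(lra)) as [N1 H1].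
  destruct (Hs2 (S (2 * n)) (dl / 2)%R ltac:(lra)) as [N2 H2].
  exists (N1 + N2)%nat; intros i j Hi Hj.
  specialize (H1 i j ltac:(lia) ltac:(lia)); specialize (H2 i j ltac:(lia) ltac:(lia)); cbn beta in *.
  assert (Ev : Nat.even (2 * n) = true) by (apply Nat.even_spec; exists n; lia).
  rewrite Ev, Nat.div2_double in H1.
  rewrite Nat.even_succ, <- Nat.negb_even, Ev, Nat.div2_succ_double in H2; cbn [negb] in H2.
  set (z := u (s i) n - u (s j) n).
  assert (R1 : Re z = (Re (u (s i) n) - Re (u (s j) n))%R) by reflexivity.
  assert (I1 : Im z = (Im (u (s i) n) - Im (u (s j) n))%R) by reflexivity.
  rewrite <- R1 in H1; rewrite <- I1 in H2.
  assert (Q := Cmod_sqr z); assert (G := Cmod_ge_0 z).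
  apply Rabs_le_between in H1; apply Rabs_le_between in H2.
  apply Rnot_lt_le; intros L; nra.
Qed.

(** A bounded sequence has a subsequence that is Cauchy in every coefficient; the hypothesis, which
    looks at finitely many coefficients only, makes its images Cauchy in norm. *)
Lemma compact_criterion (K : op) : (forall f, InD f -> InD (K f)) ->
  (forall M eps, (0 <= M)%R -> (0 < eps)%R -> exists N dl, (0 < dl)%R /\ forall f g, InD f -> InD g ->
    (Dnorm2 f <= M)%R -> (Dnorm2 g <= M)%R -> (forall n, (n <= N)%nat -> (Cmod (f n - g n) <= dl)%R) ->
    (Dnorm2 (csub (K f) (K g)) < eps)%R) ->
  compact_on_D K.
Proof.
  intros HK H; split; auto; intros u Hu [M HM].
  assert (HuM : forall k, (Dnorm2 (u k) <= M)%R) by (intros k; apply (HM k), InD_dnorm2, Hu).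
  assert (M0 : (0 <= M)%R) by (apply Rle_trans with (2 := HuM 0%nat), Dnorm2_pos, Hu).
  destruct (coefs_diagonal u (M + 1)) as [s [Hs1 Hs2]].
  { intros k n; apply coef_le; auto. }
  exists s; split; auto; intros eps Heps.
  destruct (H M eps M0 ltac:(lra)) as [N [dl [Hdl HH]]].
  assert (J0 : exists J, forall i j, (J <= i)%nat -> (J <= j)%nat -> forall n, (n <= N)%nat -> (Cmod (u (s i) n - u (s j) n) <= dl)%R).
  { clear HH; induction N as [|N [J HJ]].
    - destruct (Hs2 0%nat dl Hdl) as [J HJ]; exists J; intros i j Hi Hj n Hn; replace n with 0%nat by lia; auto.
    - destruct (Hs2 (S N) dl Hdl) as [J' HJ']; exists (J + J')%nat; intros i j Hi Hj n Hn.
      destruct (Nat.eq_dec n (S N)) as [->|]; [apply HJ'; lia|apply HJ; lia]. }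
  destruct J0 as [J HJ]; exists J; intros i j Hi Hj l Hl.
  rewrite (dnorm2_is_unique _ _ Hl); apply HH; auto.
Qed.

(** One-sided: it is applied to nonnegative sequences, for which it means convergence to 0. *)
Definition vanishes (v : nat -> R) : Prop := forall e, (0 < e)%R -> exists J, forall j, (J <= j)%nat -> (v j <= e)%R.

Lemma vanishes_le (v w : nat -> R) (c : R) : (0 <= c)%R -> (forall j, v j <= c * w j)%R -> vanishes w -> vanishes v.
Proof.
  intros Hc H Hw e He; destruct (Hw (e / (c + 1))%R) as [J HJ]; [apply Rdiv_lt_0_compat; lra|].
  exists J; intros j Hj; apply Rle_trans with (1 := H j).
  apply Rle_trans with (c * (e / (c + 1)))%R; [apply Rmult_le_compat_l; auto|].
  apply Rle_trans with ((c + 1) * (e / (c + 1)))%R; [|right; field; lra].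
  apply Rmult_le_compat_r; [left; apply Rdiv_lt_0_compat; lra|lra].
Qed.

Lemma vanishes_plus (v w : nat -> R) : vanishes v -> vanishes w -> vanishes (fun j => v j + w j)%R.
Proof.
  intros Hv Hw e He; destruct (Hv (e / 2)%R ltac:(lra)) as [J1 H1]; destruct (Hw (e / 2)%R ltac:(lra)) as [J2 H2].
  exists (J1 + J2)%nat; intros j Hj; generalize (H1 j ltac:(lia)) (H2 j ltac:(lia)); lra.
Qed.

Lemma vanishes_sum (a : nat -> nat -> R) (m : nat) : (forall n, vanishes (a n)) ->
  vanishes (fun j => Rsumn (fun n => a n j) m).
Proof.
  intros H; induction m as [|m IH]; cbn [Rsumn].
  - intros e He; exists 0%nat; intros; lra.
  - now apply (vanishes_plus (fun j => Rsumn (fun n => a n j) m) (a m)).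
Qed.

Lemma vanishes_sqr (v : nat -> R) : (forall j, 0 <= v j)%R -> vanishes v -> vanishes (fun j => v j * v j)%R.
Proof.
  intros H0 H e He; destruct (H (Rmin 1 e)) as [J HJ]; [apply Rmin_glb_lt; lra|].
  exists J; intros j Hj; specialize (HJ j Hj); specialize (H0 j).
  assert (R1 := Rmin_l 1 e); assert (R2 := Rmin_r 1 e).
  assert (v j * v j <= 1 * v j)%R by (apply Rmult_le_compat_r; lra); lra.
Qed.

Lemma Dnorm2_partial (f : coefs) (m : nat) : InD f ->
  (Rsumn (fun n => INR (S n) * Cnorm2 (f (S n))) m <= Dnorm2 f)%R.
Proof.
  intros Hf; assert (E := proj1 (InD_ex_series f) Hf).
  apply Rle_trans with (Rsumn (fun n => dweight n * Cnorm2 (f n))%R (S m)).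
  - clear; induction m as [|m IH].
    + assert (T := Dterm_pos f 0%nat); cbn [Rsumn]; lra.
    + apply Rplus_le_compat; [exact IH|apply Rle_refl].
  - rewrite Rsumn_sum_n; apply sum_n_le_Series; auto; apply Dterm_pos.
Qed.

(* A compact K maps the weakly null f_k to norm-null images along a subsequence;
   the finite-rank part lam * y may be discarded. *)
Lemma compact_test (K : op) (f x : nat -> coefs) (lam : nat -> C) (y : coefs) (M : R) :
  compact_on_D K -> (forall k, InD (f k)) -> (forall k, Dnorm2 (f k) <= M)%R -> InD y ->
  (forall k n, K (f k) (S n) = x k (S n) + lam k * y (S n)) ->
  vanishes (fun k => Cmod (lam k)) -> (forall n, vanishes (fun k => Cmod (x k (S n)))) ->
  forall eps N, (0 < eps)%R -> exists k, (N <= k)%nat /\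
    forall m, (Rsumn (fun n => INR (S n) * Cnorm2 (x k (S n))) m <= eps)%R.
Proof.
  intros [HK HC] Hf HM Hy Hx Hl Hv eps N He.
  (* The three error terms will enter with factors 2, 4 and 4, so each is made at most eps / 10. *)
  destruct (HC f Hf) as [s [Hs1 Hs2]].
  { exists M; intros k l Hkl; rewrite (dnorm2_is_unique _ _ Hkl); auto. }
  destruct (Hs2 (eps / 10)%R ltac:(lra)) as [N1 HN1].
  assert (Y0 := Dnorm2_pos y Hy).
  assert (VL : vanishes (fun k => Dnorm2 y * (Cmod (lam k) * Cmod (lam k)))%R).
  { apply vanishes_le with (w := fun k => (Cmod (lam k) * Cmod (lam k))%R) (c := Dnorm2 y); auto; [intros; lra|].
    apply vanishes_sqr; auto; intros; apply Cmod_ge_0. }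
  destruct (VL (eps / 10)%R ltac:(lra)) as [N2 HN2].
  set (i := (N + N1 + N2)%nat).
  assert (Hi := increasing_ge s i Hs1).
  exists (s i); split; [lia|]; intros m.
  (* The index [i] is fixed before [m], the index [j] after it: only the first m coefficients of the
     second image have to be small, and these tend to 0 one by one. *)
  assert (VK : vanishes (fun j => Rsumn (fun n => INR (S n) * Cnorm2 (K (f j) (S n))) m)%R).
  { apply (vanishes_sum (fun n j => INR (S n) * Cnorm2 (K (f j) (S n)))%R); intros n.
    apply vanishes_le with (w := fun j => (Cmod (K (f j) (S n)) * Cmod (K (f j) (S n)))%R) (c := INR (S n)); [apply pos_INR| |].
    - intros j; rewrite Cnorm2_Cmod; lra.
    - apply vanishes_sqr; [intros; apply Cmod_ge_0|].
      apply vanishes_le with (w := fun j => (Cmod (x j (S n)) + Cmod (y (S n)) * Cmod (lam j))%R) (c := 1%R); [lra| |].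
      + intros j; rewrite Hx; apply Rle_trans with (1 := Cmod_triangle _ _); rewrite Cmod_mult; lra.
      + apply vanishes_plus; auto.
        apply vanishes_le with (w := fun j => Cmod (lam j)) (c := Cmod (y (S n))); auto; [apply Cmod_ge_0|intros; lra]. }
  destruct (VK (eps / 10)%R ltac:(lra)) as [J HJ].
  set (j := (J + N1)%nat).
  assert (Hj := increasing_ge s j Hs1).
  specialize (HJ (s j) ltac:(lia)); cbn beta in HJ.
  assert (Hc : InD (csub (K (f (s i))) (K (f (s j))))) by (apply InD_csub; auto).
  specialize (HN1 i j ltac:(lia) ltac:(lia) _ (InD_dnorm2 _ Hc)).
  assert (A := Rle_lt_trans _ _ _ (Dnorm2_partial _ m Hc) HN1).
  specialize (HN2 (s i) ltac:(lia)); cbn beta in HN2.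
  assert (By := Dnorm2_partial y m Hy).
  set (l2 := (Cmod (lam (s i)) * Cmod (lam (s i)))%R) in *.
  assert (l20 : (0 <= l2)%R) by (unfold l2; apply Rle_0_sqr).
  assert (Main : (Rsumn (fun n => INR (S n) * Cnorm2 (x (s i) (S n))) m <=
     2 * Rsumn (fun n => INR (S n) * Cnorm2 (csub (K (f (s i))) (K (f (s j))) (S n))) m
     + 4 * Rsumn (fun n => INR (S n) * Cnorm2 (K (f (s j)) (S n))) m
     + 4 * l2 * Rsumn (fun n => INR (S n) * Cnorm2 (y (S n))) m)%R).
  { rewrite <- !Rsumn_scal, <- !Rsumn_plus; apply Rsumn_le; intros n _.
    set (u := csub (K (f (s i))) (K (f (s j))) (S n)); set (v := K (f (s j)) (S n) : C).
    assert (E : x (s i) (S n) = u + (v + - lam (s i) * y (S n))).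
    { unfold u, v, csub; change (Csub ?p ?q) with (p - q : C); rewrite Hx.
      assert (R0 : forall p q r t : C, p = (p + q * r - t) + (t + - q * r)) by (intros; ring).
      apply R0. }
    rewrite E.
    assert (I1 := Cnorm2_plus_le u (v + - lam (s i) * y (S n))).
    assert (I2 := Cnorm2_plus_le v (- lam (s i) * y (S n))).
    rewrite (Cnorm2_Cmod (- lam (s i) * y (S n))), Cmod_mult, Cmod_opp in I2.
    assert (I3 : (Cmod (lam (s i)) * Cmod (y (S n)) * (Cmod (lam (s i)) * Cmod (y (S n))) = l2 * Cnorm2 (y (S n)))%R)
      by (rewrite Cnorm2_Cmod; unfold l2; ring).
    rewrite I3 in I2.
    assert (P := pos_INR (S n)).
    replace (2 * (INR (S n) * Cnorm2 u) + 4 * (INR (S n) * Cnorm2 v) + 4 * l2 * (INR (S n) * Cnorm2 (y (S n))))%R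
      with (INR (S n) * (2 * Cnorm2 u + 4 * Cnorm2 v + 4 * (l2 * Cnorm2 (y (S n)))))%R by ring.
    apply Rmult_le_compat_l; auto; lra. }
  assert (l2 * Rsumn (fun n => INR (S n) * Cnorm2 (y (S n))) m <= l2 * Dnorm2 y)%R by (apply Rmult_le_compat_l; auto).
  lra.
Qed.

(** * Compactness of the two products and of the commutator *)

Lemma csub_lin (f g : coefs) (n : nat) : csub f g n = 1 * f n + (-(1)) * g n.
Proof. change (f n - g n = 1 * f n + - (1) * g n :> C). ring. Qed.

Lemma fval_csub (f g : coefs) (z : C) : InD f -> InD g -> (Cmod z < 1)%R ->
  fval (csub f g) z = fval f z - fval g z.
Proof.
  intros Hf Hg Hz; transitivity (1 * fval f z + (-(1)) * fval g z); [|ring].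
  rewrite <- fval_lin by auto using InD_bounded.
  apply Csum_ext; intros n; now rewrite csub_lin.
Qed.

Lemma dval_csub (f g : coefs) (z : C) : InD f -> InD g -> (Cmod z < 1)%R ->
  dval (csub f g) z = dval f z - dval g z.
Proof.
  intros Hf Hg Hz; transitivity (1 * dval f z + (-(1)) * dval g z); [|ring].
  rewrite <- dval_lin by auto using InD_bounded.
  apply Csum_ext; intros n; now rewrite csub_lin.
Qed.

Lemma dinner_csub_l (f g h : coefs) : InD f -> InD g -> InD h ->
  dinner (csub f g) h = dinner f h - dinner g h.
Proof.
  intros Hf Hg Hh; unfold dinner; rewrite <- Csum_minus by now apply Cabs_dinner.
  apply Csum_ext; intros n; rewrite csub_lin; ring.
Qed.

(** Since n |c_n|^2 <= (n |c_n|)^2, the Dirichlet seminorm is at most the Hardy norm of the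
    derivative, which Parseval bounds by the supremum. *)
Lemma Dnorm2_le_sup (f : coefs) (s : R) : InD f ->
  (forall z, (Cmod z < 1)%R -> (Cmod (dval f z) <= s)%R) ->
  (Dnorm2 f <= Cmod (f 0%nat) * Cmod (f 0%nat) + s * s)%R.
Proof.
  intros Hf Hs; assert (E := proj1 (InD_ex_series f) Hf).
  destruct (InD_bounded f Hf) as [B HB].
  unfold Dnorm2; rewrite (Series_incr_1 _ E).
  apply Rplus_le_compat.
  - cbn [dweight]; rewrite Cnorm2_Cmod; lra.
  - apply (ex_series_bounded (fun n => dweight (S n) * Cnorm2 (f (S n)))%R); [intros; apply Dterm_pos|].
    intros m; rewrite <- Rsumn_sum_n.
    assert (G : forall k, (Cmod (INR (S k) * f (S k)) <= B * INR (S k))%R).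
    { intros k; rewrite Cmod_mult, Cmod_R, Rabs_pos_eq, Rmult_comm by apply pos_INR.
      apply Rmult_le_compat_r; auto; apply pos_INR. }
    apply Rle_trans with (2 := parseval_le (fun n => INR (S n) * f (S n)) B s (S m) G Hs).
    apply Rsumn_le; intros k _; rewrite !Cnorm2_Cmod, Cmod_mult, Cmod_R, Rabs_pos_eq by apply pos_INR.
    change (dweight (S k)) with (INR (S k)).
    assert (K : (1 <= INR (S k))%R) by (rewrite S_INR; generalize (pos_INR k); lra).
    generalize (Cmod_ge_0 (f (S k))); generalize (Cmod (f (S k))); intros x Hx.
    replace (INR (S k) * x * (INR (S k) * x))%R with (INR (S k) * (INR (S k) * (x * x)))%R by ring.
    apply Rmult_le_compat_l; [lra|]; nra.
Qed.

Definition pairing (f h : coefs) : R := Series (fun n => dweight n * (Cmod (f n) * Cmod (h n)))%R.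

Lemma pairing_pos (f h : coefs) : InD f -> InD h -> (0 <= pairing f h)%R.
Proof.
  intros Hf Hh; apply Series_pos; [|now apply ex_series_abs_pair].
  intros n; repeat apply Rmult_le_pos; try apply Cmod_ge_0; generalize (dweight_ge_1 n); lra.
Qed.

(* K factors, up to norm, through three scalar pairings, which are continuous for
   coefficientwise convergence of bounded sequences. *)
Lemma compact_of_pairings (K : op) (h1 h2 h3 : coefs) (c : R) :
  (forall f, InD f -> InD (K f)) -> InD h1 -> InD h2 -> InD h3 -> (0 <= c)%R ->
  (forall f g, InD f -> InD g -> (Cmod (K f 0%nat - K g 0%nat)
     <= c * (pairing (csub f g) h1 + pairing (csub f g) h2 + pairing (csub f g) h3))%R) ->
  (forall f g z, InD f -> InD g -> (Cmod z < 1)%R -> (Cmod (dval (K f) z - dval (K g) z)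
     <= c * (pairing (csub f g) h1 + pairing (csub f g) h2 + pairing (csub f g) h3))%R) ->
  compact_on_D K.
Proof.
  intros HK H1 H2 H3 Hc HK0 HKd; apply compact_criterion; auto; intros M eps HM He.
  (* As e <= 1, each of the two squares in the norm bound is at most 9 (c + 1)^2 e; the excess of 20
     over 18 makes the inequality strict. *)
  assert (Q : (0 < 20 * (c + 1) * (c + 1))%R) by nra.
  destruct (small_pos 1 (20 * (c + 1) * (c + 1)) eps) as [e [e0 [e1 e2]]]; try lra.
  destruct (pairing_small h1 (4 * M) e H1 ltac:(lra) e0) as [N1 [d1 [D1 P1]]].
  destruct (pairing_small h2 (4 * M) e H2 ltac:(lra) e0) as [N2 [d2 [D2 P2]]].
  destruct (pairing_small h3 (4 * M) e H3 ltac:(lra) e0) as [N3 [d3 [D3 P3]]].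
  exists (N1 + N2 + N3)%nat, (Rmin d1 (Rmin d2 d3)); split; [now repeat apply Rmin_glb_lt|].
  intros f g Hf Hg Mf Mg Hfg.
  assert (Hs := InD_csub f g Hf Hg).
  assert (Ms : (Dnorm2 (csub f g) <= 4 * M)%R) by (apply Rle_trans with (1 := Dnorm2_csub_le f g Hf Hg); lra).
  assert (X1 : (pairing (csub f g) h1 <= e)%R).
  { apply P1; auto; intros n Hn; apply Rle_trans with (1 := Hfg n ltac:(lia)), Rmin_l. }
  assert (X2 : (pairing (csub f g) h2 <= e)%R).
  { apply P2; auto; intros n Hn; apply Rle_trans with (1 := Hfg n ltac:(lia)).
    apply Rle_trans with (1 := Rmin_r _ _), Rmin_l. }
  assert (X3 : (pairing (csub f g) h3 <= e)%R).
  { apply P3; auto; intros n Hn; apply Rle_trans with (1 := Hfg n ltac:(lia)).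
    apply Rle_trans with (1 := Rmin_r _ _), Rmin_r. }
  specialize (HK0 f g Hf Hg).
  set (E := (pairing (csub f g) h1 + pairing (csub f g) h2 + pairing (csub f g) h3)%R) in *.
  assert (E0 : (0 <= E)%R) by (unfold E; generalize (pairing_pos _ _ Hs H1) (pairing_pos _ _ Hs H2) (pairing_pos _ _ Hs H3); lra).
  assert (E3 : (E <= 3 * e)%R) by (unfold E; lra).
  apply Rle_lt_trans with (1 := Dnorm2_le_sup _ (c * E)%R (InD_csub _ _ (HK f Hf) (HK g Hg))
     ltac:(intros z Hz; rewrite dval_csub by auto; now apply HKd)).
  change (csub (K f) (K g) 0%nat) with (K f 0%nat - K g 0%nat).
  assert (B0 : (0 <= c * E)%R) by now apply Rmult_le_pos.
  assert (B1 : (c * E <= (c + 1) * (3 * e))%R) by (apply Rmult_le_compat; lra).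
  assert (B2 : (c * E * (c * E) <= (c + 1) * (3 * e) * ((c + 1) * (3 * e)))%R) by (apply Rmult_le_compat; lra).
  assert (B3 : (Cmod (K f 0%nat - K g 0%nat) * Cmod (K f 0%nat - K g 0%nat) <= c * E * (c * E))%R)
    by (apply Rmult_le_compat; auto; apply Cmod_ge_0).
  assert (B4 : ((c + 1) * (3 * e) * ((c + 1) * (3 * e)) <= 9 * (c + 1) * (c + 1) * e)%R).
  { replace ((c + 1) * (3 * e) * ((c + 1) * (3 * e)))%R with (9 * (c + 1) * (c + 1) * (e * e))%R by ring.
    apply Rmult_le_compat_l; nra. }
  assert (0 < (c + 1) * (c + 1) * e)%R by (repeat apply Rmult_lt_0_compat; lra).
  lra.
Qed.

(** Otherwise the pole -d / c lies in the closed disk; there [selfmap_closed] forces the numerator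
    to vanish too, against det <> 0. *)
Lemma selfmap_md_gt_mc (M : mat) : selfmap M -> (Cmod (mc M) < Cmod (md M))%R.
Proof.
  intros HM; apply Rnot_le_lt; intros Hle.
  assert (Z := Cmod_0_lt_1).
  assert (D0 := selfmap_mden M 0 HM Z); unfold mden in D0; rewrite Cmult_0_r, Cplus_0_l in D0.
  assert (c0 : mc M <> 0) by (apply Cmod_gt_0; generalize (proj1 (Cmod_gt_0 _) D0); lra).
  set (z := - md M / mc M).
  assert (Hz : (Cmod z <= 1)%R).
  { unfold z; rewrite Cmod_div, Cmod_opp by auto; apply Rmult_le_reg_r with (Cmod (mc M)); [now apply Cmod_gt_0|].
    unfold Rdiv; rewrite Rmult_assoc, Rinv_l, Rmult_1_r; [lra|]; generalize (proj1 (Cmod_gt_0 _) c0); lra. }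
  assert (E : mden M z = 0) by (unfold mden, z; field; auto).
  assert (C := selfmap_closed M z HM Hz); rewrite E, Cmod_0 in C.
  assert (E' : mnum M z = 0) by (apply Cmod_eq_0; generalize (Cmod_ge_0 (mnum M z)); lra).
  apply (proj1 HM); replace (mdet M) with (ma M * mden M z - mc M * mnum M z) by (unfold mdet, mden, mnum; ring).
  rewrite E, E'; ring.
Qed.

Lemma mden_lower (M : mat) (z : C) : (Cmod z <= 1)%R -> (Cmod (md M) - Cmod (mc M) <= Cmod (mden M z))%R.
Proof.
  intros Hz; assert (T := Cmod_triangle (mden M z) (- (mc M * z))).
  replace (mden M z + - (mc M * z)) with (md M) in T by (unfold mden; ring).
  rewrite Cmod_opp, Cmod_mult in T; generalize (Cmod_ge_0 (mc M)) (Cmod_ge_0 z); intros; nra.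
Qed.

Lemma selfmap_mden_closed (M : mat) (z : C) : selfmap M -> (Cmod z <= 1)%R -> mden M z <> 0.
Proof.
  intros HM Hz; apply Cmod_gt_0; generalize (mden_lower M z Hz) (selfmap_md_gt_mc M HM); lra.
Qed.

Lemma mder_bounded (M : mat) : selfmap M -> exists B, (0 <= B)%R /\ forall z, (Cmod z < 1)%R -> (Cmod (mder M z) <= B)%R.
Proof.
  intros HM; set (m := (Cmod (md M) - Cmod (mc M))%R).
  assert (m0 : (0 < m)%R) by (unfold m; generalize (selfmap_md_gt_mc M HM); lra).
  exists (Cmod (mdet M) * / (m * m))%R; split.
  - apply Rmult_le_pos; [apply Cmod_ge_0|left; apply Rinv_0_lt_compat; nra].
  - intros z Hz; assert (D := selfmap_mden M z HM Hz).
    unfold mder; rewrite Cmod_div, Cmod_mult by now apply Cmult_neq_0.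
    apply Rmult_le_compat_l; [apply Cmod_ge_0|].
    assert (L := mden_lower M z ltac:(lra)); fold m in L.
    apply Rinv_le_contravar; nra.
Qed.

Lemma dval_kern_bounded (v : C) : (Cmod v < 1)%R -> exists B, (0 <= B)%R /\ forall z, (Cmod z < 1)%R -> (Cmod (dval (kern v) z) <= B)%R.
Proof.
  intros Hv; exists (/ (1 - Cmod v))%R; split; [left; apply Rinv_0_lt_compat; lra|].
  intros z Hz; rewrite dval_kern by auto.
  assert (L : (Cmod (Cconj v * z) < 1)%R) by (apply Cmod_mult_lt_1; auto; now rewrite Cmod_conj).
  assert (N := one_minus_neq_0 _ L).
  assert (Lw : (1 - Cmod v <= Cmod (1 - Cconj v * z))%R).
  { assert (T := Cmod_triangle (1 - Cconj v * z) (Cconj v * z)).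
    replace (1 - Cconj v * z + Cconj v * z) with (RtoC 1) in T by ring.
    rewrite Cmod_1, Cmod_mult, Cmod_conj in T; generalize (Cmod_ge_0 v) (Cmod_ge_0 z); intros; nra. }
  rewrite Cmod_div, Cmod_conj by auto.
  unfold Rdiv; rewrite <- (Rmult_1_l (/ (1 - Cmod v))).
  apply Rmult_le_compat; [apply Cmod_ge_0|left; apply Rinv_0_lt_compat; lra|lra|apply Rinv_le_contravar; lra].
Qed.

Definition touches (M : mat) : Prop := exists zeta, Cmod zeta = 1%R /\ Cmod (mnum M zeta) = Cmod (mden M zeta).

(** Hermitian form measuring how far M z stays inside the circle. By [mgap_expand] it depends, for
    fixed |z|, on z only through Re (q z). *)
Definition mgap (M : mat) (z : C) : R := (Cnorm2 (mden M z) - Cnorm2 (mnum M z))%R.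

Lemma mgap_expand (M : mat) (z : C) : mgap M z =
  ((Cnorm2 (mc M) - Cnorm2 (ma M)) * Cnorm2 z + (Cnorm2 (md M) - Cnorm2 (mb M))
   + 2 * Re ((mc M * Cconj (md M) - ma M * Cconj (mb M)) * z))%R.
Proof. unfold mgap, mden, mnum, Cnorm2, Re; cbn; ring. Qed.

Lemma mgap_pos (M : mat) (z : C) : (Cmod (mnum M z) < Cmod (mden M z))%R <-> (0 < mgap M z)%R.
Proof.
  unfold mgap; rewrite !Cnorm2_Cmod; generalize (Cmod_ge_0 (mnum M z)) (Cmod_ge_0 (mden M z)); split; intros; nra.
Qed.

Lemma Cnorm2_pos (z : C) : (0 <= Cnorm2 z)%R.
Proof. rewrite Cnorm2_Cmod; apply Rle_0_sqr. Qed.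

Lemma Cnorm2_gt_0 (z : C) : z <> 0 -> (0 < Cnorm2 z)%R.
Proof. intros H; apply Cmod_gt_0 in H; rewrite Cnorm2_Cmod; nra. Qed.

Lemma Re_ge_Cmod (z : C) : (- Cmod z <= Re z)%R.
Proof. generalize (re_le_Cmod z); intros H; apply Rabs_le_between in H; lra. Qed.

Lemma circle_minimizer (q : C) : exists m, Cmod m = 1%R /\ q * m = RtoC (- Cmod q).
Proof.
  destruct (Ceq_dec q 0) as [->|E].
  - exists 1; rewrite Cmod_0, Ropp_0; split; [apply Cmod_1|ring].
  - assert (P := proj1 (Cmod_gt_0 _) E).
    exists (- (RtoC (/ Cmod q) * Cconj q)); split.
    + rewrite Cmod_opp, Cmod_mult, Cmod_conj, Cmod_R, Rabs_pos_eq; [field; lra|].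
      left; now apply Rinv_0_lt_compat.
    + transitivity (- (RtoC (/ Cmod q) * (q * Cconj q))); [ring|].
      rewrite <- Cmod2_conj, <- RtoC_mult, <- RtoC_opp; f_equal; field; lra.
Qed.

(* On |z| = rho the form mgap is at least A rho^2 - 2|q| rho + B, and A <= |q| because
   otherwise the vertex rho = |q|/A < 1 would give the value -|det|^2/A < 0. *)
Lemma not_touches_bound (M : mat) : selfmap M -> ~ touches M ->
  exists r, (0 <= r < 1)%R /\ forall z, (Cmod z < 1)%R -> (Cmod (mapp M z) <= r)%R.
Proof.
  intros HM HT.
  set (A := (Cnorm2 (mc M) - Cnorm2 (ma M))%R); set (B := (Cnorm2 (md M) - Cnorm2 (mb M))%R).
  set (q := mc M * Cconj (md M) - ma M * Cconj (mb M)).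
  assert (HQ : forall z, mgap M z = (A * Cnorm2 z + B + 2 * Re (q * z))%R) by (intros; apply mgap_expand).
  (* The Hermitian matrix of [mgap] has determinant A B - |q|^2 = -|det|^2. *)
  assert (HD : (Cnorm2 q - A * B = Cnorm2 (mdet M))%R) by (unfold q, A, B, mdet, Cnorm2; cbn; ring).
  assert (Dp := Cnorm2_gt_0 _ (proj1 HM)).
  assert (q0 := Cmod_ge_0 q).
  assert (HA : (A <= Cmod q)%R).
  { apply Rnot_lt_le; intros L.
    assert (Ap : (0 < A)%R) by lra.
    set (z := - (RtoC (/ A) * Cconj q)).
    assert (Cz : Cmod z = (Cmod q / A)%R).
    { unfold z; rewrite Cmod_opp, Cmod_mult, Cmod_conj, Cmod_R, Rabs_pos_eq; [unfold Rdiv; ring|].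
      left; now apply Rinv_0_lt_compat. }
    assert (Hz : (Cmod z < 1)%R).
    { rewrite Cz; apply Rmult_lt_reg_r with A; auto; unfold Rdiv; rewrite Rmult_assoc, Rinv_l; lra. }
    assert (P := proj1 (mgap_pos M z) (proj2 HM z Hz)); rewrite HQ in P.
    assert (Rq : Re (q * z) = (- (Cnorm2 q / A))%R) by (unfold z, Cnorm2, Re, Rdiv; cbn; ring).
    rewrite Rq, (Cnorm2_Cmod z), Cz, (Cnorm2_Cmod q) in P.
    rewrite (Cnorm2_Cmod q) in HD.
    assert (P' : (0 < A * (A * (Cmod q / A * (Cmod q / A)) + B + 2 * - (Cmod q * Cmod q / A)))%R) by now apply Rmult_lt_0_compat.
    replace (A * (A * (Cmod q / A * (Cmod q / A)) + B + 2 * - (Cmod q * Cmod q / A)))%R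
      with (A * B - Cmod q * Cmod q)%R in P' by (field; lra).
    lra. }
  assert (Hm : (0 < A + B - 2 * Cmod q)%R).
  { destruct (circle_minimizer q) as [z [Hz1 Hz2]].
    assert (L : (Cmod (mnum M z) < Cmod (mden M z))%R).
    { destruct (Rle_lt_or_eq_dec _ _ (selfmap_closed M z HM ltac:(lra))); auto.
      exfalso; apply HT; exists z; auto. }
    apply mgap_pos in L; rewrite HQ, Hz2, Cnorm2_Cmod, Hz1 in L; unfold Re, RtoC in L; cbn [fst] in L; lra. }
  set (m := (A + B - 2 * Cmod q)%R) in *.
  assert (Hgap : forall z, (Cmod z < 1)%R -> (m <= mgap M z)%R).
  { intros z Hz; rewrite HQ, Cnorm2_Cmod.
    assert (R1 := Re_ge_Cmod (q * z)); rewrite Cmod_mult in R1.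
    assert (z0 := Cmod_ge_0 z); set (x := Cmod z) in *; set (p := Cmod q) in *.
    assert (0 <= (1 - x) * (2 * p - A * (1 + x)))%R.
    { apply Rmult_le_pos; [lra|]; destruct (Rle_or_lt A 0); nra. }
    unfold m; lra. }
  set (L := (Cmod (mc M) + Cmod (md M))%R).
  assert (Lp : (0 < L)%R) by (unfold L; generalize (selfmap_md_gt_mc M HM) (Cmod_ge_0 (mc M)); lra).
  assert (HL : forall z, (Cmod z < 1)%R -> (Cmod (mden M z) <= L)%R).
  { intros z Hz; apply Rle_trans with (1 := Cmod_triangle _ _); rewrite Cmod_mult; unfold L.
    generalize (Cmod_ge_0 (mc M)); nra. }
  set (k := (m / (L * L))%R).
  assert (k0 : (0 < k)%R) by (apply Rdiv_lt_0_compat; nra).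
  assert (Hk : forall z, (Cmod z < 1)%R -> (Cmod (mapp M z) * Cmod (mapp M z) <= 1 - k)%R).
  { intros z Hz; assert (D := proj1 (Cmod_gt_0 _) (selfmap_mden M z HM Hz)).
    assert (G := Hgap z Hz); unfold mgap in G; rewrite !Cnorm2_Cmod in G; specialize (HL z Hz).
    unfold mapp; rewrite Cmod_div by now apply selfmap_mden.
    set (y := Cmod (mden M z)) in *; set (x := Cmod (mnum M z)) in *.
    apply Rmult_le_reg_r with (y * y)%R; [nra|].
    replace (x / y * (x / y) * (y * y))%R with (x * x)%R by (field; lra).
    assert (k * (y * y) <= m)%R.
    { apply Rle_trans with (k * (L * L))%R; [apply Rmult_le_compat_l; nra|unfold k; right; field; lra]. }
    lra. }
  (* No square root needed: x^2 <= 1 - k and 2 x <= 1 + x^2 give x <= 1 - k / 2. *)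
  exists (1 - k / 2)%R; split.
  - assert (Z : (Cmod 0 < 1)%R) by (rewrite Cmod_0; lra).
    specialize (Hk 0 Z); generalize (Rle_0_sqr (Cmod (mapp M 0))); unfold Rsqr; lra.
  - intros z Hz; specialize (Hk z Hz); generalize (Rle_0_sqr (Cmod (mapp M z) - 1)); unfold Rsqr; lra.
Qed.

Lemma fval_le_pairing (f : coefs) (v : C) : InD f -> (Cmod v < 1)%R -> (Cmod (fval f v) <= pairing f (kern v))%R.
Proof.
  intros Hf Hv; rewrite <- dinner_kern_r by auto; apply dinner_le_pairing; auto using InD_kern.
Qed.

(** [P] and [Q] are matrices of phi and psi, and [S] is the adjoint of C_psi; the pair of symbols to
    compare is [P] and [krein Q]. *)
Definition adjoint_setup (P Q : mat) (Tp Tq S : op) : Prop :=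
  selfmap P /\ selfmap Q /\ is_comp_op (mapp P) Tp /\ is_comp_op (mapp Q) Tq /\ is_adjoint Tq S.

Lemma ST_InD (P Q : mat) (Tp Tq S : op) (f : coefs) : adjoint_setup P Q Tp Tq S -> InD f -> InD (S (Tp f)).
Proof. intros [HP [HQ [HTp [HTq HS]]]] Hf; apply (HS (Tp f)), (comp_InD _ _ _ HTp Hf). Qed.

Lemma TS_InD (P Q : mat) (Tp Tq S : op) (f : coefs) : adjoint_setup P Q Tp Tq S -> InD f -> InD (Tp (S f)).
Proof. intros [HP [HQ [HTp [HTq HS]]]] Hf; apply (comp_InD _ _ _ HTp), (HS f Hf). Qed.

Lemma ST_0 (P Q : mat) (Tp Tq S : op) (f : coefs) : adjoint_setup P Q Tp Tq S -> InD f ->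
  S (Tp f) 0%nat = fval f (mapp P 0).
Proof.
  intros [HP [HQ [HTp [HTq HS]]]] Hf.
  rewrite (adjoint_0 Q Tq S (Tp f)) by (auto; exact (comp_InD _ _ _ HTp Hf)).
  now apply comp_0.
Qed.

Lemma ST_dval (P Q : mat) (Tp Tq S : op) (f : coefs) (z : C) : adjoint_setup P Q Tp Tq S -> InD f -> (Cmod z < 1)%R ->
  dval (S (Tp f)) z = fval f (mapp P 0) * dval (kern (mapp Q 0)) z
    + dval f (mapp (mmul P (krein Q)) z) * mder (mmul P (krein Q)) z.
Proof.
  intros [HP [HQ [HTp [HTq HS]]]] Hf Hz.
  assert (HX := selfmap_krein Q HQ); assert (HXz := selfmap_mapp _ z HX Hz).
  rewrite (adjoint_dval Q Tq S (Tp f)) by (auto; exact (comp_InD _ _ _ HTp Hf)).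
  rewrite (comp_0 P) by auto; rewrite (comp_dval P) by auto.
  rewrite mapp_mmul, mder_mmul by auto using selfmap_mden; ring.
Qed.

(** The formulas for the adjoint determine its derivative, so its value at phi(0) is obtained by
    pairing with the kernel there and moving the adjoint across. *)
Lemma TS_0 (P Q : mat) (Tp Tq S : op) (f : coefs) : adjoint_setup P Q Tp Tq S -> InD f ->
  Tp (S f) 0%nat = dinner f (Tq (kern (mapp P 0))).
Proof.
  intros [HP [HQ [HTp [HTq HS]]]] Hf; assert (HSf := proj1 (HS f Hf)).
  assert (Hp : (Cmod (mapp P 0) < 1)%R) by (apply selfmap_mapp; auto using Cmod_0_lt_1).
  rewrite (comp_0 P) by auto; rewrite <- dinner_kern_r by auto.
  apply (adjoint_conj Q); auto using InD_kern.
Qed.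

Lemma TS_dval (P Q : mat) (Tp Tq S : op) (f : coefs) (z : C) : adjoint_setup P Q Tp Tq S -> InD f -> (Cmod z < 1)%R ->
  dval (Tp (S f)) z = f 0%nat * (dval (kern (mapp Q 0)) (mapp P z) * mder P z)
    + dval f (mapp (mmul (krein Q) P) z) * mder (mmul (krein Q) P) z.
Proof.
  intros [HP [HQ [HTp [HTq HS]]]] Hf Hz.
  assert (HX := selfmap_krein Q HQ); assert (HPz := selfmap_mapp _ z HP Hz).
  rewrite (comp_dval P) by (auto; apply (HS f Hf)).
  rewrite (adjoint_dval Q Tq S f) by auto.
  rewrite mapp_mmul, mder_mmul by auto using selfmap_mden; ring.
Qed.

(** The symbol stays in a disk |z| <= r with r < 1, so the derivative of the image is controlled by
    the pairing with e_r, and the rank-one term by the pairing with the kernel at phi(0). *)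
Lemma ST_compact (P Q : mat) (Tp Tq S : op) : adjoint_setup P Q Tp Tq S -> ~ touches (mmul P (krein Q)) ->
  compact_on_D (compose_op S Tp).
Proof.
  intros HS HT; assert (HS' := HS); destruct HS' as [HP [HQ [HTp [HTq _]]]].
  assert (HX := selfmap_krein Q HQ); assert (HM := selfmap_mmul _ _ HP HX).
  assert (Z := Cmod_0_lt_1).
  assert (Hp := selfmap_mapp P 0 HP Z); assert (Hq := selfmap_mapp Q 0 HQ Z).
  destruct (not_touches_bound _ HM HT) as [r [Hr Hbd]].
  destruct (mder_bounded _ HM) as [B1 [B10 HB1]].
  destruct (dval_kern_bounded _ Hq) as [B2 [B20 HB2]].
  assert (Er : InD (es r)) by (apply InD_es; rewrite Cmod_R, Rabs_pos_eq; lra).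
  apply compact_of_pairings with (kern (mapp P 0)) (es r) cst1 (1 + B1 + B2)%R; auto using InD_kern, InD_cst1.
  - intros f Hf; now apply (ST_InD P Q Tp Tq).
  - lra.
  - intros f g Hf Hg; unfold compose_op; assert (Hs := InD_csub f g Hf Hg).
    rewrite !(ST_0 P Q Tp Tq) by auto.
    rewrite <- fval_csub by auto.
    assert (I := fval_le_pairing (csub f g) (mapp P 0) Hs Hp).
    assert (J1 := pairing_pos _ _ Hs (InD_kern _ Hp)); assert (J2 := pairing_pos _ _ Hs Er); assert (J3 := pairing_pos _ _ Hs InD_cst1).
    set (j1 := pairing (csub f g) (kern (mapp P 0))) in *; nra.
  - intros f g z Hf Hg Hz; unfold compose_op; assert (Hs := InD_csub f g Hf Hg).
    rewrite !(ST_dval P Q Tp Tq) by auto.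
    set (t := mapp (mmul P (krein Q)) z).
    replace (fval f (mapp P 0) * dval (kern (mapp Q 0)) z + dval f t * mder (mmul P (krein Q)) z
       - (fval g (mapp P 0) * dval (kern (mapp Q 0)) z + dval g t * mder (mmul P (krein Q)) z))
      with (fval (csub f g) (mapp P 0) * dval (kern (mapp Q 0)) z + dval (csub f g) t * mder (mmul P (krein Q)) z)
      by (rewrite fval_csub, dval_csub by (auto; now apply selfmap_mapp); ring).
    apply Rle_trans with (1 := Cmod_triangle _ _); rewrite !Cmod_mult.
    assert (I := fval_le_pairing (csub f g) (mapp P 0) Hs Hp).
    assert (I' := dval_le_pairing (csub f g) r t Hs (proj2 Hr) (Hbd z Hz)).
    fold (pairing (csub f g) (es r)) in I'.
    assert (J1 := pairing_pos _ _ Hs (InD_kern _ Hp)); assert (J2 := pairing_pos _ _ Hs Er); assert (J3 := pairing_pos _ _ Hs InD_cst1).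
    assert (K1 := Rmult_le_compat _ _ _ _ (Cmod_ge_0 _) (Cmod_ge_0 _) I (HB2 z Hz)).
    assert (K2 := Rmult_le_compat _ _ _ _ (Cmod_ge_0 _) (Cmod_ge_0 _) I' (HB1 z Hz)).
    set (j1 := pairing (csub f g) (kern (mapp P 0))) in *; set (j2 := pairing (csub f g) (es r)) in *.
    set (j3 := pairing (csub f g) cst1) in *.
    assert (0 <= B1 * j1 /\ 0 <= B2 * j2 /\ 0 <= (1 + B1 + B2) * j3)%R by (repeat split; apply Rmult_le_pos; lra).
    lra.
Qed.

Lemma commutator_0 (P Q : mat) (Tp Tq S : op) (f : coefs) : adjoint_setup P Q Tp Tq S -> InD f ->
  commutator S Tp f 0%nat = fval f (mapp P 0) - dinner f (Tq (kern (mapp P 0))).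
Proof.
  intros HS Hf; unfold commutator, csub; change (Csub ?p ?q) with (p - q : C).
  now rewrite (ST_0 P Q Tp Tq), (TS_0 P Q Tp Tq).
Qed.

Lemma commutator_InD (P Q : mat) (Tp Tq S : op) (f : coefs) : adjoint_setup P Q Tp Tq S -> InD f -> InD (commutator S Tp f).
Proof. intros HS Hf; apply InD_csub; [now apply (ST_InD P Q Tp Tq)|now apply (TS_InD P Q Tp Tq)]. Qed.

Lemma commutator_dval (P Q : mat) (Tp Tq S : op) (f : coefs) (z : C) : adjoint_setup P Q Tp Tq S -> InD f -> (Cmod z < 1)%R ->
  mmul P (krein Q) = mmul (krein Q) P ->
  dval (commutator S Tp f) z = fval f (mapp P 0) * dval (kern (mapp Q 0)) z
    - f 0%nat * (dval (kern (mapp Q 0)) (mapp P z) * mder P z).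
Proof.
  intros HS Hf Hz E; unfold commutator.
  rewrite dval_csub; [|exact (ST_InD P Q Tp Tq S f HS Hf)|exact (TS_InD P Q Tp Tq S f HS Hf)|auto].
  rewrite (ST_dval P Q Tp Tq), (TS_dval P Q Tp Tq), E by auto; ring.
Qed.

(** With equal symbols the composition parts cancel. What remains depends on f only through
    f(phi(0)), f(0) and the pairing with C_psi of the kernel at phi(0). *)
Lemma commutator_compact (P Q : mat) (Tp Tq S : op) : adjoint_setup P Q Tp Tq S ->
  mmul P (krein Q) = mmul (krein Q) P -> compact_on_D (commutator S Tp).
Proof.
  intros HS HE; assert (HS' := HS); destruct HS' as [HP [HQ [HTp [HTq _]]]].
  assert (Z := Cmod_0_lt_1).
  assert (Hp := selfmap_mapp P 0 HP Z); assert (Hq := selfmap_mapp Q 0 HQ Z).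
  destruct (mder_bounded _ HP) as [B1 [B10 HB1]].
  destruct (dval_kern_bounded _ Hq) as [B2 [B20 HB2]].
  assert (HKp := InD_kern _ Hp); assert (HTK := comp_InD _ _ _ HTq HKp).
  set (h2 := Tq (kern (mapp P 0))) in *.
  apply compact_of_pairings with (kern (mapp P 0)) h2 cst1 (1 + B2 + B2 * B1)%R; auto using InD_cst1.
  - intros f Hf; now apply (commutator_InD P Q Tp Tq).
  - generalize (Rmult_le_pos _ _ B20 B10); lra.
  - intros f g Hf Hg; assert (Hs := InD_csub f g Hf Hg).
    rewrite !(commutator_0 P Q Tp Tq) by auto; fold h2.
    replace (fval f (mapp P 0) - dinner f h2 - (fval g (mapp P 0) - dinner g h2))
      with (fval (csub f g) (mapp P 0) + - dinner (csub f g) h2)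
      by (rewrite fval_csub, dinner_csub_l by auto; ring).
    apply Rle_trans with (1 := Cmod_triangle _ _); rewrite Cmod_opp.
    assert (I := fval_le_pairing (csub f g) (mapp P 0) Hs Hp).
    assert (I' := dinner_le_pairing (csub f g) h2 Hs HTK); fold (pairing (csub f g) h2) in I'.
    assert (J1 := pairing_pos _ _ Hs HKp); assert (J2 := pairing_pos _ _ Hs HTK); assert (J3 := pairing_pos _ _ Hs InD_cst1).
    set (j1 := pairing (csub f g) (kern (mapp P 0))) in *; set (j2 := pairing (csub f g) h2) in *.
    set (j3 := pairing (csub f g) cst1) in *.
    assert (0 <= (B2 + B2 * B1) * (j1 + j2 + j3))%R by (apply Rmult_le_pos; [generalize (Rmult_le_pos _ _ B20 B10)|]; lra).
    lra.
  - intros f g z Hf Hg Hz; assert (Hs := InD_csub f g Hf Hg).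
    rewrite !(commutator_dval P Q Tp Tq) by auto.
    set (k1 := dval (kern (mapp Q 0)) z); set (k2 := dval (kern (mapp Q 0)) (mapp P z) * mder P z).
    replace (fval f (mapp P 0) * k1 - f 0%nat * k2 - (fval g (mapp P 0) * k1 - g 0%nat * k2))
      with (fval (csub f g) (mapp P 0) * k1 + - (csub f g 0%nat * k2))
      by (rewrite fval_csub, csub_lin by auto; ring).
    apply Rle_trans with (1 := Cmod_triangle _ _); rewrite Cmod_opp, !Cmod_mult.
    assert (I := fval_le_pairing (csub f g) (mapp P 0) Hs Hp).
    assert (I' := dinner_le_pairing (csub f g) cst1 Hs InD_cst1); fold (pairing (csub f g) cst1) in I'.
    rewrite dinner_cst1_r in I' by auto.
    assert (J1 := pairing_pos _ _ Hs HKp); assert (J2 := pairing_pos _ _ Hs HTK); assert (J3 := pairing_pos _ _ Hs InD_cst1).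
    assert (L1 : (Cmod k1 <= B2)%R) by now apply HB2.
    assert (L2 : (Cmod k2 <= B2 * B1)%R).
    { unfold k2; rewrite Cmod_mult; apply Rmult_le_compat; try apply Cmod_ge_0; auto.
      apply HB2, selfmap_mapp; auto. }
    assert (K1 := Rmult_le_compat _ _ _ _ (Cmod_ge_0 _) (Cmod_ge_0 _) I L1).
    assert (K2 := Rmult_le_compat _ _ _ _ (Cmod_ge_0 _) (Cmod_ge_0 _) I' L2).
    set (j1 := pairing (csub f g) (kern (mapp P 0))) in *; set (j2 := pairing (csub f g) h2) in *.
    set (j3 := pairing (csub f g) cst1) in *.
    assert (0 <= B2 * B1)%R by now apply Rmult_le_pos.
    assert (0 <= (1 + B2 + B2 * B1) * j2 /\ 0 <= (1 + B2 * B1) * j1 /\ 0 <= (1 + B2) * j3)%R by (repeat split; apply Rmult_le_pos; lra).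
    lra.
Qed.

(** * Derivative kernels along a horocycle *)

Lemma Cnorm2_conj_mult (z : C) : RtoC (Cnorm2 z) = z * Cconj z.
Proof. unfold Cnorm2, RtoC, Cconj, Cmult; cbn; f_equal; ring. Qed.

(** Gram expansion of the squared norm of B1 e_(s1) - B2 e_(s2): each of the four terms is a series
    with terms (n + 1) x^n. *)
Lemma weighted_diff_series (B1 B2 s1 s2 : C) : (Cmod s1 < 1)%R -> (Cmod s2 < 1)%R ->
  Cseries (fun n => RtoC (INR (S n) * Cnorm2 (B1 * s1 ^ n - B2 * s2 ^ n)%C))
    (B1 * Cconj B1 / ((1 - s1 * Cconj s1) * (1 - s1 * Cconj s1))
     + B2 * Cconj B2 / ((1 - s2 * Cconj s2) * (1 - s2 * Cconj s2))
     - (B1 * Cconj B2 / ((1 - s1 * Cconj s2) * (1 - s1 * Cconj s2))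
        + B2 * Cconj B1 / ((1 - s2 * Cconj s1) * (1 - s2 * Cconj s1)))).
Proof.
  intros H1 H2.
  assert (H1' : (Cmod (Cconj s1) < 1)%R) by now rewrite Cmod_conj.
  assert (H2' : (Cmod (Cconj s2) < 1)%R) by now rewrite Cmod_conj.
  assert (G : forall A s t : C, (Cmod s < 1)%R -> (Cmod t < 1)%R ->
    Cseries (fun n => A * (INR (S n) * (s * t) ^ n)) (A / ((1 - s * t) * (1 - s * t)))).
  { intros A s t Hs Ht; assert (L := Cmod_mult_lt_1 s t Hs Ht).
    unfold Cdiv; apply Cseries_scal; rewrite <- Csum_geom1 by auto; now apply Cabs_Cseries, Cabs_geom1. }
  assert (E := Cseries_plus _ _ _ _ (Cseries_plus _ _ _ _ (G (B1 * Cconj B1) _ _ H1 H1') (G (B2 * Cconj B2) _ _ H2 H2'))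
    (Cseries_scal (-(1)) _ _ (Cseries_plus _ _ _ _ (G (B1 * Cconj B2) _ _ H1 H2') (G (B2 * Cconj B1) _ _ H2 H1')))).
  match type of E with Cseries _ ?l => match goal with |- Cseries _ ?m => replace m with l by ring end end.
  apply Cseries_ext with (2 := E); intros n.
  rewrite RtoC_mult, Cnorm2_conj_mult, Cminus_conj, !Cmult_conj, !Cpow_conj, !Cpow_mult_l; ring.
Qed.

Lemma weighted_diff_le (B1 B2 s1 s2 : C) (e : R) : (Cmod s1 < 1)%R -> (Cmod s2 < 1)%R ->
  (forall m, (Rsumn (fun n => INR (S n) * Cnorm2 (B1 * s1 ^ n - B2 * s2 ^ n)%C) m <= e)%R) ->
  (Re (B1 * Cconj B1 / ((1 - s1 * Cconj s1) * (1 - s1 * Cconj s1))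
     + B2 * Cconj B2 / ((1 - s2 * Cconj s2) * (1 - s2 * Cconj s2))
     - (B1 * Cconj B2 / ((1 - s1 * Cconj s2) * (1 - s1 * Cconj s2))
        + B2 * Cconj B1 / ((1 - s2 * Cconj s1) * (1 - s2 * Cconj s1))))%C <= e)%R.
Proof.
  intros H1 H2 H; destruct (weighted_diff_series B1 B2 s1 s2 H1 H2) as [E _].
  apply infinite_sum_series, is_series_unique in E; unfold Re at 1; rewrite <- E.
  apply (ex_series_bounded (fun n => INR (S n) * Cnorm2 (B1 * s1 ^ n - B2 * s2 ^ n)%C)%R).
  - intros n; apply Rmult_le_pos; [apply pos_INR|apply Cnorm2_pos].
  - intros m; rewrite <- Rsumn_sum_n; apply H.
Qed.

(* w = eta * i x / (1 + i x) runs through the horocycle 1 - |w|^2 = |w - eta|^2. *)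
Definition horo (eta : C) (x : R) : C := eta * (Ci * x / (1 + Ci * x)).

(* (1 - i x) times the denominator and the numerator of ks M (conj (horo eta x)). *)
Definition hD (M : mat) (eta : C) (x : R) : C := md M - Ci * x * (md M - Cconj eta * mb M).
Definition hN (M : mat) (eta : C) (x : R) : C := - mc M - Ci * x * (Cconj eta * ma M - mc M).

Lemma Cnorm2_1_ix (x : R) : Cnorm2 (1 + Ci * x) = (1 + x * x)%R.
Proof. unfold Cnorm2; cbn; ring. Qed.

Lemma Cnorm2_1_mix (x : R) : Cnorm2 (1 - Ci * x) = (1 + x * x)%R.
Proof. unfold Cnorm2; cbn; ring. Qed.

Lemma Cnorm2_neq_0 (z : C) : Cnorm2 z <> 0%R -> z <> 0.
Proof. intros H E; apply H; rewrite E; apply Cnorm2_0. Qed.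

Lemma one_ix_neq_0 (x : R) : 1 + Ci * x <> 0.
Proof. apply Cnorm2_neq_0; rewrite Cnorm2_1_ix; nra. Qed.

Lemma one_mix_neq_0 (x : R) : 1 - Ci * x <> 0.
Proof. apply Cnorm2_neq_0; rewrite Cnorm2_1_mix; nra. Qed.

Lemma Cconj_Ci : Cconj Ci = - Ci.
Proof. unfold Cconj, Ci, Copp; cbn; f_equal; ring. Qed.

Lemma Ci_sqr : Ci * Ci = -(1).
Proof. unfold Ci, Cmult, Copp, RtoC; cbn; f_equal; ring. Qed.

Lemma conj_1_ix (x : R) : Cconj (1 + Ci * x) = 1 - Ci * x.
Proof. rewrite Cplus_conj, Cmult_conj, !Cconj_RtoC, Cconj_Ci; ring. Qed.

Lemma horo_conj (eta : C) (x : R) : Cconj (horo eta x) = Cconj eta * (- (Ci * x) / (1 - Ci * x)).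
Proof.
  unfold horo; rewrite Cmult_conj, Cdiv_conj, conj_1_ix, Cmult_conj, Cconj_RtoC, Cconj_Ci by apply one_ix_neq_0.
  f_equal; unfold Cdiv; ring.
Qed.

Lemma horo_norm (eta : C) (x : R) : Cmod eta = 1%R -> (1 - Cnorm2 (horo eta x) = / (1 + x * x))%R.
Proof.
  intros He; apply RtoC_inj; rewrite RtoC_minus, RtoC_inv, Cnorm2_conj_mult, horo_conj by nra.
  assert (E : RtoC (1 + x * x) = (1 + Ci * x) * (1 - Ci * x)).
  { rewrite <- conj_1_ix, <- Cnorm2_conj_mult, Cnorm2_1_ix; reflexivity. }
  rewrite E; unfold horo.
  assert (A := one_ix_neq_0 x); assert (B := one_mix_neq_0 x).
  transitivity (1 - (eta * Cconj eta) * (- ((Ci * Ci) * (x * x)) / ((1 + Ci * x) * (1 - Ci * x)))); [field; auto|].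
  rewrite <- Cnorm2_conj_mult, Cnorm2_Cmod, He, Rmult_1_l, Ci_sqr.
  transitivity (((1 + Ci * x) * (1 - Ci * x) - x * x) / ((1 + Ci * x) * (1 - Ci * x))); [field; auto|].
  transitivity ((1 - (Ci * Ci + 1) * (x * x)) / ((1 + Ci * x) * (1 - Ci * x))); [field; auto|].
  rewrite Ci_sqr; field; auto.
Qed.

Lemma horo_disk (eta : C) (x : R) : Cmod eta = 1%R -> (Cmod (horo eta x) < 1)%R.
Proof.
  intros He; apply in_disk_Cmod; unfold in_disk.
  assert (P : (0 < / (1 + x * x))%R) by (apply Rinv_0_lt_compat; nra).
  rewrite <- (horo_norm eta x He) in P; lra.
Qed.

Lemma hD_eq (M : mat) (eta : C) (x : R) : hD M eta x = (1 - Ci * x) * (md M - Cconj (horo eta x) * mb M).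
Proof. rewrite horo_conj; unfold hD; assert (B := one_mix_neq_0 x); field; auto. Qed.

Lemma hN_eq (M : mat) (eta : C) (x : R) : hN M eta x = (1 - Ci * x) * (Cconj (horo eta x) * ma M - mc M).
Proof. rewrite horo_conj; unfold hN; assert (B := one_mix_neq_0 x); field; auto. Qed.

Lemma Cmod_conj_horo (eta : C) (x : R) : Cmod eta = 1%R -> (Cmod (Cconj (horo eta x)) < 1)%R.
Proof. intros; rewrite Cmod_conj; now apply horo_disk. Qed.

Lemma hN_lt_hD (M : mat) (eta : C) (x : R) : selfmap M -> Cmod eta = 1%R -> (Cmod (hN M eta x) < Cmod (hD M eta x))%R.
Proof.
  intros HM He; rewrite hD_eq, hN_eq, !Cmod_mult; apply Rmult_lt_compat_l.
  - apply Cmod_gt_0, one_mix_neq_0.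
  - now apply selfmap_krein_lt, Cmod_conj_horo.
Qed.

Lemma hD_neq_0 (M : mat) (eta : C) (x : R) : selfmap M -> Cmod eta = 1%R -> hD M eta x <> 0.
Proof. intros HM He; exact (Cmod_lt_neq_0 _ _ (hN_lt_hD M eta x HM He)). Qed.

Lemma ks_horo (M : mat) (eta : C) (x : R) : selfmap M -> Cmod eta = 1%R ->
  ks M (Cconj (horo eta x)) = hN M eta x / hD M eta x.
Proof.
  intros HM He; rewrite hD_eq, hN_eq; unfold ks.
  assert (A := krein_den_neq_0 M _ HM (Cmod_conj_horo eta x He)); assert (B := one_mix_neq_0 x).
  field; auto.
Qed.

(** Unimodular and independent of the map, so it drops out of the norm of a difference of two
    images. *)
Definition hphase (x : R) : C := (1 - Ci * x) / (1 + Ci * x).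

Lemma hphase_norm (x : R) : Cnorm2 (hphase x) = 1%R.
Proof.
  apply RtoC_inj; rewrite Cnorm2_conj_mult; unfold hphase.
  rewrite <- conj_1_ix, Cdiv_conj, Cconj_conj by apply one_ix_neq_0.
  rewrite conj_1_ix; assert (A := one_ix_neq_0 x); assert (B := one_mix_neq_0 x); field; auto.
Qed.

Lemma kbeta_horo (M : mat) (eta : C) (x : R) : selfmap M -> Cmod eta = 1%R ->
  RtoC (1 - Cnorm2 (horo eta x)) * kbeta M (Cconj (horo eta x)) = hphase x * (mdet M / (hD M eta x * hD M eta x)).
Proof.
  intros HM He; rewrite horo_norm by auto; rewrite hD_eq; unfold kbeta, hphase.
  assert (A := krein_den_neq_0 M _ HM (Cmod_conj_horo eta x He)).
  assert (B := one_mix_neq_0 x); assert (B' := one_ix_neq_0 x).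
  assert (E : RtoC (1 + x * x) = (1 + Ci * x) * (1 - Ci * x)).
  { rewrite <- conj_1_ix, <- Cnorm2_conj_mult, Cnorm2_1_ix; reflexivity. }
  rewrite RtoC_inv, E by nra; field; repeat split; auto.
Qed.

Definition ftest (w : C) : coefs := fun n => RtoC (1 - Cnorm2 w) * es (Cconj w) n.

Lemma es_norm (s : C) : (Cmod s < 1)%R -> Dnorm2 (es s) = (/ ((1 - Cnorm2 s) * (1 - Cnorm2 s)))%R.
Proof.
  intros Hs; assert (E := proj1 (InD_ex_series _) (InD_es s Hs)).
  unfold Dnorm2; rewrite (Series_incr_1 _ E); cbn [es]; rewrite Cnorm2_0, Rmult_0_r, Rplus_0_l.
  assert (L : (Cmod (s * Cconj s) < 1)%R) by (apply Cmod_mult_lt_1; auto; now rewrite Cmod_conj).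
  assert (G := f_equal fst (Csum_geom1 _ L)).
  rewrite <- Cnorm2_conj_mult in G; unfold Csum, Re in G; cbn [fst] in G.
  rewrite <- RtoC_minus, <- RtoC_mult, <- RtoC_inv in G.
  2:{ rewrite <- Cnorm2_conj_mult, Cmod_R, Rabs_pos_eq in L by apply Cnorm2_pos; nra. }
  cbn [fst RtoC] in G; rewrite <- G; apply Series_ext; intros n.
  assert (X : RtoC (dweight (S n) * Cnorm2 (s ^ n)%C) = INR (S n) * Cnorm2 s ^ n).
  { rewrite RtoC_mult, !Cnorm2_conj_mult, Cpow_conj, Cpow_mult_l; reflexivity. }
  exact (f_equal fst X).
Qed.

Lemma ftest_InD (w : C) : (Cmod w < 1)%R -> InD (ftest w).
Proof.
  intros Hw; assert (E := proj1 (InD_ex_series _) (InD_es (Cconj w) ltac:(now rewrite Cmod_conj))).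
  apply InD_ex_series; apply exR_ext with (2 := exR_scal (Cnorm2 (RtoC (1 - Cnorm2 w))) _ E).
  intros n; unfold ftest; rewrite Cnorm2_mult; ring.
Qed.

Lemma ftest_norm (w : C) : (Cmod w < 1)%R -> Dnorm2 (ftest w) = 1%R.
Proof.
  intros Hw; assert (Hw' : (Cmod (Cconj w) < 1)%R) by now rewrite Cmod_conj.
  unfold Dnorm2; rewrite (Series_ext _ (fun n => Cnorm2 (RtoC (1 - Cnorm2 w)) * (dweight n * Cnorm2 (es (Cconj w) n)))%R)
    by (intros n; unfold ftest; rewrite Cnorm2_mult; ring).
  rewrite Series_scal_l; fold (Dnorm2 (es (Cconj w))); rewrite es_norm by auto.
  apply in_disk_Cmod in Hw; unfold in_disk in Hw.
  rewrite !Cnorm2_Cmod, Cmod_conj, Cmod_R, <- Cnorm2_Cmod, Rabs_pos_eq by lra; field; lra.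
Qed.

Lemma ftest_0 (w : C) : ftest w 0%nat = RtoC 0.
Proof. exact (Cmult_0_r _). Qed.

Lemma fval_ftest (w z : C) : (Cmod w < 1)%R -> (Cmod z < 1)%R ->
  fval (ftest w) z = RtoC (1 - Cnorm2 w) * (z / (1 - Cconj w * z)).
Proof.
  intros Hw Hz; assert (Hw' : (Cmod (Cconj w) < 1)%R) by now rewrite Cmod_conj.
  rewrite <- fval_es by auto; unfold fval; rewrite <- Csum_scal.
  - apply Csum_ext; intros n; unfold ftest; ring.
  - apply Cabs_fval with 1%R; auto; intros; now apply Cmod_es_le.
Qed.

Lemma dval_ftest (w z : C) : (Cmod w < 1)%R -> (Cmod z < 1)%R ->
  dval (ftest w) z = RtoC (1 - Cnorm2 w) * dval (es (Cconj w)) z.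
Proof.
  intros Hw Hz; assert (Hw' : (Cmod (Cconj w) < 1)%R) by now rewrite Cmod_conj.
  unfold dval; rewrite <- Csum_scal.
  - apply Csum_ext; intros n; unfold ftest; ring.
  - apply Cabs_dval with 1%R; auto; intros; now apply Cmod_es_le.
Qed.

(** The composite of [ftest w] with M, up to constants. *)
Definition xtest (M : mat) (w : C) : coefs :=
  fun n => RtoC (1 - Cnorm2 w) * kbeta M (Cconj w) * es (ks M (Cconj w)) n.

Lemma dval_ftest_comp (M : mat) (w z : C) : selfmap M -> (Cmod w < 1)%R -> (Cmod z < 1)%R ->
  dval (ftest w) (mapp M z) * mder M z = RtoC (1 - Cnorm2 w) * kbeta M (Cconj w) * dval (es (ks M (Cconj w))) z.
Proof.
  intros HM Hw Hz; rewrite dval_ftest, <- Cmult_assoc, dval_es_comp by (auto using selfmap_mapp; now rewrite Cmod_conj).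
  ring.
Qed.

Lemma ST_ftest (P Q : mat) (Tp Tq S : op) (w : C) (n : nat) : adjoint_setup P Q Tp Tq S -> (Cmod w < 1)%R ->
  S (Tp (ftest w)) (Datatypes.S n) = xtest (mmul P (krein Q)) w (Datatypes.S n)
     + fval (ftest w) (mapp P 0) * kern (mapp Q 0) (Datatypes.S n).
Proof.
  intros HS Hw; assert (HS' := HS); destruct HS' as [HP [HQ _]].
  assert (HX := selfmap_krein Q HQ); assert (HM := selfmap_mmul _ _ HP HX).
  assert (Z := Cmod_0_lt_1).
  assert (Hs := Cmod_ks _ (Cconj w) HM ltac:(now rewrite Cmod_conj)).
  assert (Hk := InD_kern _ (selfmap_mapp Q 0 HQ Z)).
  assert (Hf := ftest_InD w Hw).
  apply dval_unique with (g := fun n => RtoC (1 - Cnorm2 w) * kbeta (mmul P (krein Q)) (Cconj w) * es (ks (mmul P (krein Q)) (Cconj w)) n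
    + fval (ftest w) (mapp P 0) * kern (mapp Q 0) n).
  - apply InD_bounded; now apply (ST_InD P Q Tp Tq).
  - apply bounded_lin; [now apply bounded_es|now apply InD_bounded].
  - intros z Hz; rewrite (ST_dval P Q Tp Tq), dval_lin by auto using bounded_es, InD_bounded.
    rewrite dval_ftest_comp by auto; ring.
Qed.

(** The rank-one term of [TS_dval] carries the factor f(0), which is 0 for [ftest w]. *)
Lemma TS_ftest (P Q : mat) (Tp Tq S : op) (w : C) (n : nat) : adjoint_setup P Q Tp Tq S -> (Cmod w < 1)%R ->
  Tp (S (ftest w)) (Datatypes.S n) = xtest (mmul (krein Q) P) w (Datatypes.S n).
Proof.
  intros HS Hw; assert (HS' := HS); destruct HS' as [HP [HQ _]].
  assert (HX := selfmap_krein Q HQ); assert (HM := selfmap_mmul _ _ HX HP).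
  assert (Hs := Cmod_ks _ (Cconj w) HM ltac:(now rewrite Cmod_conj)).
  assert (Hf := ftest_InD w Hw).
  assert (E := dval_unique (Tp (S (ftest w))) (fun n => RtoC (1 - Cnorm2 w) * kbeta (mmul (krein Q) P) (Cconj w) * es (ks (mmul (krein Q) P) (Cconj w)) n
    + 0 * es (ks (mmul (krein Q) P) (Cconj w)) n)).
  rewrite E.
  - assert (X : forall a b : C, a + 0 * b = a) by (intros; ring); apply X.
  - apply InD_bounded; now apply (TS_InD P Q Tp Tq).
  - apply bounded_lin; now apply bounded_es.
  - intros z Hz; rewrite (TS_dval P Q Tp Tq), dval_lin by auto using bounded_es.
    rewrite dval_ftest_comp, ftest_0 by auto; ring.
Qed.

Lemma vanishes_inv_sqr : vanishes (fun k => / (1 + INR k * INR k))%R.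
Proof.
  intros e He; destruct (archimed_cor1 e He) as [N [HN1 HN2]].
  exists N; intros k Hk; apply Rle_trans with (/ INR N)%R; [|lra].
  apply le_INR in Hk; assert (P : (1 <= INR N)%R) by (apply (le_INR 1); lia).
  apply Rinv_le_contravar; nra.
Qed.

Lemma hD_lower (M : mat) (eta : C) (x : R) : selfmap M -> Cmod eta = 1%R ->
  ((Cmod (md M) - Cmod (mb M)) * (Cmod (md M) - Cmod (mb M)) * (1 + x * x) <= Cnorm2 (hD M eta x))%R.
Proof.
  intros HM He.
  assert (Z := Cmod_0_lt_1).
  assert (L := proj2 HM 0 Z); unfold mnum, mden in L; rewrite !Cmult_0_r, !Cplus_0_l in L.
  rewrite hD_eq, Cnorm2_mult, Cnorm2_1_mix, (Rmult_comm (1 + x * x)).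
  apply Rmult_le_compat_r; [nra|].
  set (u := Cconj (horo eta x)); assert (Hu : (Cmod u < 1)%R) by now apply Cmod_conj_horo.
  assert (T := Cmod_triangle (md M - u * mb M) (u * mb M)).
  replace (md M - u * mb M + u * mb M) with (md M) in T by ring; rewrite Cmod_mult in T.
  assert (Cmod u * Cmod (mb M) <= Cmod (mb M))%R by (generalize (Cmod_ge_0 (mb M)); nra).
  rewrite Cnorm2_Cmod; apply Rmult_le_compat; lra.
Qed.

(** By [hD_lower] the denominator |hD|^2 grows at least like 1 + k^2, while the coefficients of the
    kernel stay below 1. This holds whether or not M touches the circle. *)
Lemma xtest_vanishes (M : mat) (eta : C) (n : nat) : selfmap M -> Cmod eta = 1%R ->
  vanishes (fun k => Cmod (xtest M (horo eta (INR k)) (S n))).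
Proof.
  intros HM He.
  assert (Z := Cmod_0_lt_1).
  assert (L := proj2 HM 0 Z); unfold mnum, mden in L; rewrite !Cmult_0_r, !Cplus_0_l in L.
  set (b := ((Cmod (md M) - Cmod (mb M)) * (Cmod (md M) - Cmod (mb M)))%R).
  assert (b0 : (0 < b)%R) by (unfold b; nra).
  assert (D0 := Cmod_ge_0 (mdet M)).
  apply vanishes_le with (w := fun k => (/ (1 + INR k * INR k))%R) (c := (Cmod (mdet M) * / b)%R); [|intros k|apply vanishes_inv_sqr].
  - apply Rmult_le_pos; auto; left; now apply Rinv_0_lt_compat.
  - unfold xtest; rewrite kbeta_horo by auto; rewrite !Cmod_mult.
    assert (Hh := hphase_norm (INR k)); rewrite Cnorm2_Cmod in Hh.
    assert (Hh1 : Cmod (hphase (INR k)) = 1%R) by (generalize (Cmod_ge_0 (hphase (INR k))); nra).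
    rewrite Hh1, Rmult_1_l.
    assert (E1 := Cmod_es_le _ (S n) (Cmod_ks M _ HM (Cmod_conj_horo eta (INR k) He))).
    assert (HDn := hD_neq_0 M eta (INR k) HM He).
    rewrite Cmod_div, Cmod_mult, <- Cnorm2_Cmod by now apply Cmult_neq_0.
    assert (HL := hD_lower M eta (INR k) HM He); fold b in HL.
    set (y := (1 + INR k * INR k)%R) in *; assert (y0 : (0 < y)%R) by (unfold y; nra).
    assert (Q : (Cmod (mdet M) / Cnorm2 (hD M eta (INR k)) <= Cmod (mdet M) * / b * / y)%R).
    { rewrite Rmult_assoc, <- Rinv_mult; apply Rmult_le_compat_l; auto; apply Rinv_le_contravar; nra. }
    assert (Q0 : (0 <= Cmod (mdet M) / Cnorm2 (hD M eta (INR k)))%R).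
    { apply Rmult_le_pos; auto; left; apply Rinv_0_lt_compat; nra. }
    generalize (Cmod_ge_0 (es (ks M (Cconj (horo eta (INR k)))) (S n))); nra.
Qed.

Lemma fval_ftest_vanishes (eta p : C) : Cmod eta = 1%R -> (Cmod p < 1)%R ->
  vanishes (fun k => Cmod (fval (ftest (horo eta (INR k))) p)).
Proof.
  intros He Hp.
  apply vanishes_le with (w := fun k => (/ (1 + INR k * INR k))%R) (c := (/ (1 - Cmod p))%R);
    [left; apply Rinv_0_lt_compat; lra|intros k|apply vanishes_inv_sqr].
  assert (Hw := horo_disk eta (INR k) He); set (w := horo eta (INR k)) in *.
  rewrite fval_ftest by auto; unfold w; rewrite horo_norm by auto; fold w.
  assert (y0 : (0 < / (1 + INR k * INR k))%R) by (apply Rinv_0_lt_compat; nra).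
  assert (L : (Cmod (Cconj w * p) < 1)%R) by (apply Cmod_mult_lt_1; auto; now rewrite Cmod_conj).
  assert (T := Cmod_triangle (1 - Cconj w * p) (Cconj w * p)).
  replace (1 - Cconj w * p + Cconj w * p) with (RtoC 1) in T by ring.
  rewrite Cmod_1, (Cmod_mult (Cconj w)), Cmod_conj in T.
  rewrite Cmod_mult, Cmod_R, Rabs_pos_eq, Rmult_comm, Cmod_div by (auto using one_minus_neq_0; lra).
  apply Rmult_le_compat_r; [lra|].
  assert (W0 := Cmod_ge_0 w); assert (P0 := Cmod_ge_0 p).
  assert (T2 : (1 - Cmod p <= Cmod (1 - Cconj w * p))%R) by nra.
  unfold Rdiv; rewrite <- (Rmult_1_l (/ (1 - Cmod p))).
  apply Rmult_le_compat; [auto|left; apply Rinv_0_lt_compat; lra|lra|apply Rinv_le_contravar; lra].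
Qed.

(** |det| / [hgap] is the hyperbolic derivative of the Krein adjoint at the point of the
    horocycle. *)
Definition hgap (M : mat) (eta : C) (x : R) : R := (Cnorm2 (hD M eta x) - Cnorm2 (hN M eta x))%R.

Lemma hgap_pos (M : mat) (eta : C) (x : R) : selfmap M -> Cmod eta = 1%R -> (0 < hgap M eta x)%R.
Proof.
  intros HM He; assert (L := hN_lt_hD M eta x HM He); unfold hgap; rewrite !Cnorm2_Cmod.
  generalize (Cmod_ge_0 (hN M eta x)); nra.
Qed.

(** Contact seen from the image side: eta is the boundary value attained, and the Krein adjoint
    touches the circle at eta. *)
Definition touches_at (M : mat) (eta : C) : Prop :=
  Cmod eta = 1%R /\ Cmod (md M - Cconj eta * mb M) = Cmod (Cconj eta * ma M - mc M).

Lemma touches_touches_at (M : mat) : selfmap M -> touches M -> exists eta, touches_at M eta.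
Proof.
  intros HM [zeta [Hz HE]].
  assert (D := selfmap_mden_closed M zeta HM ltac:(lra)).
  exists (mapp M zeta).
  assert (He : Cmod (mapp M zeta) = 1%R).
  { unfold mapp; rewrite Cmod_div, HE by auto; apply Rinv_r; now apply Rgt_not_eq, Cmod_gt_0. }
  split; auto.
  set (eta := mapp M zeta) in *.
  assert (E1 : Cconj eta * eta = 1) by (rewrite Cmult_comm, <- Cnorm2_conj_mult, Cnorm2_Cmod, He, Rmult_1_l; auto).
  assert (E2 : eta * mden M zeta = mnum M zeta) by (unfold eta, mapp; field; auto).
  assert (E3 : md M - Cconj eta * mb M = zeta * (Cconj eta * ma M - mc M)).
  { assert (E4 : Cconj eta * mnum M zeta = mden M zeta) by (rewrite <- E2, Cmult_assoc, E1; ring).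
    unfold mnum, mden in E4.
    transitivity (mc M * zeta + md M - Cconj eta * (ma M * zeta + mb M) + zeta * (Cconj eta * ma M - mc M)); [ring|].
    rewrite E4; ring. }
  rewrite E3, Cmod_mult, Hz; ring.
Qed.

(** [hgap] is a quadratic in x. Contact kills the leading coefficient, and an affine function that
    is positive on the whole line is constant. *)
Lemma hgap_const (M : mat) (eta : C) (x : R) : selfmap M -> touches_at M eta ->
  hgap M eta x = (Cnorm2 (md M) - Cnorm2 (mc M))%R.
Proof.
  intros HM [He HT].
  set (e := md M - Cconj eta * mb M) in *; set (g := Cconj eta * ma M - mc M) in *.
  assert (E : exists b, forall t, hgap M eta t = (Cnorm2 (md M) - Cnorm2 (mc M) + b * t)%R).
  { exists (2 * (Re (md M) * Im e - Im (md M) * Re e + Re (mc M) * Im g - Im (mc M) * Re g))%R; intros t.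
    assert (N : Cnorm2 e = Cnorm2 g) by (rewrite !Cnorm2_Cmod, HT; auto).
    transitivity (Cnorm2 (md M) - Cnorm2 (mc M) + 2 * (Re (md M) * Im e - Im (md M) * Re e + Re (mc M) * Im g - Im (mc M) * Re g) * t
      + (Cnorm2 e - Cnorm2 g) * (t * t))%R; [|rewrite N; ring].
    unfold hgap, hD, hN; fold e g; unfold Cnorm2, Re, Im; cbn; ring. }
  destruct E as [b Hb].
  assert (b0 : b = 0%R).
  { destruct (Req_dec b 0) as [|Hn]; auto; exfalso.
    (* The point where the affine function takes the value -1. *)
    assert (P := hgap_pos M eta (- (Cnorm2 (md M) - Cnorm2 (mc M) + 1) / b)%R HM He); rewrite Hb in P.
    replace (b * (- (Cnorm2 (md M) - Cnorm2 (mc M) + 1) / b))%R with (- (Cnorm2 (md M) - Cnorm2 (mc M) + 1))%R in P by (field; auto).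
    lra. }
  rewrite Hb, b0; ring.
Qed.

(** * Consequences of compactness *)

Lemma Cmult_integral (x y : C) : x * y = 0 -> x = 0 \/ y = 0.
Proof.
  intros H; destruct (Ceq_dec x 0) as [|Hx]; auto; right.
  replace y with ((x * y) / x) by (field; auto); rewrite H; field; auto.
Qed.

Lemma cross_term (E1 E2 D1 D2 N1 N2 : C) : (Cmod N1 < Cmod D1)%R -> (Cmod N2 < Cmod D2)%R ->
  (E1 / (D1 * D1)) * Cconj (E2 / (D2 * D2))
    / ((1 - (N1 / D1) * Cconj (N2 / D2)) * (1 - (N1 / D1) * Cconj (N2 / D2)))
  = E1 * Cconj E2 / ((D1 * Cconj D2 - N1 * Cconj N2) * (D1 * Cconj D2 - N1 * Cconj N2)).
Proof.
  intros H1 H2; assert (P1 := Cmod_lt_neq_0 _ _ H1); assert (P2 := Cmod_lt_neq_0 _ _ H2).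
  assert (P2' : Cconj D2 <> 0) by (apply Cmod_gt_0; rewrite Cmod_conj; now apply Cmod_gt_0).
  assert (L : 1 - (N1 / D1) * Cconj (N2 / D2) <> 0).
  { apply one_minus_neq_0, Cmod_mult_lt_1; [|rewrite Cmod_conj]; now apply Cmod_div_lt_1. }
  rewrite !Cdiv_conj, Cmult_conj in * by auto using Cmult_neq_0.
  assert (L' : D1 * Cconj D2 - N1 * Cconj N2 <> 0).
  { replace (D1 * Cconj D2 - N1 * Cconj N2) with ((1 - N1 / D1 * (Cconj N2 / Cconj D2)) * (D1 * Cconj D2)) by (field; auto).
    auto using Cmult_neq_0. }
  field; repeat split; auto.
Qed.

(** Homogeneous form of |1 - s1 conj s2|^2 = (1 - |s1|^2) (1 - |s2|^2) + |s1 - s2|^2, through which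
    the pseudo-hyperbolic distance enters. *)
Lemma Cnorm2_cross (D1 D2 N1 N2 : C) :
  Cnorm2 (D1 * Cconj D2 - N1 * Cconj N2)
  = ((Cnorm2 D1 - Cnorm2 N1) * (Cnorm2 D2 - Cnorm2 N2) + Cnorm2 (D1 * N2 - N1 * D2))%R.
Proof. unfold Cnorm2; cbn; ring. Qed.

Lemma Cmod_cross_le (E1 E2 G : C) : G <> 0 ->
  (Re (E1 * Cconj E2 / (G * G)) <= Cmod E1 * Cmod E2 / Cnorm2 G)%R.
Proof.
  intros HG; apply Rle_trans with (1 := Rle_abs _), Rle_trans with (1 := re_le_Cmod _).
  rewrite Cmod_div, !Cmod_mult, Cmod_conj, <- Cnorm2_Cmod by (auto using Cmult_neq_0); lra.
Qed.

(** The second alternative covers a zero denominator; positivity of the gap excludes it in each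
    application. *)
Lemma diag_term (E D N : C) :
  E * Cconj E / ((D * Cconj D - N * Cconj N) * (D * Cconj D - N * Cconj N))
  = RtoC (Cnorm2 E / ((Cnorm2 D - Cnorm2 N) * (Cnorm2 D - Cnorm2 N)))
  \/ (Cnorm2 D - Cnorm2 N = 0)%R.
Proof.
  destruct (Req_dec (Cnorm2 D - Cnorm2 N) 0) as [|H]; [right; auto|left].
  rewrite RtoC_div by (apply Rmult_integral_contrapositive; auto).
  rewrite RtoC_mult, RtoC_minus, !Cnorm2_conj_mult; reflexivity.
Qed.

Definition hW (M1 M2 : mat) (eta : C) (x : R) : C :=
  hD M1 eta x * hN M2 eta x - hN M1 eta x * hD M2 eta x.

(** The two diagonal terms of the Gram expansion are squared hyperbolic derivatives; each cross term
    is bounded by its modulus, whose denominator [Cnorm2_cross] rewrites with the determinant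
    [hW]. *)
Lemma horo_gram_le (M1 M2 : mat) (eta : C) (x e : R) : selfmap M1 -> selfmap M2 -> Cmod eta = 1%R ->
  (forall m, (Rsumn (fun n => INR (S n) * Cnorm2 (xtest M1 (horo eta x) (S n) - xtest M2 (horo eta x) (S n))%C) m <= e)%R) ->
  (Cnorm2 (mdet M1) / (hgap M1 eta x * hgap M1 eta x) + Cnorm2 (mdet M2) / (hgap M2 eta x * hgap M2 eta x)
   - 2 * (Cmod (mdet M1) * Cmod (mdet M2) / (hgap M1 eta x * hgap M2 eta x + Cnorm2 (hW M1 M2 eta x))) <= e)%R.
Proof.
  intros H1 H2 He H.
  assert (L1 := hN_lt_hD M1 eta x H1 He); assert (L2 := hN_lt_hD M2 eta x H2 He).
  assert (G1 := hgap_pos M1 eta x H1 He); assert (G2 := hgap_pos M2 eta x H2 He).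
  assert (Q := weighted_diff_le (mdet M1 / (hD M1 eta x * hD M1 eta x)) (mdet M2 / (hD M2 eta x * hD M2 eta x))
    (hN M1 eta x / hD M1 eta x) (hN M2 eta x / hD M2 eta x) e (Cmod_div_lt_1 _ _ L1) (Cmod_div_lt_1 _ _ L2)).
  rewrite !cross_term in Q by auto.
  unfold hgap, hW in *.
  rewrite <- Cnorm2_cross.
  set (D1 := hD M1 eta x) in *; set (D2 := hD M2 eta x) in *; set (N1 := hN M1 eta x) in *; set (N2 := hN M2 eta x) in *.
  destruct (diag_term (mdet M1) D1 N1) as [T1|T1]; [|lra].
  destruct (diag_term (mdet M2) D2 N2) as [T2|T2]; [|lra].
  rewrite T1, T2 in Q.
  set (G := D1 * Cconj D2 - N1 * Cconj N2) in *.
  assert (HG : G <> 0).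
  { apply Cnorm2_neq_0; unfold G; rewrite Cnorm2_cross; generalize (Cnorm2_pos (D1 * N2 - N1 * D2)); nra. }
  assert (EG : D2 * Cconj D1 - N2 * Cconj N1 = Cconj G) by (unfold G; rewrite Cminus_conj, !Cmult_conj, !Cconj_conj; ring).
  assert (HG' : Cconj G <> 0) by (apply Cmod_gt_0; rewrite Cmod_conj; now apply Cmod_gt_0).
  rewrite EG in Q.
  assert (C1 := Cmod_cross_le (mdet M1) (mdet M2) G HG).
  assert (C2 := Cmod_cross_le (mdet M2) (mdet M1) _ HG').
  rewrite (Cnorm2_Cmod (Cconj G)), Cmod_conj, <- Cnorm2_Cmod, (Rmult_comm (Cmod (mdet M2))) in C2.
  assert (Q' : (Re (RtoC (Cnorm2 (mdet M1) / ((Cnorm2 D1 - Cnorm2 N1) * (Cnorm2 D1 - Cnorm2 N1))) +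
     RtoC (Cnorm2 (mdet M2) / ((Cnorm2 D2 - Cnorm2 N2) * (Cnorm2 D2 - Cnorm2 N2))) -
     (mdet M1 * Cconj (mdet M2) / (G * G) + mdet M2 * Cconj (mdet M1) / (Cconj G * Cconj G)))%C <= e)%R).
  { apply Q; intros m; apply Rle_trans with (2 := H m); right; apply Rsumn_ext; intros n; f_equal.
    unfold xtest, es; rewrite !kbeta_horo, !ks_horo by auto; fold D1 D2 N1 N2.
    replace (hphase x * (mdet M1 / (D1 * D1)) * (N1 / D1) ^ n - hphase x * (mdet M2 / (D2 * D2)) * (N2 / D2) ^ n)
      with (hphase x * (mdet M1 / (D1 * D1) * (N1 / D1) ^ n - mdet M2 / (D2 * D2) * (N2 / D2) ^ n)) by ring.
    rewrite Cnorm2_mult, hphase_norm; ring. }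
  change (Re (?a + ?b - (?c + ?d))) with (Re a + Re b - (Re c + Re d))%R in Q'.
  change (Re (RtoC ?a)) with a in Q'.
  lra.
Qed.

Lemma horo_single_le (M : mat) (eta : C) (x e : R) : selfmap M -> Cmod eta = 1%R ->
  (forall m, (Rsumn (fun n => INR (S n) * Cnorm2 (xtest M (horo eta x) (S n))) m <= e)%R) ->
  (Cnorm2 (mdet M) / (hgap M eta x * hgap M eta x) <= e)%R.
Proof.
  intros H1 He H.
  assert (L1 := hN_lt_hD M eta x H1 He); assert (G1 := hgap_pos M eta x H1 He).
  assert (Z := Cmod_0_lt_1).
  assert (Q := weighted_diff_le (mdet M / (hD M eta x * hD M eta x)) 0
    (hN M eta x / hD M eta x) 0 e (Cmod_div_lt_1 _ _ L1) Z).
  rewrite cross_term in Q by auto.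
  unfold hgap in *.
  set (D1 := hD M eta x) in *; set (N1 := hN M eta x) in *.
  destruct (diag_term (mdet M) D1 N1) as [T1|T1]; [|lra].
  rewrite T1, Cconj_RtoC in Q.
  match type of Q with _ -> (Re ?z <= _)%R => replace z with (RtoC (Cnorm2 (mdet M) / ((Cnorm2 D1 - Cnorm2 N1) * (Cnorm2 D1 - Cnorm2 N1)))) in Q end.
  - apply Q; intros m; apply Rle_trans with (2 := H m); right; apply Rsumn_ext; intros n; f_equal.
    unfold xtest, es; rewrite !kbeta_horo, !ks_horo by auto; fold D1 N1.
    replace (mdet M / (D1 * D1) * (N1 / D1) ^ n - 0 * 0 ^ n) with (mdet M / (D1 * D1) * (N1 / D1) ^ n) by ring.
    rewrite <- Cmult_assoc, (Cnorm2_mult (hphase x)), hphase_norm; ring.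
  - unfold Cdiv; ring.
Qed.

(** The squared norm of the image, up to the rank-one term, is the constant h = |det|^2 / g^2 along
    the horocycle, whereas compactness would push it below h / 2. *)
Lemma not_compact_of_touch (K : op) (M : mat) (p eta : C) (y : coefs) : selfmap M -> touches_at M eta ->
  (Cmod p < 1)%R -> InD y ->
  (forall w n, (Cmod w < 1)%R -> K (ftest w) (S n) = xtest M w (S n) + fval (ftest w) p * y (S n)) ->
  ~ compact_on_D K.
Proof.
  intros HM HT Hp Hy HK HC; assert (He := proj1 HT).
  assert (Dp := Cnorm2_gt_0 _ (proj1 HM)).
  set (g := (Cnorm2 (md M) - Cnorm2 (mc M))%R).
  assert (g0 : (0 < g)%R) by (generalize (hgap_pos M eta 0 HM He); rewrite hgap_const; auto).
  set (h := (Cnorm2 (mdet M) / (g * g))%R).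
  assert (h0 : (0 < h)%R) by (apply Rdiv_lt_0_compat; nra).
  destruct (compact_test K (fun k => ftest (horo eta (INR k))) (fun k => xtest M (horo eta (INR k)))
    (fun k => fval (ftest (horo eta (INR k))) p) y 1 HC) with (eps := (h / 2)%R) (N := 0%nat) as [k [_ Hk]]; auto.
  - intros k; now apply ftest_InD, horo_disk.
  - intros k; rewrite ftest_norm; [lra|now apply horo_disk].
  - intros k n; now apply HK, horo_disk.
  - now apply fval_ftest_vanishes.
  - intros n; now apply xtest_vanishes.
  - lra.
  - apply horo_single_le in Hk; auto; rewrite hgap_const in Hk by auto; fold g in Hk; fold h in Hk; lra.
Qed.

(** Compactness supplies a subsequence only, so smallness is assumed at some k beyond each N. The
    coefficients are removed from the top, a nonzero leading term being dominant at large k. *)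
Lemma small_poly_zero (p0 p1 p2 : C) :
  (forall e N, (0 < e)%R -> exists k, (N <= k)%nat /\ (Cmod (p0 + INR k * p1 + INR k * INR k * p2) <= e)%R) ->
  p0 = 0 /\ p1 = 0 /\ p2 = 0.
Proof.
  intros H.
  assert (Big : forall X : R, exists N : nat, (X <= INR N)%R /\ (1 <= N)%nat).
  { intros X; destruct (INR_unbounded X) as [N HN]; exists (S N); split; [|lia]; rewrite S_INR; lra. }
  assert (K2 : p2 = 0).
  { destruct (Ceq_dec p2 0) as [|n2]; auto; exfalso; apply Cmod_gt_0 in n2.
    (* For k >= N this gives k^2 |p2| >= k (|p0| + |p1| + 2), more than |p0| + k |p1| + 1. *)
    destruct (Big ((Cmod p0 + Cmod p1 + 2) / Cmod p2)%R) as [N [HN N1]].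
    destruct (H 1%R N ltac:(lra)) as [k [Hk1 Hk2]].
    apply le_INR in Hk1; apply le_INR in N1; cbn [INR] in N1.
    assert (A : (Cmod p0 + Cmod p1 + 2 <= INR k * Cmod p2)%R).
    { apply Rle_trans with ((Cmod p0 + Cmod p1 + 2) / Cmod p2 * Cmod p2)%R; [right; field; lra|].
      apply Rmult_le_compat_r; lra. }
    assert (T := Cmod_triangle (p0 + INR k * p1 + INR k * INR k * p2) (- p0 + - (INR k * p1))).
    replace (p0 + INR k * p1 + INR k * INR k * p2 + (- p0 + - (INR k * p1))) with (INR k * INR k * p2) in T by ring.
    assert (T2 := Cmod_triangle (- p0) (- (INR k * p1))).
    rewrite !Cmod_opp, !Cmod_mult, !Cmod_R, !Rabs_pos_eq in T2 by apply pos_INR.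
    rewrite !Cmod_mult, !Cmod_R, !Rabs_pos_eq in T by apply pos_INR.
    generalize (Cmod_ge_0 p0) (Cmod_ge_0 p1); intros.
    assert (INR k * (Cmod p0 + Cmod p1 + 2) <= INR k * (INR k * Cmod p2))%R by (apply Rmult_le_compat_l; lra).
    nra. }
  subst p2.
  assert (K1 : p1 = 0).
  { destruct (Ceq_dec p1 0) as [|n1]; auto; exfalso; apply Cmod_gt_0 in n1.
    destruct (Big ((Cmod p0 + 2) / Cmod p1)%R) as [N [HN N1]].
    destruct (H 1%R N ltac:(lra)) as [k [Hk1 Hk2]].
    apply le_INR in Hk1.
    assert (A : (Cmod p0 + 2 <= INR k * Cmod p1)%R).
    { apply Rle_trans with ((Cmod p0 + 2) / Cmod p1 * Cmod p1)%R; [right; field; lra|].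
      apply Rmult_le_compat_r; lra. }
    assert (T := Cmod_triangle (p0 + INR k * p1 + INR k * INR k * 0) (- p0)).
    replace (p0 + INR k * p1 + INR k * INR k * 0 + - p0) with (INR k * p1) in T by ring.
    rewrite Cmod_opp, Cmod_mult, Cmod_R, Rabs_pos_eq in T by apply pos_INR.
    lra. }
  subst p1; repeat split; auto.
  apply Cmod_eq_0; apply Rle_antisym; [|apply Cmod_ge_0].
  apply Rnot_lt_le; intros L.
  destruct (H (Cmod p0 / 2)%R 0%nat ltac:(lra)) as [k [_ Hk]].
  replace (p0 + INR k * 0 + INR k * INR k * 0) with p0 in Hk by ring; lra.
Qed.

(* With h_i = |det_i| / g_i and theta = g1 g2 / (g1 g2 + W), the hypothesis reads
   h1^2 + h2^2 - 2 h1 h2 theta <= e; it forces (h1 - h2)^2 <= e and h1^2 (1 - theta) <= e. *)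
Lemma gram_defect (d1 d2 g1 g2 W e : R) : (0 < d1)%R -> (0 < d2)%R -> (0 < g1)%R -> (0 < g2)%R -> (0 <= W)%R ->
  (e <= (d1 / g1) * (d1 / g1) / 4)%R ->
  (d1 * d1 / (g1 * g1) + d2 * d2 / (g2 * g2) - 2 * (d1 * d2 / (g1 * g2 + W)) <= e)%R ->
  (W <= 4 * e * g1 * (2 * d2 * g1 / d1) / ((d1 / g1) * (d1 / g1)))%R.
Proof.
  intros Hd1 Hd2 Hg1 Hg2 HW He H.
  set (h1 := (d1 / g1)%R) in *; set (h2 := (d2 / g2)%R).
  assert (P1 : (0 < h1)%R) by now apply Rdiv_lt_0_compat.
  assert (P2 : (0 < h2)%R) by now apply Rdiv_lt_0_compat.
  assert (Pg : (0 < g1 * g2)%R) by now apply Rmult_lt_0_compat.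
  set (th := (g1 * g2 / (g1 * g2 + W))%R).
  assert (Hth : (th * (g1 * g2 + W) = g1 * g2)%R) by (unfold th; field; lra).
  assert (th0 : (0 < th)%R) by (apply Rdiv_lt_0_compat; lra).
  assert (th1 : (th <= 1)%R) by (apply Rmult_le_reg_r with (g1 * g2 + W)%R; lra).
  assert (H' : (h1 * h1 + h2 * h2 - 2 * (h1 * h2 * th) <= e)%R).
  { replace (h1 * h1 + h2 * h2 - 2 * (h1 * h2 * th))%R
      with (d1 * d1 / (g1 * g1) + d2 * d2 / (g2 * g2) - 2 * (d1 * d2 / (g1 * g2 + W)))%R; auto.
    unfold h1, h2, th; field; lra. }
  assert (B1 : ((h1 - h2) * (h1 - h2) <= e)%R).
  { assert (0 <= h1 * h2 * (1 - th))%R by (apply Rmult_le_pos; [left; now apply Rmult_lt_0_compat|lra]); lra. }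
  assert (B2 : (h1 * h1 * (1 - th) <= e)%R).
  { assert (0 <= (h2 - h1 * th) * (h2 - h1 * th))%R by apply Rle_0_sqr.
    assert (0 <= h1 * h1 * (1 - th) * th)%R by (apply Rmult_le_pos; [apply Rmult_le_pos; nra|lra]).
    lra. }
  assert (B3 : (h1 / 2 <= h2)%R).
  { apply Rnot_lt_le; intros L.
    assert (h1 / 2 * (h1 / 2) < (h1 - h2) * (h1 - h2))%R by (apply Rmult_le_0_lt_compat; lra); lra. }
  (* The gap g2 may vary along the horocycle; h2 >= h1 / 2 bounds it from above, so that the
     conclusion no longer contains it. *)
  assert (B4 : (g2 <= 2 * d2 * g1 / d1)%R).
  { assert (E : (h2 * g2 = d2)%R) by (unfold h2; field; lra).
    apply Rmult_le_reg_r with d1; auto.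
    replace (2 * d2 * g1 / d1 * d1)%R with (2 * d2 * g1)%R by (field; lra).
    assert (E1 : (h1 * g1 = d1)%R) by (unfold h1; field; lra).
    assert (Y : (h1 / 2 * g2 <= h2 * g2)%R) by (apply Rmult_le_compat_r; lra).
    rewrite <- E1; rewrite E in Y.
    assert (h1 / 2 * g2 * (2 * g1) <= d2 * (2 * g1))%R by (apply Rmult_le_compat_r; lra); lra. }
  assert (Ph : (0 < h1 * h1)%R) by now apply Rmult_lt_0_compat.
  assert (B5 : (1 - th <= 1 / 4)%R).
  { apply Rmult_le_reg_l with (h1 * h1)%R; auto; lra. }
  assert (B6 : (3 / 4 * W <= (1 - th) * (g1 * g2))%R) by nra.
  assert (B7 : (h1 * h1 * W <= 2 * e * (g1 * g2))%R).
  { assert (h1 * h1 * (3 / 4 * W) <= h1 * h1 * ((1 - th) * (g1 * g2)))%R by (apply Rmult_le_compat_l; lra).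
    assert (h1 * h1 * (1 - th) * (g1 * g2) <= e * (g1 * g2))%R by (apply Rmult_le_compat_r; lra).
    assert (0 <= h1 * h1 * W)%R by (apply Rmult_le_pos; lra). lra. }
  assert (e0 : (0 <= e)%R) by (apply Rle_trans with (2 := B1), Rle_0_sqr).
  assert (B8 : (2 * e * (g1 * g2) <= 4 * e * g1 * (2 * d2 * g1 / d1))%R).
  { replace (4 * e * g1 * (2 * d2 * g1 / d1))%R with (2 * (e * g1) * (2 * (2 * d2 * g1 / d1)))%R by ring.
    replace (2 * e * (g1 * g2))%R with (2 * (e * g1) * g2)%R by ring.
    apply Rmult_le_compat_l; [repeat apply Rmult_le_pos; lra|lra]. }
  apply Rmult_le_reg_l with (h1 * h1)%R; auto.
  replace (h1 * h1 * (4 * e * g1 * (2 * d2 * g1 / d1) / (h1 * h1)))%R with (4 * e * g1 * (2 * d2 * g1 / d1))%R by (field; lra).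
  lra.
Qed.

Definition hq0 (M1 M2 : mat) : C := - (md M1 * mc M2) + mc M1 * md M2.
Definition he (M : mat) (eta : C) : C := md M - Cconj eta * mb M.
Definition hg (M : mat) (eta : C) : C := Cconj eta * ma M - mc M.
Definition hq1 (M1 M2 : mat) (eta : C) : C :=
  Ci * (he M1 eta * mc M2 - md M1 * hg M2 eta - mc M1 * he M2 eta + hg M1 eta * md M2).
Definition hq2 (M1 M2 : mat) (eta : C) : C := - (he M1 eta * hg M2 eta - hg M1 eta * he M2 eta).

Lemma hW_poly (M1 M2 : mat) (eta : C) (x : R) :
  hW M1 M2 eta x = hq0 M1 M2 + x * hq1 M1 M2 eta + x * x * hq2 M1 M2 eta.
Proof.
  unfold hW, hD, hN, hq0, hq1, hq2; fold (he M1 eta) (he M2 eta) (hg M1 eta) (hg M2 eta).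
  set (w := he M1 eta * hg M2 eta - hg M1 eta * he M2 eta).
  replace (- w) with (Ci * Ci * w) by (rewrite Ci_sqr; ring); unfold w; ring.
Qed.

(** Contact is assumed for [M1], whose gap is then constant; [gram_defect] controls the gap of [M2].
    Small images make the quadratic [hW] small at arbitrarily large integers. *)
Lemma compact_difference (K : op) (M1 M2 : mat) (p eta : C) (y : coefs) :
  selfmap M1 -> selfmap M2 -> touches_at M1 eta -> (Cmod p < 1)%R -> InD y ->
  (forall w n, (Cmod w < 1)%R ->
     K (ftest w) (S n) = xtest M1 w (S n) - xtest M2 w (S n) + fval (ftest w) p * y (S n)) ->
  compact_on_D K -> hq0 M1 M2 = 0 /\ hq1 M1 M2 eta = 0 /\ hq2 M1 M2 eta = 0.
Proof.
  intros H1 H2 HT Hp Hy HK HC; assert (He := proj1 HT).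
  assert (D1 := proj1 (Cmod_gt_0 _) (proj1 H1)); assert (D2 := proj1 (Cmod_gt_0 _) (proj1 H2)).
  set (g := (Cnorm2 (md M1) - Cnorm2 (mc M1))%R).
  assert (g0 : (0 < g)%R) by (generalize (hgap_pos M1 eta 0 H1 He); rewrite hgap_const; auto).
  set (d1 := Cmod (mdet M1)) in *; set (d2 := Cmod (mdet M2)) in *.
  assert (h0 : (0 < d1 / g)%R) by now apply Rdiv_lt_0_compat.
  assert (h00 : (0 < (d1 / g) * (d1 / g))%R) by now apply Rmult_lt_0_compat.
  set (kap := (4 * g * (2 * d2 * g / d1) / ((d1 / g) * (d1 / g)))%R).
  assert (kap0 : (0 < kap)%R).
  { apply Rdiv_lt_0_compat; auto; apply Rmult_lt_0_compat; [lra|]; apply Rdiv_lt_0_compat; auto.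
    repeat apply Rmult_lt_0_compat; lra. }
  apply small_poly_zero; intros e N He0.
  (* The first bound is a hypothesis of [gram_defect]; the second turns its conclusion into |hW|^2
     <= ep kap <= e^2. *)
  destruct (small_pos ((d1 / g) * (d1 / g) / 4) kap (e * e)) as [ep [ep0 [ep1 ep2]]]; [lra|lra|nra|].
  destruct (compact_test K (fun k => ftest (horo eta (INR k)))
    (fun k n => xtest M1 (horo eta (INR k)) n - xtest M2 (horo eta (INR k)) n)
    (fun k => fval (ftest (horo eta (INR k))) p) y 1 HC) with (eps := ep) (N := N) as [k [HNk Hk]]; auto.
  - intros k; now apply ftest_InD, horo_disk.
  - intros k; rewrite ftest_norm; [lra|now apply horo_disk].
  - intros k n; now apply HK, horo_disk.
  - now apply fval_ftest_vanishes.
  - intros n; apply vanishes_le with (w := fun k => (Cmod (xtest M1 (horo eta (INR k)) (S n)) + Cmod (xtest M2 (horo eta (INR k)) (S n)))%R) (c := 1%R); [lra| |].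
    + intros k; rewrite Rmult_1_l, <- (Cmod_opp (xtest M2 _ _)); apply Cmod_triangle.
    + apply vanishes_plus; now apply xtest_vanishes.
  - exists k; split; auto.
    apply horo_gram_le in Hk; auto.
    assert (G2 := hgap_pos M2 eta (INR k) H2 He).
    rewrite hgap_const in Hk by auto; fold g in Hk.
    rewrite !(Cnorm2_Cmod (mdet _)) in Hk; fold d1 d2 in Hk.
    apply gram_defect in Hk; auto using Cnorm2_pos.
    rewrite hW_poly in Hk.
    replace (4 * ep * g * (2 * d2 * g / d1) / (d1 / g * (d1 / g)))%R with (ep * kap)%R in Hk by (unfold kap, Rdiv; ring).
    rewrite Cnorm2_Cmod in Hk.
    match type of Hk with (Cmod ?v * _ <= _)%R => generalize (Cmod_ge_0 v) end; intros; nra.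
Qed.

(** [hq0] = 0 makes the lower rows proportional with factor l. The defects [al], [be] of the upper
    row then solve a homogeneous linear system of determinant [mdet M1], so they vanish. *)
Lemma hW_zero_proportional (M1 M2 : mat) (eta : C) : selfmap M1 -> selfmap M2 -> Cmod eta = 1%R ->
  hq0 M1 M2 = 0 -> hq1 M1 M2 eta = 0 -> hq2 M1 M2 eta = 0 ->
  exists l : C, l <> 0 /\ ma M2 = l * ma M1 /\ mb M2 = l * mb M1 /\ mc M2 = l * mc M1 /\ md M2 = l * md M1.
Proof.
  intros H1 H2 He Z0 Z1 Z2.
  assert (EE : eta * Cconj eta = 1) by (rewrite <- Cnorm2_conj_mult, Cnorm2_Cmod, He, Rmult_1_l; auto).
  assert (Z := Cmod_0_lt_1).
  assert (D1 := selfmap_mden M1 0 H1 Z); assert (D2 := selfmap_mden M2 0 H2 Z).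
  unfold mden in D1, D2; rewrite Cmult_0_r, Cplus_0_l in D1, D2.
  assert (CiN : Ci <> 0) by (intros E; apply (f_equal snd) in E; cbn in E; lra).
  assert (Z1' : he M1 eta * mc M2 - md M1 * hg M2 eta - mc M1 * he M2 eta + hg M1 eta * md M2 = 0).
  { unfold hq1 in Z1; apply Cmult_integral in Z1; destruct Z1; [contradiction|auto]. }
  set (l := md M2 / md M1).
  assert (Dl : md M2 = l * md M1) by (unfold l; field; auto).
  assert (Cl : mc M2 = l * mc M1).
  { unfold l; replace (mc M2) with ((md M1 * mc M2) / md M1) by (field; auto).
    replace (md M1 * mc M2) with (mc M1 * md M2 - hq0 M1 M2) by (unfold hq0; ring); rewrite Z0; field; auto. }
  set (al := ma M2 - l * ma M1); set (be := mb M2 - l * mb M1).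
  assert (R1 : md M1 * al = mc M1 * be).
  { assert (X : Cconj eta * (mc M1 * be - md M1 * al) = 0).
    { rewrite <- Z1'; unfold he, hg, al, be; rewrite Dl, Cl; ring. }
    assert (X2 : mc M1 * be - md M1 * al = 0).
    { transitivity (eta * Cconj eta * (mc M1 * be - md M1 * al)); [rewrite EE; ring|rewrite <- Cmult_assoc, X; ring]. }
    transitivity (mc M1 * be - (mc M1 * be - md M1 * al)); [ring|rewrite X2; ring]. }
  assert (R2 : ma M1 * be = al * mb M1).
  { assert (X : Cconj eta * Cconj eta * (ma M1 * be - al * mb M1) = 0).
    { transitivity (- hq2 M1 M2 eta + Cconj eta * (mc M1 * be - md M1 * al)).
      - unfold hq2, he, hg, al, be; rewrite Dl, Cl; ring.
      - rewrite Z2, R1; ring. }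
    assert (X2 : ma M1 * be - al * mb M1 = 0).
    { transitivity (eta * Cconj eta * (eta * Cconj eta) * (ma M1 * be - al * mb M1)); [rewrite EE; ring|].
      transitivity (eta * eta * (Cconj eta * Cconj eta * (ma M1 * be - al * mb M1))); [ring|rewrite X; ring]. }
    transitivity (al * mb M1 + (ma M1 * be - al * mb M1)); [ring|rewrite X2; ring]. }
  assert (A0 : mdet M1 * al = 0).
  { transitivity (ma M1 * (md M1 * al) - mc M1 * (al * mb M1)); [unfold mdet; ring|rewrite R1, <- R2; ring]. }
  assert (B0 : mdet M1 * be = 0).
  { transitivity (md M1 * (ma M1 * be) - mb M1 * (mc M1 * be)); [unfold mdet; ring|rewrite R2, <- R1; ring]. }
  apply Cmult_integral in A0; destruct A0 as [A0|A0]; [now destruct (proj1 H1)|].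
  apply Cmult_integral in B0; destruct B0 as [B0|B0]; [now destruct (proj1 H1)|].
  exists l; repeat split; auto.
  - intros E; apply D2; rewrite Dl, E; ring.
  - transitivity (al + l * ma M1); [unfold al; ring|rewrite A0; ring].
  - transitivity (be + l * mb M1); [unfold be; ring|rewrite B0; ring].
Qed.

(** * Fixed points and sufficiency *)

Definition fixes (M : mat) (z : C) : Prop := mnum M z = z * mden M z.

Definition efix (M : mat) (p : ext) : Prop :=
  match p with Some z => fixes M z | None => mc M = 0 end.

(** Among invertible matrices, those of the identity map, for which every point is fixed. *)
Definition scalar_mat (M : mat) : Prop := mb M = 0 /\ mc M = 0 /\ ma M = md M.

Lemma fixes_mden (M : mat) (z : C) : mdet M <> 0 -> fixes M z -> mden M z <> 0.
Proof.
  intros HD HF E; unfold fixes in HF; rewrite E, Cmult_0_r in HF; apply HD.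
  replace (mdet M) with (ma M * mden M z - mc M * mnum M z) by (unfold mdet, mden, mnum; ring).
  rewrite E, HF; ring.
Qed.

Lemma Cdiv_eq_iff (x y z : C) : y <> 0 -> x / y = z <-> x = z * y.
Proof.
  intros Hy; split; [intros <-; field; auto|intros ->; field; auto].
Qed.

Lemma lft_fixed_efix (a b c d : C) (p : ext) : mdet (Mat a b c d) <> 0 ->
  lft_fixed a b c d p <-> efix (Mat a b c d) p.
Proof.
  intros HD; destruct p as [z|]; [|reflexivity].
  unfold lft_fixed, efix, fixes; rewrite lft_mob.
  change (Cadd (Cmul c z) d) with (mden (Mat a b c d) z).
  change (mob a b c d z) with (mapp (Mat a b c d) z); unfold mapp; split.
  - intros [H1 H2]; now apply Cdiv_eq_iff.
  - intros H; assert (N := fixes_mden _ _ HD H); split; auto; now apply Cdiv_eq_iff.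
Qed.

(* The quadratic c p^2 + (d - a) p - b splits off the factor p - zeta. *)
Lemma fixes_other (M : mat) (zeta p : C) : fixes M zeta ->
  fixes M p <-> (p = zeta \/ mc M * p = ma M - md M - mc M * zeta).
Proof.
  intros HZ; unfold fixes, mnum, mden in *.
  assert (E : p * (mc M * p + md M) - (ma M * p + mb M)
    = (p - zeta) * (mc M * p - (ma M - md M - mc M * zeta)) + (zeta * (mc M * zeta + md M) - (ma M * zeta + mb M))) by ring.
  rewrite HZ in E; split.
  - intros H; rewrite H in E.
    assert (E' : (p - zeta) * (mc M * p - (ma M - md M - mc M * zeta)) = 0).
    { transitivity ((p - zeta) * (mc M * p - (ma M - md M - mc M * zeta)) + (zeta * (mc M * zeta + md M) - zeta * (mc M * zeta + md M)));
        [ring|rewrite <- E; ring]. }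
    apply Cmult_integral in E'; destruct E' as [E'|E']; [left|right].
    + transitivity (zeta + (p - zeta)); [ring|rewrite E'; ring].
    + transitivity ((ma M - md M - mc M * zeta) + (mc M * p - (ma M - md M - mc M * zeta))); [ring|rewrite E'; ring].
  - intros [->|H]; auto.
    assert (K0 : mc M * p - (ma M - md M - mc M * zeta) = 0) by (rewrite H; ring).
    rewrite K0 in E; transitivity (p * (mc M * p + md M) - (p * (mc M * p + md M) - (ma M * p + mb M))); [ring|].
    rewrite E; ring.
Qed.

(** Second root of c p^2 + (d - a) p - b by Vieta's formula, with infinity for c = 0. It is zeta
    again when zeta is a double root, so parabolic and hyperbolic maps need no separate
    treatment. *)
Definition other_fix (M : mat) (zeta : C) : ext :=
  if Ceq_dec (mc M) 0 then None else Some ((ma M - md M - mc M * zeta) / mc M).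

Lemma fixes_mb (M : mat) (zeta : C) : fixes M zeta -> mb M = zeta * (mc M * zeta + md M - ma M).
Proof.
  unfold fixes, mnum, mden; intros H.
  transitivity ((ma M * zeta + mb M) - ma M * zeta); [ring|rewrite H; ring].
Qed.

Lemma efix_other (M : mat) (zeta : C) (p : ext) : fixes M zeta -> ~ scalar_mat M ->
  efix M p <-> (p = Some zeta \/ p = other_fix M zeta).
Proof.
  intros HZ HN; unfold other_fix; destruct p as [z|]; cbn [efix].
  - rewrite (fixes_other M zeta z HZ); destruct (Ceq_dec (mc M) 0) as [E|E].
    + split; [intros [->|H]; auto; exfalso|intros [H|H]; [left; now injection H|discriminate]].
      assert (Ead : ma M = md M).
      { transitivity (md M + (ma M - md M - mc M * zeta) + mc M * zeta); [ring|rewrite <- H, E; ring]. }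
      apply HN; repeat split; auto; rewrite (fixes_mb M zeta HZ), E, Ead; ring.
    + split; intros [H|H].
      * left; now rewrite H.
      * right; f_equal; symmetry; apply Cdiv_eq_iff; auto; rewrite <- H; apply Cmult_comm.
      * left; now injection H.
      * right; injection H as H; symmetry in H; apply Cdiv_eq_iff in H; auto; rewrite H; apply Cmult_comm.
  - destruct (Ceq_dec (mc M) 0) as [E|E]; split; auto; [contradiction|intros [H|H]; discriminate].
Qed.

(** Inversion in the unit circle as a function on the extended plane; as an involution it is easier
    to use than the relation [inv_conj_is]. *)
Definition invc (p : ext) : ext :=
  match p with
  | Some z => if Ceq_dec z 0 then None else Some (/ Cconj z)
  | None => Some (RtoC 0)
  end.

Lemma Cconj_neq_0 (z : C) : z <> 0 -> Cconj z <> 0.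
Proof. intros H; apply Cmod_gt_0; rewrite Cmod_conj; now apply Cmod_gt_0. Qed.

Lemma Defs_Cinv (z : C) : Defs.Cinv z = / z.
Proof. unfold Defs.Cinv, Cinv, Cnorm2; cbn [fst snd pow]; now rewrite !Rmult_1_r. Qed.

Lemma inv_conj_is_invc (p q : ext) : inv_conj_is p q <-> q = invc p.
Proof.
  destruct p as [z|], q as [w|]; cbn [inv_conj_is invc]; try destruct (Ceq_dec z 0) as [E|E]; subst.
  - split; [intros [H _]; now destruct H|discriminate].
  - rewrite Defs_Cinv; split; [intros [_ ->]; reflexivity|intros H; injection H as ->; auto].
  - split; auto.
  - split; [contradiction|discriminate].
  - split; [intros ->; reflexivity|intros H; injection H as ->; auto].
  - split; [contradiction|discriminate].
Qed.

Lemma invc_invc (p : ext) : invc (invc p) = p.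
Proof.
  destruct p as [z|]; cbn [invc].
  - destruct (Ceq_dec z 0) as [E|E]; cbn [invc]; [now rewrite E|].
    assert (E' := Cconj_neq_0 z E).
    destruct (Ceq_dec (/ Cconj z) 0) as [F|F].
    + exfalso; apply E'; transitivity (Cconj z * (/ Cconj z * Cconj z)); [field; auto|rewrite F; ring].
    + f_equal; rewrite Cinv_conj, Cconj_conj by auto; field; auto.
  - destruct (Ceq_dec 0 0) as [E|E]; auto; now destruct E.
Qed.

Lemma circle_conj (z : C) : Cmod z = 1%R -> z * Cconj z = 1.
Proof. intros H; now rewrite <- Cnorm2_conj_mult, Cnorm2_Cmod, H, Rmult_1_l. Qed.

Lemma invc_circle (zeta : C) : Cmod zeta = 1%R -> invc (Some zeta) = Some zeta.
Proof.
  intros H; cbn [invc]; assert (N : zeta <> 0) by (apply Cmod_gt_0; lra).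
  destruct (Ceq_dec zeta 0); [contradiction|]; f_equal.
  assert (E := circle_conj zeta H); assert (N' := Cconj_neq_0 zeta N).
  transitivity ((zeta * Cconj zeta) / Cconj zeta); [rewrite E; field; auto|field; auto].
Qed.

Lemma Cconj_inj (x y : C) : Cconj x = Cconj y -> x = y.
Proof. intros H; now rewrite <- (Cconj_conj x), H, Cconj_conj. Qed.

Lemma Cconj_0_iff (x : C) : - Cconj x = 0 <-> x = 0.
Proof.
  split; intros H.
  - apply Cconj_inj; rewrite Cconj_RtoC; transitivity (- - Cconj x); [ring|rewrite H; ring].
  - rewrite H, Cconj_RtoC; ring.
Qed.

Lemma fixes_krein (M : mat) (z : C) : z <> 0 -> fixes (krein M) z <-> fixes M (/ Cconj z).
Proof.
  intros E; assert (E' := Cconj_neq_0 z E).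
  set (q := / Cconj z); assert (Ez : z = / Cconj q).
  { unfold q; rewrite Cinv_conj, Cconj_conj by auto; field; auto. }
  assert (Hq : q <> 0).
  { intros F; apply E'; transitivity (Cconj z * (q * Cconj z)); [unfold q; field; auto|rewrite F; ring]. }
  assert (Hq' := Cconj_neq_0 q Hq).
  assert (Key : Cconj q * Cconj q * (mnum (krein M) z - z * mden (krein M) z) = Cconj (mnum M q - q * mden M q)).
  { rewrite Ez; unfold mnum, mden; cbn [krein ma mb mc md].
    rewrite Cminus_conj, !Cplus_conj, !Cmult_conj, Cplus_conj, Cmult_conj; field; auto. }
  unfold fixes; split; intros H.
  * assert (X : mnum M q - q * mden M q = 0).
    { apply Cconj_inj; rewrite <- Key, H, Cconj_RtoC; ring. }
    transitivity (q * mden M q + (mnum M q - q * mden M q)); [ring|rewrite X; ring].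
  * assert (X : Cconj q * Cconj q * (mnum (krein M) z - z * mden (krein M) z) = 0).
    { rewrite Key, H, <- (Cconj_RtoC 0); f_equal; ring. }
    apply Cmult_integral in X; destruct X as [X|X]; [exfalso; now apply (Cmult_neq_0 _ _ Hq' Hq')|].
    transitivity (z * mden (krein M) z + (mnum (krein M) z - z * mden (krein M) z)); [ring|rewrite X; ring].
Qed.

(** The Krein adjoint is the inverse of M conjugated by inversion in the circle, and a map and its
    inverse have the same fixed points. *)
Lemma efix_krein (M : mat) (p : ext) : efix (krein M) p <-> efix M (invc p).
Proof.
  destruct p as [z|]; cbn [invc].
  - destruct (Ceq_dec z 0) as [->|E]; cbn [efix]; [|now apply fixes_krein].
    unfold fixes, mnum, mden; cbn [krein ma mb mc md].
    rewrite <- (Cconj_0_iff (mc M)); split; intros H.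
    + rewrite Cmult_0_r, Cplus_0_l, Cmult_0_l in H; auto.
    + rewrite H; ring.
  - cbn [efix]; unfold fixes, mnum, mden; cbn [krein ma mb mc md].
    rewrite Cconj_0_iff; split; intros H; [rewrite H; ring|].
    transitivity (ma M * 0 + mb M); [ring|rewrite H; ring].
Qed.

Lemma scalar_krein (M : mat) : scalar_mat (krein M) <-> scalar_mat M.
Proof.
  unfold scalar_mat; cbn [krein ma mb mc md]; rewrite !Cconj_0_iff; split; intros [H1 [H2 H3]]; repeat split; auto.
  - now apply Cconj_inj.
  - now rewrite H3.
Qed.

(** With zeta in common, equality of the other roots is equality of the root sums (a - d) / c.
    Cross-multiplied, it is also the lower left entry of M N = N M. *)
Lemma other_fix_commute (M N : mat) (zeta : C) : ~ scalar_mat M -> ~ scalar_mat N ->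
  fixes M zeta -> fixes N zeta ->
  other_fix M zeta = other_fix N zeta <-> mc M * (ma N - md N) = mc N * (ma M - md M).
Proof.
  intros HM HN FM FN.
  assert (NS : forall A, ~ scalar_mat A -> fixes A zeta -> mc A = 0 -> ma A - md A <> 0).
  { intros A HA FA EA E; assert (Ead : ma A = md A) by (transitivity (md A + (ma A - md A)); [ring|rewrite E; ring]).
    apply HA; repeat split; auto; rewrite (fixes_mb A zeta FA), EA, Ead; ring. }
  unfold other_fix; destruct (Ceq_dec (mc M) 0) as [EM|EM], (Ceq_dec (mc N) 0) as [EN|EN].
  - split; auto; intros _; rewrite EM, EN; ring.
  - split; [discriminate|]; intros H; exfalso; rewrite EM, Cmult_0_l in H; symmetry in H.
    apply Cmult_integral in H; destruct H; [contradiction|now apply (NS M)].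
  - split; [discriminate|]; intros H; exfalso; rewrite EN, Cmult_0_l in H.
    apply Cmult_integral in H; destruct H; [contradiction|now apply (NS N)].
  - split; intros H.
    + assert (H' : (ma M - md M - mc M * zeta) / mc M = (ma N - md N - mc N * zeta) / mc N) by congruence.
      transitivity (mc M * mc N * ((ma N - md N - mc N * zeta) / mc N + zeta)); [field; auto|].
      rewrite <- H'; field; auto.
    + f_equal.
      transitivity ((mc N * (ma M - md M) - mc N * mc M * zeta) / (mc M * mc N)); [field; auto|].
      rewrite <- H; field; auto.
Qed.

(** [fixes_mb] expresses the upper right entries through the others, so all entries of M N - N M
    reduce to the lower left one. *)
Lemma mmul_commute (M N : mat) (zeta : C) : fixes M zeta -> fixes N zeta ->
  mc M * (ma N - md N) = mc N * (ma M - md M) -> mmul M N = mmul N M.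
Proof.
  intros FM FN H; unfold mmul.
  assert (BM := fixes_mb M zeta FM); assert (BN := fixes_mb N zeta FN).
  assert (E1 : mb M * mc N = mb N * mc M).
  { rewrite BM, BN.
    transitivity (zeta * (mc M * mc N * zeta - mc N * (ma M - md M))); [ring|rewrite <- H; ring]. }
  f_equal.
  - rewrite E1; ring.
  - transitivity (ma N * mb M + mb N * md M + (mb N * (ma M - md M) - mb M * (ma N - md N))); [ring|].
    rewrite BM, BN.
    transitivity (ma N * (zeta * (mc M * zeta + md M - ma M)) + zeta * (mc N * zeta + md N - ma N) * md M
      + zeta * zeta * (mc N * (ma M - md M) - mc M * (ma N - md N))); [ring|rewrite H; ring].
  - transitivity (mc N * ma M + md N * mc M + (mc M * (ma N - md N) - mc N * (ma M - md M))); [ring|rewrite H; ring].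
  - transitivity (mb N * mc M + md M * md N); [ring|rewrite <- E1; ring].
Qed.

Lemma fixes_touches (M : mat) (zeta : C) : Cmod zeta = 1%R -> fixes M zeta -> touches M.
Proof. intros Hz HF; exists zeta; split; auto; rewrite HF, Cmod_mult, Hz; ring. Qed.

Lemma fixes_mmul (M N : mat) (zeta : C) : fixes M zeta -> fixes N zeta -> fixes (mmul M N) zeta.
Proof.
  intros FM FN; unfold fixes in *.
  transitivity (ma M * mnum N zeta + mb M * mden N zeta); [unfold mnum, mden, mmul; cbn; ring|].
  rewrite FN; transitivity (mnum M zeta * mden N zeta); [unfold mnum; ring|rewrite FM].
  transitivity (zeta * (mc M * (zeta * mden N zeta) + md M * mden N zeta)); [unfold mden; ring|].
  rewrite <- FN; unfold mnum, mden, mmul; cbn; ring.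
Qed.

Lemma ST_not_compact (P Q : mat) (Tp Tq S : op) : adjoint_setup P Q Tp Tq S -> touches (mmul P (krein Q)) ->
  ~ compact_on_D (compose_op S Tp).
Proof.
  intros HS HT; assert (HS' := HS); destruct HS' as [HP [HQ _]].
  assert (Z := Cmod_0_lt_1).
  assert (HM := selfmap_mmul _ _ HP (selfmap_krein Q HQ)).
  destruct (touches_touches_at _ HM HT) as [eta He].
  apply (not_compact_of_touch _ (mmul P (krein Q)) (mapp P 0) eta (kern (mapp Q 0)));
    auto using selfmap_mapp, InD_kern.
  intros w n Hw; now apply (ST_ftest P Q Tp Tq).
Qed.

Lemma TS_not_compact (P Q : mat) (Tp Tq S : op) : adjoint_setup P Q Tp Tq S -> touches (mmul (krein Q) P) ->
  ~ compact_on_D (compose_op Tp S).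
Proof.
  intros HS HT; assert (HS' := HS); destruct HS' as [HP [HQ _]].
  assert (Z := Cmod_0_lt_1).
  assert (HM := selfmap_mmul _ _ (selfmap_krein Q HQ) HP).
  destruct (touches_touches_at _ HM HT) as [eta He].
  apply (not_compact_of_touch _ (mmul (krein Q) P) 0 eta cst1); auto using InD_cst1.
  intros w n Hw; unfold compose_op; rewrite (TS_ftest P Q Tp Tq) by auto.
  assert (X : forall a b : C, a = a + b * 0) by (intros; ring); apply X.
Qed.

Lemma dval_0 (f : coefs) : coefs_bounded f -> dval f 0 = f 1%nat.
Proof.
  intros [B HB]; assert (Z : (Cmod 0 < 1)%R) by (rewrite Cmod_0; lra).
  unfold dval; rewrite Csum_incr by now apply Cabs_dval with B.
  rewrite (Csum_ext _ (fun n => 0 * 0 ^ n)) by (intros; cbn [Cpow]; ring).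
  rewrite Csum_scal by now apply Cabs_geom.
  cbn [Cpow INR]; ring.
Qed.

Lemma mapp_0_eq_0 (M : mat) : selfmap M -> mapp M 0 = 0 <-> mb M = 0.
Proof.
  intros HM; assert (Z : (Cmod 0 < 1)%R) by (rewrite Cmod_0; lra).
  assert (D := selfmap_mden M 0 HM Z); unfold mapp.
  assert (E : mnum M 0 = mb M) by (unfold mnum; ring); rewrite E; split; intros H.
  - transitivity (mb M / mden M 0 * mden M 0); [field; auto|rewrite H; ring].
  - rewrite H; field; auto.
Qed.

Lemma mder_0 (M : mat) : selfmap M -> mb M = 0 -> mder M 0 = ma M / md M.
Proof.
  intros HM HB; assert (Z : (Cmod 0 < 1)%R) by (rewrite Cmod_0; lra).
  assert (D := selfmap_mden M 0 HM Z); unfold mder, mdet, mden in *; rewrite Cmult_0_r, Cplus_0_l in *.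
  rewrite HB; field; auto.
Qed.

Lemma div_eq_1 (x y : C) : y <> 0 -> 1 - x / y = 0 -> x = y.
Proof.
  intros Hy H; transitivity (y - y * (1 - x / y)); [field; auto|rewrite H; ring].
Qed.

(** The test functions are z, which is [es 0], and 1. If phi(0) and psi(0) are both nonzero, the
    image of z has the z-coefficient phi(0) conj psi(0). If only phi(0) = 0, the image of 1 has the
    z-coefficient conj psi(0) (1 - phi'(0)). If psi(0) = 0, then sigma(z) = t z and the image of z
    has the value (1 - t) phi(0) at 0. A vanishing result would make phi or sigma the identity. *)
Lemma commutator_nonzero (P Q : mat) (Tp Tq S : op) (zeta : C) : adjoint_setup P Q Tp Tq S ->
  Cmod zeta = 1%R -> fixes P zeta -> fixes (krein Q) zeta -> ~ scalar_mat P -> ~ scalar_mat (krein Q) ->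
  mc P * (ma (krein Q) - md (krein Q)) = mc (krein Q) * (ma P - md P) ->
  nonzero_on_D (commutator S Tp).
Proof.
  intros HS Hz FP FX NP NX HC; assert (HS' := HS); destruct HS' as [HP [HQ [HTp [HTq HA]]]].
  assert (Z := Cmod_0_lt_1).
  assert (HX := selfmap_krein Q HQ).
  assert (HE := mmul_commute P (krein Q) zeta FP FX HC).
  assert (Hp := selfmap_mapp P 0 HP Z); assert (Hq := selfmap_mapp Q 0 HQ Z).
  assert (z0 : zeta <> 0) by (apply Cmod_gt_0; lra).
  assert (K1 : forall f, InD f -> commutator S Tp f 1%nat
     = fval f (mapp P 0) * Cconj (mapp Q 0) - f 0%nat * (dval (kern (mapp Q 0)) (mapp P 0) * mder P 0)).
  { intros f Hf; rewrite <- dval_0 by (apply InD_bounded; now apply (commutator_InD P Q Tp Tq)).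
    rewrite (commutator_dval P Q Tp Tq) by auto.
    rewrite (dval_kern _ 0) by auto; do 2 f_equal; field. }
  assert (Ez := InD_es 0 Z).
  assert (F1 : fval (es 0) (mapp P 0) = mapp P 0).
  { rewrite fval_es by auto; replace (1 - 0 * mapp P 0) with (RtoC 1) by ring; field. }
  assert (NS : forall A, selfmap A -> ~ scalar_mat A -> fixes A zeta -> mc A = 0 -> ma A <> md A).
  { intros A SA NA FA CA E; apply NA; repeat split; auto; rewrite (fixes_mb A zeta FA), CA, E; ring. }
  destruct (Ceq_dec (mapp Q 0) 0) as [q0|q0].
  - assert (bQ := proj1 (mapp_0_eq_0 Q HQ) q0).
    assert (cX : mc (krein Q) = 0) by (cbn [krein mc]; now apply Cconj_0_iff).
    assert (aX := NS _ HX NX FX cX).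
    assert (dX : md (krein Q) <> 0).
    { generalize (selfmap_mden _ 0 HX Z); unfold mden; now rewrite Cmult_0_r, Cplus_0_l. }
    exists (es 0); split; auto; exists 0%nat.
    rewrite (commutator_0 P Q Tp Tq) by auto.
    rewrite <- (adjoint_conj Q Tq S) by auto using InD_kern.
    assert (HSe := proj1 (HA _ Ez)).
    rewrite dinner_kern_r by auto.
    set (t := ma (krein Q) / md (krein Q)).
    assert (ES : forall n, S (es 0) n = 0 * cst1 n + t * es 0 n).
    { intros [|n].
      - rewrite (adjoint_0 Q Tq S) by auto; cbn [es cst1].
        assert (X : RtoC 0 = 0 * 1 + t * 0) by ring; exact X.
      - apply (dval_unique (S (es 0)) (fun n => 0 * cst1 n + t * es 0 n)); auto using InD_bounded, bounded_lin, InD_cst1.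
        intros z Hz'; rewrite (adjoint_dval Q Tq S), dval_lin by auto using InD_bounded, InD_cst1.
        assert (HXz := selfmap_mapp _ z HX Hz').
        rewrite !dval_es by auto.
        change (es 0 0%nat) with (RtoC 0).
        replace (1 - 0 * mapp (krein Q) z) with (RtoC 1) by ring; replace (1 - 0 * z) with (RtoC 1) by ring.
        unfold mder, mdet, mden; rewrite cX; unfold t; field; auto. }
    unfold fval at 2; rewrite (Csum_ext _ (fun n => (0 * cst1 n + t * es 0 n) * mapp P 0 ^ n)) by (intros; now rewrite ES).
    fold (fval (fun n => 0 * cst1 n + t * es 0 n) (mapp P 0)).
    rewrite fval_lin, F1 by auto using InD_bounded, InD_cst1.
    intros H.
    assert (H' : (1 - t) * mapp P 0 = 0) by (etransitivity; [|exact H]; ring).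
    apply Cmult_integral in H'; destruct H' as [H'|H'].
    + now apply aX, div_eq_1.
    + assert (bP := proj1 (mapp_0_eq_0 P HP) H').
      (* Here sigma is linear and phi(0) = 0; the commutation condition makes phi linear too, and
         fixing zeta leaves only the identity. *)
      rewrite cX, Cmult_0_l in HC; apply Cmult_integral in HC; destruct HC as [cP|E].
      * apply (NS P HP NP FP cP).
        assert (B := fixes_mb P zeta FP); rewrite bP, cP in B; symmetry in B.
        apply Cmult_integral in B; destruct B as [B|B]; [contradiction|].
        transitivity (md P - (0 * zeta + md P - ma P)); [ring|rewrite B; ring].
      * apply aX; transitivity (md (krein Q) + (ma (krein Q) - md (krein Q))); [ring|rewrite E; ring].
  - assert (q0' := Cconj_neq_0 _ q0).
    destruct (Ceq_dec (mapp P 0) 0) as [p0|p0].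
    + assert (bP := proj1 (mapp_0_eq_0 P HP) p0).
      exists cst1; split; [apply InD_cst1|]; exists 1%nat; rewrite K1 by apply InD_cst1.
      rewrite fval_cst1, dval_kern, p0, mder_0 by auto; intros H.
      assert (dP : md P <> 0).
      { generalize (selfmap_mden P 0 HP Z); unfold mden; now rewrite Cmult_0_r, Cplus_0_l. }
      assert (H' : Cconj (mapp Q 0) * (1 - ma P / md P) = 0).
      { etransitivity; [|exact H]; change (cst1 0%nat) with (RtoC 1); field; auto. }
      apply Cmult_integral in H'; destruct H' as [H'|H']; [contradiction|].
      apply div_eq_1 in H'; auto.
      assert (B := fixes_mb P zeta FP); rewrite bP, H' in B; symmetry in B.
      apply Cmult_integral in B; destruct B as [B|B]; [contradiction|].
      assert (B' : mc P * zeta = 0) by (rewrite <- B; ring).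
      apply Cmult_integral in B'; destruct B' as [B'|B']; [|contradiction].
      apply NP; repeat split; auto.
    + exists (es 0); split; auto; exists 1%nat; rewrite K1, F1 by auto.
      change (es 0 0%nat) with (RtoC 0); change C0 with (RtoC 0); intros H.
      apply (Cmult_neq_0 _ _ p0 q0'); etransitivity; [|exact H]; ring.
Qed.

(** * Necessity *)

Lemma mapp_closed (M : mat) (z : C) : selfmap M -> (Cmod z <= 1)%R -> (Cmod (mapp M z) <= 1)%R.
Proof.
  intros HM Hz; assert (D := selfmap_mden_closed M z HM Hz); assert (P := proj1 (Cmod_gt_0 _) D).
  unfold mapp; rewrite Cmod_div by auto; apply Rmult_le_reg_r with (Cmod (mden M z)); auto.
  unfold Rdiv; rewrite Rmult_assoc, Rinv_l, Rmult_1_r, Rmult_1_l by lra; now apply selfmap_closed.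
Qed.

Lemma mapp_boundary (M : mat) (z : C) : selfmap M -> (Cmod z <= 1)%R -> Cmod (mapp M z) = 1%R -> Cmod z = 1%R.
Proof.
  intros HM Hz H; destruct (Rle_lt_or_eq_dec _ _ Hz) as [L|]; auto.
  generalize (selfmap_mapp M z HM L); lra.
Qed.

Lemma mapp_inj (M : mat) (z w : C) : mdet M <> 0 -> mden M z <> 0 -> mden M w <> 0 ->
  mapp M z = mapp M w -> z = w.
Proof.
  intros HD Hz Hw H.
  assert (E : mnum M z * mden M w = mnum M w * mden M z).
  { transitivity (mapp M z * mden M z * mden M w); [unfold mapp; field; auto|].
    rewrite H; unfold mapp; field; auto. }
  assert (E' : mdet M * (z - w) = 0).
  { transitivity (mnum M z * mden M w - mnum M w * mden M z); [unfold mdet, mnum, mden; ring|rewrite E; ring]. }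
  apply Cmult_integral in E'; destruct E' as [|E']; [contradiction|].
  transitivity (w + (z - w)); [ring|rewrite E'; ring].
Qed.

Lemma Cmod_eq_mgap (M : mat) (z : C) : Cmod (mnum M z) = Cmod (mden M z) -> mgap M z = 0%R.
Proof. intros H; unfold mgap; rewrite !Cnorm2_Cmod, H; ring. Qed.

(** On the circle [mgap] is A + B + 2 Re (q z) and nonnegative; for q <> 0 it could vanish only at
    the unique minimizer. Two zeros give q = 0, so [mgap] is a multiple of 1 - |z|^2. *)
Lemma two_touches_aut (M : mat) (z1 z2 : C) : selfmap M -> Cmod z1 = 1%R -> Cmod z2 = 1%R -> z1 <> z2 ->
  Cmod (mnum M z1) = Cmod (mden M z1) -> Cmod (mnum M z2) = Cmod (mden M z2) -> is_disk_aut (mapp M).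
Proof.
  intros HM Hz1 Hz2 Hne T1 T2.
  set (A := (Cnorm2 (mc M) - Cnorm2 (ma M))%R); set (B := (Cnorm2 (md M) - Cnorm2 (mb M))%R).
  set (q := mc M * Cconj (md M) - ma M * Cconj (mb M)).
  assert (HQ : forall z, mgap M z = (A * Cnorm2 z + B + 2 * Re (q * z))%R) by (intros; apply mgap_expand).
  assert (G1 := Cmod_eq_mgap M z1 T1); assert (G2 := Cmod_eq_mgap M z2 T2).
  rewrite HQ, Cnorm2_Cmod, Hz1 in G1; rewrite HQ, Cnorm2_Cmod, Hz2 in G2.
  assert (Hge : forall z, Cmod z = 1%R -> (0 <= A + B + 2 * Re (q * z))%R).
  { intros z Hz; assert (L := selfmap_closed M z HM ltac:(lra)).
    assert (G : (0 <= mgap M z)%R).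
    { unfold mgap; rewrite !Cnorm2_Cmod; generalize (Cmod_ge_0 (mnum M z)); nra. }
    rewrite HQ, Cnorm2_Cmod, Hz in G; lra. }
  assert (q0 : q = 0).
  { destruct (Ceq_dec q 0) as [|Hq]; auto; exfalso; apply Hne.
    assert (Pq := proj1 (Cmod_gt_0 _) Hq).
    (* Re (q z) has a unique minimizer on the circle. *)
    destruct (circle_minimizer q) as [m [Hm Em]].
    assert (Hgm := Hge m Hm); rewrite Em in Hgm; unfold Re, RtoC in Hgm; cbn [fst] in Hgm.
    assert (U : forall z, Cmod z = 1%R -> (A * (1 * 1) + B + 2 * Re (q * z) = 0)%R -> z = m).
    { intros z Hz HG.
      assert (R1 : (Re (q * z) <= - Cmod q)%R) by lra.
      assert (R2 := Cmod_sqr (q * z)); rewrite Cmod_mult, Hz, Rmult_1_r in R2.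
      assert (R3 := Re_ge_Cmod (q * z)); rewrite Cmod_mult, Hz, Rmult_1_r in R3.
      assert (R4 : Re (q * z) = (- Cmod q)%R) by lra.
      assert (R5 : Im (q * z) = 0%R) by (rewrite R4 in R2; nra).
      assert (E : q * z = RtoC (- Cmod q)).
      { rewrite (surjective_pairing (q * z)); unfold Re, Im in R4, R5; rewrite R4, R5; reflexivity. }
      transitivity ((q * z) / q); [field; auto|rewrite E, <- Em; field; auto]. }
    rewrite (U z1 Hz1 G1), (U z2 Hz2 G2); reflexivity. }
  rewrite q0, Cmult_0_l in G1; change (Re 0) with 0%R in G1.
  assert (HB : B = (- A)%R) by lra.
  assert (HD : (Cnorm2 q - A * B = Cnorm2 (mdet M))%R) by (unfold q, A, B, mdet, Cnorm2; cbn; ring).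
  assert (Dp := Cnorm2_gt_0 _ (proj1 HM)).
  assert (Z := Cmod_0_lt_1).
  assert (P0 := proj1 (mgap_pos M 0) (proj2 HM 0 Z)).
  assert (HQ' : forall z, mgap M z = (- A * (1 - Cnorm2 z))%R).
  { intros z; rewrite HQ, q0, Cmult_0_l, HB; change (Re 0) with 0%R; ring. }
  rewrite HQ', Cnorm2_0 in P0.
  split.
  - intros z w Hz Hw H; apply in_disk_Cmod in Hz; apply in_disk_Cmod in Hw.
    apply (mapp_inj M); auto using selfmap_mden; apply HM.
  - intros w Hw; apply in_disk_Cmod in Hw.
    assert (Pa : (0 <= Cnorm2 (mc M))%R) by apply Cnorm2_pos.
    assert (Dn : ma M - mc M * w <> 0).
    { intros E; assert (E' : ma M = mc M * w) by (transitivity ((ma M - mc M * w) + mc M * w); [ring|rewrite E; ring]).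
      assert (N : (Cnorm2 (ma M) <= Cnorm2 (mc M))%R).
      { rewrite E', Cnorm2_mult; assert (Cnorm2 w <= 1)%R by (rewrite Cnorm2_Cmod; generalize (Cmod_ge_0 w); nra).
        generalize (Cnorm2_pos w); nra. }
      unfold A in P0; lra. }
    (* The inverse map at w. As [mgap] is a positive multiple of 1 - |z|^2, |M z| = |w| < 1 puts z
       in the disk. *)
    set (z := (md M * w - mb M) / (ma M - mc M * w)).
    assert (Ez : mden M z = mdet M / (ma M - mc M * w)) by (unfold mden, z, mdet; field; auto).
    assert (Dz : mden M z <> 0).
    { rewrite Ez; intros E; apply (proj1 HM); transitivity (mdet M / (ma M - mc M * w) * (ma M - mc M * w)); [field; auto|rewrite E; ring]. }
    assert (En : mnum M z = w * mden M z) by (unfold mnum, mden, z; field; auto).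
    exists z; split.
    + apply in_disk_Cmod.
      assert (Pz : (0 < mgap M z)%R).
      { apply mgap_pos; rewrite En, Cmod_mult; generalize (proj1 (Cmod_gt_0 _) Dz); nra. }
      rewrite HQ' in Pz; assert (Cnorm2 z < 1)%R by nra; now apply in_disk_Cmod.
    + now apply Cdiv_eq_iff.
Qed.

(** Inversion is the identity on the circle, so at a contact point z the Krein adjoint acts as the
    inverse of M: M sends its value back to z. *)
Lemma krein_touch (M : mat) (z : C) : selfmap M -> Cmod z = 1%R -> Cmod (mnum (krein M) z) = Cmod (mden (krein M) z) ->
  Cmod (mnum M (mapp (krein M) z)) = Cmod (mden M (mapp (krein M) z)).
Proof.
  intros HM Hz HT; assert (HX := selfmap_krein M HM).
  assert (D := selfmap_mden_closed _ z HX ltac:(lra)).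
  set (w := mapp (krein M) z).
  assert (Hw : Cmod w = 1%R).
  { unfold w, mapp; rewrite Cmod_div, HT by auto; apply Rinv_r; now apply Rgt_not_eq, Cmod_gt_0. }
  assert (E : mnum (krein M) z = w * mden (krein M) z) by (unfold w, mapp; field; auto).
  assert (E' := f_equal Cconj E); unfold mnum, mden in E'; cbn [krein ma mb mc md] in E'.
  rewrite Cmult_conj, !Cplus_conj, !Cmult_conj, !Copp_conj, !Cconj_conj in E'.
  assert (cz := circle_conj z Hz); assert (cw := circle_conj w Hw).
  assert (F : mnum M w = z * mden M w).
  { unfold mnum, mden.
    transitivity (z * Cconj z * (ma M * w) + mb M); [rewrite cz; ring|].
    transitivity (z * w * (ma M * Cconj z + - mc M) + (z * w * mc M + mb M)); [ring|].
    rewrite E'.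
    transitivity (w * Cconj w * (- mb M * (z * Cconj z) + z * md M) + (z * w * mc M + mb M)); [ring|rewrite cw, cz; ring]. }
  rewrite F, Cmod_mult, Hz; ring.
Qed.

Definition one_touch (M : mat) : Prop := forall z1 z2, Cmod z1 = 1%R -> Cmod z2 = 1%R ->
  Cmod (mapp M z1) = 1%R -> Cmod (mapp M z2) = 1%R -> z1 = z2.

Lemma touch_mapp (M : mat) (z : C) : mden M z <> 0 ->
  Cmod (mapp M z) = 1%R <-> Cmod (mnum M z) = Cmod (mden M z).
Proof.
  intros D; assert (P := proj1 (Cmod_gt_0 _) D); unfold mapp; rewrite Cmod_div by auto; split; intros H.
  - transitivity (Cmod (mnum M z) / Cmod (mden M z) * Cmod (mden M z))%R; [field; lra|rewrite H; ring].
  - rewrite H; field; lra.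
Qed.

Lemma not_aut_one_touch (M : mat) : selfmap M -> ~ is_disk_aut (mapp M) -> one_touch M.
Proof.
  intros HM HN z1 z2 H1 H2 T1 T2; destruct (Ceq_dec z1 z2) as [|Hne]; auto; exfalso; apply HN.
  apply two_touches_aut with z1 z2; auto; apply touch_mapp; auto; apply selfmap_mden_closed; auto; lra.
Qed.

(** The Krein adjoint maps its contact points injectively to contact points of M. *)
Lemma krein_not_aut_one_touch (M : mat) : selfmap M -> ~ is_disk_aut (mapp M) -> one_touch (krein M).
Proof.
  intros HM HN z1 z2 H1 H2 T1 T2; assert (HX := selfmap_krein M HM).
  assert (D1 := selfmap_mden_closed _ z1 HX ltac:(lra)); assert (D2 := selfmap_mden_closed _ z2 HX ltac:(lra)).
  apply (mapp_inj (krein M)); auto; [apply HX|].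
  apply (not_aut_one_touch M HM HN); auto; apply touch_mapp;
    try (apply selfmap_mden_closed; auto; lra); apply krein_touch; auto; now apply touch_mapp.
Qed.

Lemma fixes_mapp (M : mat) (z : C) : mden M z <> 0 -> fixes M z <-> mapp M z = z.
Proof. intros D; unfold fixes, mapp; now rewrite Cdiv_eq_iff. Qed.

Lemma three_fixed_scalar (M : mat) (x y z : C) : x <> y -> x <> z -> y <> z ->
  fixes M x -> fixes M y -> fixes M z -> scalar_mat M.
Proof.
  intros Hxy Hxz Hyz Fx Fy Fz.
  apply (fixes_other M x y Fx) in Fy; destruct Fy as [Fy|Fy]; [now destruct Hxy|].
  apply (fixes_other M x z Fx) in Fz; destruct Fz as [Fz|Fz]; [now destruct Hxz|].
  assert (E : mc M * (y - z) = 0) by (transitivity (mc M * y - mc M * z); [ring|rewrite Fy, Fz; ring]).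
  apply Cmult_integral in E; destruct E as [E|E].
  - assert (E2 : ma M = md M).
    { transitivity (md M + (ma M - md M - mc M * x) + mc M * x); [ring|rewrite <- Fy, E; ring]. }
    repeat split; auto; rewrite (fixes_mb M x Fx), E, E2; ring.
  - exfalso; apply Hyz; transitivity (z + (y - z)); [ring|rewrite E; ring].
Qed.

(* A touches the circle at one point only, and both B zeta0 and zeta0 are such points;
   if A zeta0 were another point, B would have the three fixed points zeta0, A zeta0, A (A zeta0). *)
Lemma common_fixed_point (A B : mat) (z0 : C) : selfmap A -> selfmap B -> one_touch A -> ~ scalar_mat B ->
  (forall z, (Cmod z <= 1)%R -> mapp A (mapp B z) = mapp B (mapp A z)) ->
  Cmod z0 = 1%R -> Cmod (mapp A (mapp B z0)) = 1%R ->
  exists zeta, Cmod zeta = 1%R /\ fixes A zeta /\ fixes B zeta.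
Proof.
  intros HA HB HT NB HC Hz H.
  assert (DA : forall z, (Cmod z <= 1)%R -> mden A z <> 0) by (intros; now apply selfmap_mden_closed).
  assert (DB : forall z, (Cmod z <= 1)%R -> mden B z <> 0) by (intros; now apply selfmap_mden_closed).
  assert (z01 : (Cmod z0 <= 1)%R) by lra.
  assert (Bz := mapp_closed B z0 HB z01); assert (Az := mapp_closed A z0 HA z01).
  assert (Bz1 := mapp_boundary A _ HA Bz H).
  assert (H' := H); rewrite HC in H' by lra.
  assert (Az1 := mapp_boundary B _ HB Az H').
  assert (EB : mapp B z0 = z0) by (apply HT; auto).
  set (y := mapp A z0) in *.
  assert (EBy : mapp B y = y) by (unfold y; rewrite <- HC, EB by lra; reflexivity).
  destruct (Ceq_dec y z0) as [E|E].
  - exists z0; repeat split; auto; apply fixes_mapp; auto.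
  - exfalso; apply NB.
    set (t := mapp A y).
    assert (Ht := mapp_closed A y HA Az); fold t in Ht.
    (* If A y were on the circle, y would be a second contact point of A. So t lies inside the disk
       and differs from z0 and y. *)
    assert (Ht1 : Cmod t <> 1%R) by (intros F; apply E; apply HT; auto).
    assert (EBt : mapp B t = t) by (unfold t; rewrite <- HC, EBy by lra; reflexivity).
    apply (three_fixed_scalar B z0 y t); auto.
    + intros F; apply Ht1; now rewrite <- F.
    + intros F; apply Ht1; now rewrite <- F.
    + apply fixes_mapp; auto.
    + apply fixes_mapp; auto.
    + apply fixes_mapp; auto.
Qed.

Lemma mapp_scalar (M : mat) (z : C) : selfmap M -> scalar_mat M -> (Cmod z < 1)%R -> mapp M z = z /\ mder M z = 1.
Proof.
  intros HM [B [C0' E]] Hz; assert (D := selfmap_mden M z HM Hz).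
  assert (D' : md M <> 0) by (unfold mden in D; rewrite C0' in D; intros F; apply D; rewrite F; ring).
  unfold mapp, mder, mdet, mnum, mden; rewrite B, C0', E.
  assert (D2 : 0 * z + md M = md M) by ring; rewrite D2; split; field; auto.
Qed.

Lemma comp_scalar (M : mat) (T : op) (f : coefs) : selfmap M -> scalar_mat M -> is_comp_op (mapp M) T -> InD f -> T f = f.
Proof.
  intros HM HS HT Hf; apply functional_extensionality.
  apply fval_unique; auto using InD_bounded; [apply InD_bounded, (comp_InD _ _ _ HT Hf)|].
  intros z Hz; rewrite (comp_op_fval _ _ _ _ HT Hf Hz); now rewrite (proj1 (mapp_scalar M z HM HS Hz)).
Qed.

Lemma adjoint_scalar (M : mat) (T S : op) (g : coefs) : selfmap M -> scalar_mat M -> is_comp_op (mapp M) T ->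
  is_adjoint T S -> InD g -> S g = g.
Proof.
  intros HM HS HT HA Hg; assert (HSg := proj1 (HA g Hg)).
  assert (Z := Cmod_0_lt_1).
  assert (HX := selfmap_krein M HM); assert (SX := proj2 (scalar_krein M) HS).
  apply functional_extensionality; intros [|n].
  - now apply (adjoint_0 M T S).
  - apply dval_unique; auto using InD_bounded.
    intros z Hz; rewrite (adjoint_dval M T S) by auto.
    rewrite (proj1 (mapp_scalar M 0 HM HS Z)), dval_kern by auto.
    destruct (mapp_scalar _ z HX SX Hz) as [E1 E2]; rewrite E1, E2, Cconj_RtoC.
    replace (1 - 0 * z) with (RtoC 1) by ring; field.
Qed.

Lemma csub_self (f : coefs) (n : nat) : csub f f n = C0.
Proof. change (f n - f n = 0 :> C); ring. Qed.

(** If phi or psi is the identity, one of the two operators is the identity on the Dirichlet space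
    and commutes with the other. *)
Lemma nonzero_not_scalar (P Q : mat) (Tp Tq S : op) : adjoint_setup P Q Tp Tq S -> nonzero_on_D (commutator S Tp) ->
  ~ scalar_mat P /\ ~ scalar_mat (krein Q).
Proof.
  intros [HP [HQ [HTp [HTq HA]]]] [f [Hf [n Hn]]]; split; intros HS; apply Hn; unfold commutator.
  - rewrite (comp_scalar P Tp f), (comp_scalar P Tp (S f)) by (auto; apply (HA f Hf)); apply csub_self.
  - assert (HS' := proj1 (scalar_krein Q) HS).
    rewrite (adjoint_scalar Q Tq S f), (adjoint_scalar Q Tq S (Tp f)) by (auto; exact (comp_InD _ _ _ HTp Hf)).
    apply csub_self.
Qed.

Lemma necessity (P Q : mat) (Tp Tq S : op) : adjoint_setup P Q Tp Tq S ->
  ~ (is_disk_aut (mapp P) /\ is_disk_aut (mapp Q)) ->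
  nontrivially_compact_comm S Tp ->
  exists zeta, Cmod zeta = 1%R /\ fixes P zeta /\ fixes (krein Q) zeta /\
    ~ scalar_mat P /\ ~ scalar_mat (krein Q) /\ other_fix P zeta = other_fix (krein Q) zeta.
Proof.
  intros HS HN [HC [HZ [HST _]]]; assert (HS' := HS); destruct HS' as [HP [HQ _]].
  destruct (nonzero_not_scalar P Q Tp Tq S HS HZ) as [NP NX].
  assert (HX := selfmap_krein Q HQ); set (X := krein Q) in *.
  assert (HPX := selfmap_mmul P X HP HX); assert (HXP := selfmap_mmul X P HX HP).
  assert (Z := Cmod_0_lt_1).
  destruct (classic (touches (mmul P X))) as [HT|HT]; [|now destruct (HST (ST_compact P Q Tp Tq S HS HT))].
  destruct (touches_touches_at _ HPX HT) as [eta He].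
  destruct (compact_difference (commutator S Tp) (mmul P X) (mmul X P) (mapp P 0) eta (kern (mapp Q 0))) as [Z0 [Z1 Z2]];
    auto using selfmap_mapp, InD_kern.
  { intros w n Hw; unfold commutator, csub; change (Csub ?a ?b) with (a - b : C).
    rewrite (ST_ftest P Q Tp Tq), (TS_ftest P Q Tp Tq) by auto; fold X.
    assert (Y : forall p q r : C, p + r - q = p - q + r) by (intros; ring); apply Y. }
  destruct (hW_zero_proportional _ _ eta HPX HXP (proj1 He) Z0 Z1 Z2) as [l [l0 [Ea [Eb [Ec Ed]]]]].
  assert (Nl : forall z, mnum (mmul X P) z = l * mnum (mmul P X) z) by (intros; unfold mnum; rewrite Ea, Eb; ring).
  assert (Dl : forall z, mden (mmul X P) z = l * mden (mmul P X) z) by (intros; unfold mden; rewrite Ec, Ed; ring).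
  assert (DP : forall z, (Cmod z <= 1)%R -> mden P z <> 0) by (intros; now apply selfmap_mden_closed).
  assert (DX : forall z, (Cmod z <= 1)%R -> mden X z <> 0) by (intros; now apply selfmap_mden_closed).
  assert (Comm : forall z, (Cmod z <= 1)%R -> mapp P (mapp X z) = mapp X (mapp P z)).
  { intros z Hz; rewrite <- !mapp_mmul by (auto using mapp_closed).
    assert (D := selfmap_mden_closed _ z HPX Hz).
    unfold mapp; rewrite Nl, Dl; field; auto. }
  assert (CF : exists zeta, Cmod zeta = 1%R /\ fixes P zeta /\ fixes X zeta).
  { destruct HT as [z0 [Hz0 HT]].
    assert (Hz1 : (Cmod z0 <= 1)%R) by lra.
    apply touch_mapp in HT; [|now apply selfmap_mden_closed].
    rewrite mapp_mmul in HT by auto using mapp_closed.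
    (* The map with a single contact point is phi, or sigma when phi is an automorphism, since psi
       is not one then. *)
    destruct (classic (is_disk_aut (mapp P))) as [AP|AP].
    - destruct (common_fixed_point X P z0) as [zeta [H1 [H2 H3]]]; auto.
      + apply krein_not_aut_one_touch; auto.
      + intros; symmetry; auto.
      + rewrite <- Comm by auto; auto.
      + exists zeta; auto.
    - destruct (common_fixed_point P X z0) as [zeta [H1 [H2 H3]]]; auto.
      + apply not_aut_one_touch; auto.
      + exists zeta; auto. }
  destruct CF as [zeta [Hz [FP FX]]]; exists zeta; repeat (split; [auto; fail|]); repeat split; auto.
  apply other_fix_commute; auto.
  assert (l1 : l = 1).
  { assert (E := Dl zeta).
    assert (Hz1 : (Cmod zeta <= 1)%R) by lra.
    rewrite !mden_mmul in E by auto.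
    rewrite (proj1 (fixes_mapp P zeta (DP _ Hz1)) FP), (proj1 (fixes_mapp X zeta (DX _ Hz1)) FX) in E.
    assert (N := Cmult_neq_0 _ _ (DP _ Hz1) (DX _ Hz1)).
    transitivity (l * (mden P zeta * mden X zeta) / (mden P zeta * mden X zeta)); [field; auto|].
    rewrite <- E; field; auto. }
  rewrite l1, Cmult_1_l in Ec; cbn [mmul mc] in Ec.
  transitivity (mc P * ma X + md P * mc X - mc X * md P - mc P * md X); [ring|].
  rewrite <- Ec; ring.
Qed.

(** * From matrices back to the symbols and fixed points of the statement *)

Lemma comp_op_ext (phi phi' : C -> C) (T : op) : (forall z, phi z = phi' z) -> is_comp_op phi T -> is_comp_op phi' T.
Proof.
  intros E H f Hf; destruct (H f Hf) as [H1 H2]; split; auto.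
  intros z Hz; destruct (H2 z Hz) as [v [V1 V2]]; exists v; rewrite <- E; auto.
Qed.

Lemma disk_aut_ext (phi phi' : C -> C) : (forall z, phi z = phi' z) -> is_disk_aut phi -> is_disk_aut phi'.
Proof.
  intros E [H1 H2]; split.
  - intros z w Hz Hw H; apply H1; auto; now rewrite !E.
  - intros w Hw; destruct (H2 w Hw) as [z [Hz Ez]]; exists z; split; auto; now rewrite <- E.
Qed.

Lemma scalar_efix (M : mat) (p : ext) : scalar_mat M -> efix M p.
Proof.
  intros [B [C0' E]]; destruct p as [z|]; [|exact C0'].
  cbn; unfold fixes, mnum, mden; rewrite B, C0', E.
  assert (X : forall a b : C, a * b + 0 = b * (0 * b + a)) by (intros; ring); apply X.
Qed.

(** The identity fixes both infinity and 0; neither is zeta, and [a] cannot be both. *)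
Lemma not_scalar_of_efix (M : mat) (zeta : C) (a : ext) : (forall p, efix M p -> p = Some zeta \/ p = a) -> Cmod zeta = 1%R ->
  ~ scalar_mat M.
Proof.
  intros H Hz HS; assert (N : zeta <> 0) by (apply Cmod_gt_0; lra).
  destruct (H None (scalar_efix M None HS)) as [F|F]; [discriminate|].
  destruct (H (Some (RtoC 0)) (scalar_efix M _ HS)) as [G|G].
  - injection G as G; now apply N.
  - rewrite <- F in G; discriminate.
Qed.

Lemma sufficiency (P Q : mat) (Tp Tq S : op) (zeta : C) : adjoint_setup P Q Tp Tq S ->
  Cmod zeta = 1%R -> fixes P zeta -> fixes (krein Q) zeta -> ~ scalar_mat P -> ~ scalar_mat (krein Q) ->
  other_fix P zeta = other_fix (krein Q) zeta -> nontrivially_compact_comm S Tp.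
Proof.
  intros HS Hz FP FX NP NX HO.
  apply other_fix_commute in HO; auto.
  assert (HE := mmul_commute P (krein Q) zeta FP FX HO).
  assert (HT := fixes_touches _ zeta Hz (fixes_mmul _ _ zeta FP FX)).
  split; [now apply (commutator_compact P Q Tp Tq)|].
  split; [now apply (commutator_nonzero P Q Tp Tq S zeta)|].
  split; [now apply (ST_not_compact P Q Tp Tq)|].
  apply (TS_not_compact P Q Tp Tq); auto; now rewrite <- HE.
Qed.

Theorem theorem4p4
  (a1 b1 c1 d1 : Cx) (a2 b2 c2 d2 : Cx)
  (Hphi : lf_selfmap a1 b1 c1 d1) (Hpsi : lf_selfmap a2 b2 c2 d2)
  (Hnotaut : ~ (is_disk_aut (lft a1 b1 c1 d1) /\ is_disk_aut (lft a2 b2 c2 d2)))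
  (Cphi Cpsi Cpsi_star : op)
  (HCphi : is_comp_op (lft a1 b1 c1 d1) Cphi)
  (HCpsi : is_comp_op (lft a2 b2 c2 d2) Cpsi)
  (Hadj : is_adjoint Cpsi Cpsi_star) :
  nontrivially_compact_comm Cpsi_star Cphi <->
  ((exists zeta, parabolic_at a1 b1 c1 d1 zeta /\ parabolic_at a2 b2 c2 d2 zeta)
   \/
   (is_hyperbolic a1 b1 c1 d1 /\ is_hyperbolic a2 b2 c2 d2 /\
    exists zeta (a : ext), on_circle zeta /\
      (forall p, lft_fixed a1 b1 c1 d1 p <-> (p = Some zeta \/ p = a)) /\
      (forall p, lft_fixed a2 b2 c2 d2 p <->
                   (p = Some zeta \/ exists q, inv_conj_is a q /\ p = q)))).
Proof.
  set (P := Mat a1 b1 c1 d1); set (Q := Mat a2 b2 c2 d2).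
  assert (HP : selfmap P) by (apply selfmap_mself, lf_selfmap_mself; exact Hphi).
  assert (HQ : selfmap Q) by (apply selfmap_mself, lf_selfmap_mself; exact Hpsi).
  assert (HS : adjoint_setup P Q Cphi Cpsi Cpsi_star).
  { split; [exact HP|split; [exact HQ|split; [|split; [|exact Hadj]]]].
    - revert HCphi; apply comp_op_ext; intros z; apply lft_mob.
    - revert HCpsi; apply comp_op_ext; intros z; apply lft_mob. }
  assert (FixP : forall p, lft_fixed a1 b1 c1 d1 p <-> efix P p) by (intros p; apply lft_fixed_efix, HP).
  (* The map psi enters through sigma, whose fixed points are those of psi inverted in the
     circle. *)
  assert (FixX : forall p, lft_fixed a2 b2 c2 d2 p <-> efix (krein Q) (invc p)).
  { intros p; rewrite efix_krein, invc_invc; apply lft_fixed_efix, HQ. }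
  assert (Inv : forall (a : ext) p, (exists q, inv_conj_is a q /\ p = q) <-> invc p = a).
  { intros a p; split.
    - intros [q [H ->]]; apply inv_conj_is_invc in H; subst q; apply invc_invc.
    - intros <-; exists p; split; auto; apply inv_conj_is_invc; now rewrite invc_invc. }
  split.
  - intros H.
    destruct (necessity P Q Cphi Cpsi Cpsi_star HS) as [zeta [Hz [FP [FX [NP [NX HO]]]]]]; auto.
    { intros [A1 A2]; apply Hnotaut; split; [revert A1|revert A2]; apply disk_aut_ext; intros z; symmetry; apply lft_mob. }
    assert (EP := fun p => efix_other P zeta p FP NP).
    assert (EX := fun p => efix_other (krein Q) zeta p FX NX).
    rewrite <- HO in EX; set (a := other_fix P zeta) in *.
    assert (Iz := invc_circle zeta Hz).
    assert (IzE : forall p, invc p = Some zeta <-> p = Some zeta).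
    { intros p; split; intros E; [now rewrite <- (invc_invc p), E|now rewrite E]. }
    assert (Oz : on_circle zeta) by now apply on_circle_Cmod.
    assert (Z1 : lft_fixed a1 b1 c1 d1 (Some zeta)) by (apply FixP, EP; auto).
    assert (Z2 : lft_fixed a2 b2 c2 d2 (Some zeta)) by (apply FixX; rewrite Iz; apply EX; auto).
    (* A double root zeta gives case (i), a second root gives case (ii). *)
    destruct (classic (a = Some zeta)) as [Ha|Ha]; [left|right].
    + exists zeta; split; split; auto; split; auto; intros p Hp.
      * apply FixP, EP in Hp; rewrite Ha in Hp; tauto.
      * apply FixX, EX in Hp; rewrite Ha in Hp; apply IzE; tauto.
    + split; [exists zeta; repeat split; auto; try apply Z1; exists a; split; auto; apply FixP, EP; auto|].
      split.
      { exists zeta; repeat split; auto; try apply Z2; exists (invc a); split.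
        - intros E; apply Ha; rewrite <- (invc_invc a), E; exact Iz.
        - apply FixX; rewrite invc_invc; apply EX; auto. }
      exists zeta, a; split; auto; split; intros p.
      * rewrite FixP; apply EP.
      * rewrite FixX, EX, Inv, IzE; tauto.
  - intros H.
    (* Both cases in one form: phi and sigma have exactly the fixed points zeta and a, where a =
       zeta in the parabolic case. *)
    assert (K : exists zeta a, Cmod zeta = 1%R /\ (forall p, efix P p <-> (p = Some zeta \/ p = a))
      /\ (forall p, efix (krein Q) p <-> (p = Some zeta \/ p = a))).
    { destruct H as [[zeta [[Oz [F1 U1]] [_ [F2 U2]]]]|[_ [_ [zeta [a [Oz [H1 H2]]]]]]].
      - assert (Hz := proj1 (on_circle_Cmod zeta) Oz); assert (Iz := invc_circle zeta Hz).
        exists zeta, (Some zeta); split; auto; split; intros p.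
        + split; [intros Hp; left; apply U1, FixP; auto|intros [->| ->]; apply FixP; auto].
        + rewrite <- (invc_invc p) at 1; rewrite <- FixX; split.
          * intros Hp; left; rewrite <- (invc_invc p), (U2 _ Hp); auto.
          * intros E; assert (Ep : invc p = Some zeta) by (destruct E as [E|E]; rewrite E; exact Iz).
            rewrite Ep; exact F2.
      - assert (Hz := proj1 (on_circle_Cmod zeta) Oz); assert (Iz := invc_circle zeta Hz).
        exists zeta, a; split; auto; split; intros p.
        + rewrite <- FixP; apply H1.
        + rewrite <- (invc_invc p) at 1; rewrite <- FixX, H2, Inv, invc_invc; split; intros [E|E]; auto; left.
          * now rewrite <- (invc_invc p), E.
          * now rewrite E. }
    destruct K as [zeta [a [Hz [KP KX]]]].
    assert (NP := not_scalar_of_efix P zeta a (fun p => proj1 (KP p)) Hz).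
    assert (NX := not_scalar_of_efix (krein Q) zeta a (fun p => proj1 (KX p)) Hz).
    assert (FP : fixes P zeta) by (apply (KP (Some zeta)); auto).
    assert (FX : fixes (krein Q) zeta) by (apply (KX (Some zeta)); auto).
    apply (sufficiency P Q Cphi Cpsi Cpsi_star zeta); auto.
    assert (EP := fun p => efix_other P zeta p FP NP).
    assert (EX := fun p => efix_other (krein Q) zeta p FX NX).
    (* The sets {zeta, [other_fix]} and {zeta, a} coincide for each of the two maps, which forces
       [other_fix] = a even when a set collapses to zeta. *)
    assert (O1 := proj1 (KP _) (proj2 (EP (other_fix P zeta)) (or_intror eq_refl))).
    assert (O2 := proj1 (KX _) (proj2 (EX (other_fix (krein Q) zeta)) (or_intror eq_refl))).
    assert (A1 := proj1 (EP a) (proj2 (KP a) (or_intror eq_refl))).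
    assert (A2 := proj1 (EX a) (proj2 (KX a) (or_intror eq_refl))).
    destruct O1 as [O1|O1], O2 as [O2|O2]; try congruence.
    + rewrite O1 in *; destruct A1; congruence.
    + rewrite O2 in *; destruct A2; congruence.
Qed.
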